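(* Let $K$ be a finite extension of $\mathbb{Q}_p$ and let $(t^1,m_1),\dots,(t^h,m_h)$ be pairs of integers with $t^1<\dots<t^h$. There exists an elementary abelian $p$-extension $M/K$ whose upper ramification jumps, with their sizes, are exactly $(t^1,m_1),\dots,(t^h,m_h)$ if and only if the following conditions hold: (1) for every $i=1,\dots,h$, $1\le t^i<\frac{pe_K}{p-1}$ and $(t^i,p)=1$, with only two possible exceptions, namely $t^1=-1$ and, in the case when $\zeta_p\in K$, $t^h=\frac{pe_K}{p-1}$; (2) $1\le m_i\le f_K$ for every $i=1,\dots,h$; moreover $m_1=1$ if $t^1=-1$, and $m_h=1$ if $t^h=\frac{pe_K}{p-1}$. In this case $[M:K]=p^{\sum_{i=1}^h m_i}$.
   Context: $p$ is a prime; $e_K,f_K$ are the ramification index and inertial degree of $K/\mathbb{Q}_p$; $\zeta_p$ is a primitive $p$-th root of unity. For a finite Galois extension with group $G$, $G^\nu$ ($\nu\ge-1$) are the upper-numbering ramification subgroups, with $G^{-1}=G$ and $G^0$ the inertia group. An integer $t$ is an upper ramification jump if $G^t\ne G^u$ for all $u>t$; if $G$ is elementary abelian and $|G^t/G^{t+1}|=p^m$, $m$ is the size of the jump $t$, and the pair $(t,m)$ is called the ramification jump. *)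

(* Defs.v *)
From HB Require Import structures.
From mathcomp Require Import boolp.
From mathcomp Require Import all_boot all_order all_algebra all_fingroup all_solvable all_field.

Set Implicit Arguments. Unset Strict Implicit. Unset Printing Implicit Defensive.
Import Order.TTheory GRing.Theory Num.Theory.
Local Open Scope ring_scope.

(* "x has valuation >= n", with the convention w 0 = +oo. *)
Definition vge (F : nzRingType) (w : F -> int) (x : F) (n : int) : bool :=
  (x == 0) || (n <= w x).

(* Normalized discrete valuation (value group = Z) on a ring, values on
   nonzero elements; the value at 0 is irrelevant (treated as +oo via vge). *)
Record dvaluation (F : nzRingType) (w : F -> int) : Prop := {
  dv_mul : forall x y : F, x != 0 -> y != 0 -> w (x * y) = w x + w y;
  dv_add : forall (x y : F) (n : int), vge w x n -> vge w y n -> vge w (x + y) n;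
  dv_norm : exists x : F, x != 0 /\ w x = 1 }.

(* K (with normalized valuation v) is a finite extension of Q_p, with
   absolute ramification index e (= e_K = v(p)) and inertial degree f (= f_K):
   a characteristic 0 field, complete for a normalized discrete valuation,
   whose residue field has exactly p^f elements and whose residue
   characteristic is p (v(p) = e > 0). *)
Record padic_field (p : nat) (K : fieldType) (v : K -> int) (e f : nat) : Prop := {
  pf_char0 : forall n : nat, (0 < n)%N -> n%:R != 0 :> K;
  pf_val : dvaluation v;
  pf_complete : forall a : nat -> K,
      (forall N : int, exists n0 : nat, forall i j : nat,
          (n0 <= i)%N -> (n0 <= j)%N -> vge v (a i - a j) N) ->
      exists l : K, forall N : int, exists n0 : nat, forall i : nat,
          (n0 <= i)%N -> vge v (a i - l) N;
  pf_e_pos : (0 < e)%N;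
  pf_e : v (p%:R) = e%:Z;
  pf_f : exists s : seq K,
      [/\ size s = (p ^ f)%N,
          all (fun x => vge v x 0) s,
          (forall i j : nat, (i < size s)%N -> (j < size s)%N -> i <> j ->
              ~~ vge v (nth 0 s i - nth 0 s j) 1)
        & forall x : K, vge v x 0 -> exists2 y, y \in s & vge v (x - y) 1] }.

Section Ramification.
Variables (K : fieldType) (v : K -> int) (M : splittingFieldType K) (w : M -> int).

Definition ext_val : Prop :=
  dvaluation w /\ exists e0 : int, 0 < e0 /\ forall k : K, k != 0 -> w (k%:A) = e0 * v k.

Definition lower_ram (n : int) : {set gal_of {:M}} :=
  [set s : gal_of {:M} | (s \in ('Gal({:M} / 1%AS))%g) &&
     `[< forall x : M, vge w x 0 -> vge w (s x - x) (n + 1) >] ].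

(* Herbrand function phi at integer points:
   phi(n) = int_0^n dt / [G_0 : G_t] = (1/|G_0|) sum_{i=1}^n |G_i| for n >= 0,
   phi(n) = n for n <= 0. *)
Definition herbrand (n : int) : rat :=
  if n < 0 then n%:~R
  else (\sum_(1 <= i < `|n|%N.+1) (#|lower_ram i%:Z|)%:R) / (#|lower_ram 0|)%:R.

(* Upper numbering: G^u = G_{psi(u)}; since G_x = G_{ceil x} and phi is
   increasing, s in G^u iff s in G_n for some integer n >= -1 with phi(n) >= u.
   (For u < -1 this gives the whole group, as G^u = G^{-1} = G.) *)
Definition upper_ram (u : rat) : {set gal_of {:M}} :=
  [set s : gal_of {:M} |
     `[< exists n : int, -1 <= n /\ s \in lower_ram n /\ u <= herbrand n >] ].

Definition upper_jump (t : int) : Prop :=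
  forall u : rat, t%:~R < u -> upper_ram t%:~R != upper_ram u.

Definition has_upper_jumps (p h : nat) (t m : 'I_h -> int) : Prop :=
  (forall s : int, upper_jump s <-> exists i : 'I_h, t i = s) /\
  (forall i : 'I_h, (#|upper_ram (t i)%:~R|)%:R =
                    (p%:R : rat) ^ (m i) * (#|upper_ram (t i + 1)%:~R|)%:R).

End Ramification.

(* Main.v *)
Require Import Defs.
From HB Require Import structures.
From mathcomp Require Import boolp.
From mathcomp Require Import all_boot all_order all_algebra all_fingroup all_solvable all_field.
From mathcomp Require Import zify ring lra.

Set Implicit Arguments. Unset Strict Implicit. Unset Printing Implicit Defensive.
Import Order.TTheory GRing.Theory Num.Theory.
Local Open Scope ring_scope.

(** No class field theory is used.  A universal element [xs] of [M], the sum of a Teichmüller-like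
    lift of a generator of the residue field and of a uniformizer, satisfies: [Z[xs]] is dense in
    the ring of integers.  Hence [s] lies in the lower group of index [n] iff
    [w (s xs - xs) >= n + 1], and the upper numbering reads off the function
    [c |-> \sum_(r in G) min (w (r xs - xs)) c].

    Necessity: let [s0] have upper value [t], let [A] be the upper group at [t] and [B] the one just
    above, and let [F] be the fixed field of a subgroup containing [B] and meeting [A] in [B].
    Then [F/K] has the single jump [t], that is, [s - 1] shifts the valuation of [F] by exactly [t]
    on elements of valuation prime to [p].  Expanding [s^p = 1] as
    [p d + ... + d^p = 0] with [d = s - 1] gives [(p - 1) t < p e] if [p] does not divide [t], and
    [(p - 1) t = p e] together with a primitive [p]-th root of unity otherwise.  The residues of
    [(s pi / pi - 1) / pi^t] embed [A/B] into the residue field, so its order is at most [p^f].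

    Sufficiency: for [t] prime to [p], let [P] be a monic lift of an additive polynomial over the
    residue field with [p^m] rational roots, and adjoin the roots of [P(X) = al] with
    [v al = - t].  Two roots differ by a unit congruent to a root of [P] in [K], whence the Galois
    group embeds in the additive group of these roots and has [t] as its only jump.  Taking [al]
    integral outside the image of [P] modulo the maximal ideal gives the jump [-1], and [X^p - pi]
    gives the jump [p e / (p - 1)].  The compositum of such extensions with distinct jumps has
    exactly the prescribed jumps. *)

(** * Discrete valuations *)

(* Instances of the same ring constant or size reached through different coercion paths are
   distinct atoms for [lia]: such terms are abstracted, up to conversion, beforehand. *)
Ltac vlia := intros;
  repeat match goal with H : is_true (vge _ _ _) |- _ => clear H end;
  repeat match goal with
    | H : context [size ?x] |- _ => revert H
    | w : _ -> int |- _ => match goal with H : context [w ?x] |- _ => revert H end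
    end;
  repeat match goal with
    | |- context [size ?x] => let a := fresh "a" in move: (size x) => a
    | w : _ -> int |- _ => match goal with |- context [w ?x] =>
        let a := fresh "a" in move: (w x) => a end
    end;
  intros; lia.

(** The two usual tools, monogenicity of the ring of integers and Herbrand's theorem on quotients,
    are both replaced. Density of [Z[xs]] is enough for every estimate that monogenicity would give.
    Quotients are never formed as filtered groups: for [y] integral and fixed by a subgroup [N], the
    least valuation of [s y - y] is the sum of the lower indices over the coset [N s], and when
    [G / N] has one jump all these sums agree, so that they determine the value of the Herbrand
    function of [G] itself. The residue characteristic is [p] and [G] is a [p]-group, so inertia is
    wild: no upper jump is [0], and the shift of valuations is positive. The bound on [t] has to
    come from a quotient of order exactly [p], whereas the bound on the size needs the whole layer;
    two subgroups are therefore used for each jump. In the construction the ramification theory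
    presupposes an elementary abelian group, which is known for the compositum only at the end.
    Commutation and exponent [p] are thus first proved on the roots themselves, by comparing
    residues. *)

Section ValuationBasics.
Variables (F : fieldType) (w : F -> int).
Hypothesis Hw : dvaluation w.
Implicit Types (x y z : F) (m n : int).

Let wM := dv_mul Hw.
Lemma vgeD x y n : vge w x n -> vge w y n -> vge w (x + y) n.
Proof. exact: (dv_add Hw). Qed.

Lemma vge0 n : vge w 0 n. Proof. by rewrite /vge eqxx. Qed.

Lemma vgeE x n : x != 0 -> vge w x n = (n <= w x).
Proof. by rewrite /vge => /negbTE ->. Qed.

Lemma dval1 : w 1 = 0.
Proof.
by move: (wM (oner_neq0 F) (oner_neq0 F)); rewrite mulr1 => H; vlia.
Qed.

Lemma dvalN1 : w (-1) = 0.
Proof.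
have n0 : (-1 : F) != 0 by rewrite oppr_eq0 oner_eq0.
by move: (wM n0 n0); rewrite mulrNN mulr1 dval1 => H; vlia.
Qed.

Lemma valN x : w (- x) = w x.
Proof.
have [->|x0] := eqVneq x 0; first by rewrite oppr0.
by rewrite -mulN1r wM ?oppr_eq0 ?oner_eq0 // dvalN1 add0r.
Qed.

Lemma vgeN x n : vge w (- x) n = vge w x n.
Proof. by rewrite /vge oppr_eq0 valN. Qed.

Lemma vgeB x y n : vge w x n -> vge w y n -> vge w (x - y) n.
Proof. by move=> hx hy; apply: vgeD => //; rewrite vgeN. Qed.

Lemma vgeBC x y n : vge w (x - y) n = vge w (y - x) n.
Proof. by rewrite -vgeN opprB. Qed.

Lemma vge_trans x y z n : vge w (x - y) n -> vge w (y - z) n -> vge w (x - z) n.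
Proof. by move=> h1 h2; rewrite -(subrKA y); exact: vgeD h1 h2. Qed.

Lemma vgeW x m n : n <= m -> vge w x m -> vge w x n.
Proof. by rewrite /vge => h /orP[->//|h2]; rewrite (le_trans h h2) orbT. Qed.

Lemma vgeM x y m n : vge w x m -> vge w y n -> vge w (x * y) (m + n).
Proof.
have [->|x0] := eqVneq x 0; first by rewrite mul0r !vge0.
have [->|y0] := eqVneq y 0; first by rewrite mulr0 !vge0.
by rewrite !vgeE ?mulf_neq0 // wM //; vlia.
Qed.

Lemma vgeMl x y n : vge w x 0 -> vge w y n -> vge w (x * y) n.
Proof. by move=> h1 h2; rewrite -[n]add0r; apply: vgeM. Qed.

Lemma vgeMr x y n : vge w x n -> vge w y 0 -> vge w (x * y) n.
Proof. by move=> h1 h2; rewrite -[n]addr0; apply: vgeM. Qed.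

Lemma vge_1 : vge w 1 0.
Proof. by rewrite vgeE ?oner_eq0 // dval1. Qed.

Lemma vge_sum (I : Type) (r : seq I) (P : pred I) (E : I -> F) n :
  (forall i, P i -> vge w (E i) n) -> vge w (\sum_(i <- r | P i) E i) n.
Proof.
move=> H; elim/big_ind: _ => //; first exact: vge0.
by move=> x y; apply: vgeD.
Qed.

Lemma vge_nat k : vge w k%:R 0.
Proof. by elim: k => [|k IH]; rewrite ?vge0 // -addn1 natrD vgeD // vge_1. Qed.

Lemma vgeMn x n k : vge w x n -> vge w (x *+ k) n.
Proof. by move=> h; rewrite -mulr_natr; apply: vgeMr => //; apply: vge_nat. Qed.

Lemma vgeX x n k : vge w x n -> vge w (x ^+ k) (n * k%:Z).
Proof.
move=> h; elim: k => [|k IH]; first by rewrite expr0 mulr0 vge_1.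
by rewrite exprS intS mulrDr mulr1; apply: vgeM.
Qed.

Lemma vgeX0 x k : vge w x 0 -> vge w (x ^+ k) 0.
Proof. by move=> /vgeX - /(_ k); rewrite mul0r. Qed.

Lemma vge_prod0 (I : Type) (r : seq I) (P : pred I) (E : I -> F) :
  (forall i, P i -> vge w (E i) 0) -> vge w (\prod_(i <- r | P i) E i) 0.
Proof.
move=> H; elim/big_ind: _ => //; first exact: vge_1.
by move=> x y h1 h2; rewrite -[0](addr0 0); apply: vgeM.
Qed.

Lemma valV x : x != 0 -> w x^-1 = - w x.
Proof.
move=> x0; have := wM x0 (invr_neq0 x0).
by rewrite mulfV // dval1 => H; vlia.
Qed.

Lemma val_div x y : x != 0 -> y != 0 -> w (x / y) = w x - w y.
Proof. by move=> x0 y0; rewrite wM ?invr_eq0 // valV. Qed.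

Lemma valX x k : x != 0 -> w (x ^+ k) = w x * k%:Z.
Proof.
move=> x0; elim: k => [|k IH]; first by rewrite expr0 mulr0 dval1.
by rewrite exprS wM ?expf_neq0 // IH intS mulrDr mulr1.
Qed.

Lemma val_prod (I : Type) (r : seq I) (P : pred I) (E : I -> F) :
  (forall i, P i -> E i != 0) ->
  w (\prod_(i <- r | P i) E i) = \sum_(i <- r | P i) w (E i).
Proof.
move=> H.
suff [] : w (\prod_(i <- r | P i) E i) = \sum_(i <- r | P i) w (E i) /\
   \prod_(i <- r | P i) E i != 0 by [].
elim/big_ind2: _ => [|x1 x2 y1 y2 [h1 h2] [h3 h4]|i Pi].
- by rewrite dval1 oner_eq0.
- by rewrite wM // h1 h3 mulf_neq0.
- by rewrite H.
Qed.

Lemma vge_eq0 x : (forall n, vge w x n) -> x = 0.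
Proof.
move=> H; apply/eqP; apply/negPn/negP => x0.
by move: (H (w x + 1)); rewrite vgeE //; vlia.
Qed.

Lemma vge_eq0_nat x n0 : (forall k : nat, vge w x (n0 + k%:Z)) -> x = 0.
Proof.
move=> H; apply: vge_eq0 => n.
by apply: (vgeW _ (H `|n - n0|%N)); vlia.
Qed.

Lemma val_addl x y : x != 0 -> vge w y (w x + 1) ->
  x + y != 0 /\ w (x + y) = w x.
Proof.
move=> x0 hy.
have n0 : x + y != 0.
  apply/eqP => /eqP; rewrite addr_eq0 => /eqP E.
  by move: hy; rewrite -vgeN -E vgeE //; vlia.
split=> //; apply/eqP; rewrite eq_le; apply/andP; split; last first.
  rewrite -(vgeE _ n0); apply: vgeD; first by rewrite vgeE.
  by apply: vgeW hy; vlia.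
rewrite leNgt; apply/negP => h.
have : vge w (x + y - y) (w x + 1).
  by apply: vgeB => //; rewrite vgeE //; vlia.
by rewrite addrK vgeE //; vlia.
Qed.

Lemma val_congr x y : x != 0 -> vge w (y - x) (w x + 1) ->
  y != 0 /\ w y = w x.
Proof. by move=> x0 h; have := val_addl x0 h; rewrite addrC subrK. Qed.

Lemma val_unit_neq0 x : ~~ vge w x 1 -> x != 0.
Proof. by apply: contra => /eqP ->; apply: vge0. Qed.

Lemma val_unit x : vge w x 0 -> ~~ vge w x 1 -> x != 0 /\ w x = 0.
Proof.
move=> h1 h2; have x0 := val_unit_neq0 h2; split => //.
by move: h1 h2; rewrite !vgeE //; vlia.
Qed.

Lemma vgeM_unit x y n : x != 0 -> w x = 0 -> vge w (x * y) n = vge w y n.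
Proof.
move=> x0 h; have [->|y0] := eqVneq y 0; first by rewrite mulr0.
by rewrite !vgeE ?mulf_neq0 // wM // h add0r.
Qed.

Lemma vge_divE x y n : y != 0 -> vge w (x / y) n = vge w x (n + w y).
Proof.
move=> y0; have [->|x0] := eqVneq x 0; first by rewrite mul0r !vge0.
by rewrite !vgeE ?mulf_neq0 ?invr_eq0 // val_div //; vlia.
Qed.

Lemma vgeMlE x y n : y != 0 -> vge w (y * x) n = vge w x (n - w y).
Proof.
move=> y0; have [->|x0] := eqVneq x 0; first by rewrite mulr0 !vge0.
by rewrite !vgeE ?mulf_neq0 // wM //; vlia.
Qed.

Record residue_char (p : nat) : Prop := ResidueChar {
  residue_char_prime : prime p;
  residue_char_val : vge w p%:R 1 }.

Lemma val_natr_coprime p k : residue_char p -> coprime k p ->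
  k%:R != 0 :> F /\ w k%:R = 0.
Proof.
move=> [pp hp] cop; apply: val_unit; first exact: vge_nat.
apply/negP => hk.
have k0 : (0 < k)%N.
  case: k cop {hk} => //; rewrite /coprime gcd0n => /eqP E.
  by move: pp; rewrite E.
case: (egcdnP p k0) => a b E _.
rewrite (eqP cop) in E.
have : vge w (a%:R * k%:R - b%:R * p%:R) 1.
  by apply: vgeB; apply: vgeMl => //; apply: vge_nat.
by rewrite -!natrM E natrD addrC addKr vgeE ?oner_eq0 // dval1.
Qed.

Lemma vge_mulrn_dvd p k : residue_char p -> (p %| k)%N -> vge w k%:R 1.
Proof.
move=> [pp hp] /dvdnP[q ->]; rewrite natrM; apply: vgeMl => //.
exact: vge_nat.
Qed.

(** The middle binomial terms gain a factor [p], and the last one has valuation at least [p * n],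
    which exceeds [n] because [n >= 1]. *)
Lemma pow_congr p x y n : residue_char p -> 1 <= n -> vge w x 0 -> vge w y 0 ->
  vge w (x - y) n -> vge w (x ^+ p - y ^+ p) (n + 1).
Proof.
move=> rc n1 hx hy h.
have [pp hp] := rc.
pose d := x - y; have -> : x = y + d by rewrite /d addrC subrK.
rewrite exprDn big_ord_recl /= subn0 expr0 mulr1 bin0 mulr1n [X in X - _]addrC addrK.
apply: vge_sum => i _; rewrite /bump /= add1n.
have [E|ne] := eqVneq i.+1 p.
  rewrite E subnn expr0 mul1r binn mulr1n.
  apply: vgeW (vgeX p h).
  have := prime_gt1 pp; nia.
have ip : (0 < i.+1 < p)%N by have := ltn_ord i; vlia.
rewrite -mulr_natr; apply: vgeM; last by apply: (vge_mulrn_dvd rc); exact: prime_dvd_bin.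
rewrite mulrC; apply: vgeMr; last exact: vgeX0.
rewrite exprS; apply: vgeMr => //; apply: vgeX0.
by apply: vgeW h; vlia.
Qed.

Lemma pow_congr_iter p x y k : residue_char p -> vge w x 0 -> vge w y 0 ->
  vge w (x - y) 1 -> vge w (x ^+ (p ^ k) - y ^+ (p ^ k)) (1 + k%:Z).
Proof.
move=> rc hx hy h; elim: k => [|k IH]; first by rewrite expn0 !expr1 addr0.
rewrite expnSr !exprM intS.
have -> : 1 + (1 + k%:Z) = (1 + k%:Z) + 1 by vlia.
by apply: (pow_congr rc) => //; apply: vgeX0.
Qed.

End ValuationBasics.

(** * Hensel's lemma *)

Section Hensel.
Variables (K : fieldType) (v : K -> int).
Hypothesis Hv : dvaluation v.
Hypothesis Hc : forall a : nat -> K,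
      (forall N : int, exists n0 : nat, forall i j : nat,
          (n0 <= i)%N -> (n0 <= j)%N -> vge v (a i - a j) N) ->
      exists l : K, forall N : int, exists n0 : nat, forall i : nat,
          (n0 <= i)%N -> vge v (a i - l) N.

Lemma geometric_limit (a : nat -> K) :
  (forall k, vge v (a k.+1 - a k) k%:Z) ->
  exists l, forall k, vge v (l - a k) k%:Z.
Proof.
move=> H.
have H1 i j : (i <= j)%N -> vge v (a j - a i) i%:Z.
  move=> /subnKC <-; elim: (j - i)%N => [|d IH]; first by rewrite addn0 subrr vge0.
  rewrite addnS; apply: (vge_trans Hv) IH.
  by apply: vgeW (H _); vlia.
case: (Hc (a := a)) => [N|l Hl].
  exists `|N|%N => i j hi hj.
  have [ij|ji] := leqP i j.
    by rewrite (vgeBC Hv); apply: vgeW (H1 _ _ ij); vlia.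
  by apply: vgeW (H1 _ _ (ltnW ji)); vlia.
exists l => k; have [n0 h0] := Hl k%:Z.
apply: (@vge_trans _ _ Hv _ (a (maxn n0 k))); last by apply: H1; rewrite leq_maxr.
by rewrite (vgeBC Hv); apply: h0; rewrite leq_maxl.
Qed.

(** The Gauss valuation of [q] is at least [n]. *)
Definition pvge (q : {poly K}) (n : int) := forall i, vge v q`_i n.

Lemma pvgeD p q n : pvge p n -> pvge q n -> pvge (p + q) n.
Proof. by move=> h1 h2 i; rewrite coefD; apply: vgeD. Qed.

Lemma pvgeN p n : pvge p n -> pvge (- p) n.
Proof. by move=> h i; rewrite coefN vgeN. Qed.

Lemma pvgeB p q n : pvge p n -> pvge q n -> pvge (p - q) n.
Proof. by move=> h1 h2; apply: pvgeD => //; apply: pvgeN. Qed.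

Lemma pvgeM p q m n : pvge p m -> pvge q n -> pvge (p * q) (m + n).
Proof.
move=> h1 h2 i; rewrite coefM; apply: vge_sum => // j _.
by apply: vgeM.
Qed.

Lemma pvgeW p m n : n <= m -> pvge p m -> pvge p n.
Proof. by move=> h h1 i; apply: vgeW (h1 i). Qed.

Lemma pvge0 n : pvge 0 n.
Proof. by move=> i; rewrite coef0 vge0. Qed.

Lemma pvge1 : pvge 1 0.
Proof. by move=> i; rewrite coef1; case: (i == 0%N); [apply: vge_1|apply: vge0]. Qed.

Lemma pvge_eq0 p : (forall k : nat, pvge p k%:Z) -> p = 0.
Proof.
move=> H; apply/polyP => i; rewrite coef0.
by apply: (@vge_eq0_nat _ v _ 0) => k; rewrite add0r; exact: H.
Qed.

Lemma pvge_horner p x : pvge p 0 -> vge v x 0 -> vge v p.[x] 0.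
Proof.
move=> h hx; rewrite horner_coef; apply: vge_sum => // i _.
by apply: vgeMl => //; apply: vgeX0.
Qed.

(** Each step of Euclidean division divides a coefficient by the leading coefficient of [A], which
    is a unit, so no valuation is lost. *)
Lemma pvge_div (A : {poly K}) r : pvge A 0 -> size A = r.+1 -> v A`_r = 0 ->
  forall q n, pvge q n -> pvge (q %/ A) n /\ pvge (q %% A) n.
Proof.
move=> hA sA uA q n hq.
have A0 : A`_r != 0.
  have : lead_coef A != 0 by rewrite lead_coef_eq0 -size_poly_eq0 sA.
  by rewrite lead_coefE sA.
suff [a [b [E sb ha hb]]] : exists a b, [/\ q = a * A + b, (size b <= r)%N, pvge a n & pvge b n].
  by rewrite E divp_addl_mul_small ?modp_addl_mul_small ?sA.
have [s] := ubnP (size q); elim: s q hq => // s IH q hq sq.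
have [le|lt] := leqP (size q) r.
  by exists 0, q; rewrite mul0r add0r; split => //; apply: pvge0.
pose c := q`_(size q).-1 / A`_r.
have hcX : pvge (c *: 'X^(size q - r.+1)) n.
  move=> i; rewrite coefZ coefXn; case: eqP => _; rewrite ?mulr1 ?mulr0 ?vge0 //.
  by rewrite (vge_divE Hv) // uA addr0.
pose q' := q - c *: 'X^(size q - r.+1) * A.
have hq' : pvge q' n.
  by apply: pvgeB => //; rewrite -[n]addr0; apply: pvgeM.
have sq' : (size q' < s)%N.
  have : (size q' <= (size q).-1)%N.
    apply/leq_sizeP => j hj.
    rewrite coefB -scalerAl coefZ coefXnM.
    have [->|nj] := eqVneq j (size q).-1.
      rewrite ifF; last by vlia.
      have -> : ((size q).-1 - (size q - r.+1) = r)%N by vlia.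
      by rewrite /c divfK // subrr.
    rewrite [q`_j]nth_default; last by vlia.
    rewrite sub0r ifF; last by vlia.
    by rewrite (nth_default 0) ?mulr0 ?oppr0 //; vlia.
  by vlia.
have [a [b [E sb ha hb]]] := IH q' hq' sq'.
exists (a + c *: 'X^(size q - r.+1)), b; split => //; last exact: pvgeD.
by rewrite mulrDl addrAC -E /q' subrK.
Qed.

Lemma poly_geometric_limit (P : nat -> {poly K}) s :
  (forall k, size (P k) <= s)%N -> (forall k, pvge (P k.+1 - P k) k%:Z) ->
  exists Q : {poly K}, (size Q <= s)%N /\ forall k, pvge (Q - P k) k%:Z.
Proof.
move=> hs hP.
have /choice[l Hl] : forall i, exists l, forall k, vge v (l - (P k)`_i) k%:Z.
  move=> i; apply: (geometric_limit (a := fun k => (P k)`_i)) => k.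
  by rewrite -coefB; exact: hP.
exists (\poly_(i < s) l i); split; first exact: size_poly.
move=> k i; rewrite coefB coef_poly; case: ltnP => // hi.
by rewrite [(P k)`_i]nth_default ?subrr ?vge0 // (leq_trans (hs k)).
Qed.

Section Factor.
Variables (g : {poly K}) (n r : nat).
Hypotheses (hg : pvge g 0) (sg : size g = n.+1) (hr : (r <= n)%N).
Hypotheses (gr0 : g`_r != 0) (ugr : v g`_r = 0).
Hypothesis (hgr : forall i, (r < i)%N -> vge v g`_i 1).

Let A0 := take_poly r.+1 g.

(** Modulo the maximal ideal [g] equals [A0 * 1]. The error is divided by the fixed [A0], not by the
    current factor: the remainder corrects the first factor and the quotient the second. Convergence
    is only linear, which suffices, and the degrees stay bounded. *)
Fixpoint hensel_iter k : {poly K} * {poly K} :=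
  if k is k'.+1 then
    let: (A, B) := hensel_iter k' in
    let q := g - A * B in (A + q %% A0, B + q %/ A0)
  else (A0, 1).

Let sA0 : size A0 = r.+1.
Proof.
apply/eqP; rewrite eqn_leq size_take_poly /=.
rewrite ltnNge; apply/negP => /leq_sizeP /(_ r (leqnn _)).
by rewrite coef_take_poly ltnSn => /eqP; rewrite (negbTE gr0).
Qed.

Let hA0 : pvge A0 0.
Proof. by move=> i; rewrite coef_take_poly; case: ifP => // _; apply: vge0. Qed.

Let uA0 : v A0`_r = 0.
Proof. by rewrite coef_take_poly ltnSn. Qed.

Lemma hensel_iterP k : let: (A, B) := hensel_iter k in
  [/\ pvge (g - A * B) (1 + k%:Z), pvge (A - A0) 1, pvge (B - 1) 1,
      (size (A - A0)%R <= r)%N & (size B <= (n - r).+1)%N].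
Proof.
elim: k => [|k] /=.
  rewrite !subrr size_poly0 size_poly1 mulr1; split => //; try exact: pvge0.
  move=> i; rewrite coefB coef_take_poly ltnS addr0.
  by case: leqP => h; rewrite ?subrr ?vge0 // subr0 hgr.
case: (hensel_iter k) => A B [hq hA hB sA sB].
set q := g - A * B in hq *.
have [ha hb] := pvge_div hA0 sA0 uA0 hq.
set a := q %/ A0 in ha *; set b := q %% A0 in hb *.
have Eq : q = a * A0 + b by exact: divp_eq.
have sb : (size b <= r)%N by rewrite -ltnS -sA0 ltn_modp -size_poly_eq0 sA0.
have sAr : (size A <= r.+1)%N.
  rewrite -[A](subrK A0); apply: (leq_trans (size_polyD _ _)).
  by rewrite sA0 geq_max (leq_trans sA) /=.
split.
(* Each of the three products has one factor of valuation at least [1] besides [a] or [b], which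
   gains one unit. *)
- have -> : g - (A + b) * (B + a) = - ((A - A0) * a + b * (B - 1) + a * b).
    have -> : g = q + A * B by rewrite /q subrK.
    by rewrite Eq; ring.
  apply: pvgeN; apply: pvgeD; last first.
    by apply: (pvgeW _ (pvgeM ha hb)); vlia.
  apply: pvgeD; first by apply: (pvgeW _ (pvgeM hA ha)); vlia.
  by apply: (pvgeW _ (pvgeM hb hB)); vlia.
- by rewrite addrAC; apply: pvgeD => //; apply: (pvgeW _ hb); vlia.
- by rewrite addrAC; apply: pvgeD => //; apply: (pvgeW _ ha); vlia.
- by rewrite addrAC; apply: (leq_trans (size_polyD _ _)); rewrite geq_max sA sb.
- apply: (leq_trans (size_polyD _ _)); rewrite geq_max sB /=.
  rewrite size_divp -?size_poly_eq0 sA0 //=.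
  have : (size q <= n.+1)%N.
    apply: (leq_trans (size_polyD _ _)); rewrite size_polyN sg geq_max leqnn /=.
    by apply: (leq_trans (size_polyMleq _ _)); vlia.
  by vlia.
Qed.

Lemma hensel_factor : exists A B : {poly K},
  [/\ g = A * B, size A = r.+1 & (size B <= (n - r).+1)%N].
Proof.
pose AA k := (hensel_iter k).1; pose BB k := (hensel_iter k).2.
have HI k : [/\ pvge (g - AA k * BB k) (1 + k%:Z), pvge (AA k - A0) 1, pvge (BB k - 1) 1,
      (size (AA k - A0)%R <= r)%N & (size (BB k) <= (n - r).+1)%N].
  by move: (hensel_iterP k); rewrite /AA /BB; case: (hensel_iter k).
have step k : pvge (AA k.+1 - AA k) k%:Z /\ pvge (BB k.+1 - BB k) k%:Z.
  rewrite /AA /BB /=; move: (HI k); rewrite /AA /BB; case: (hensel_iter k) => A B /= [hq _ _ _ _].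
  have [ha hb] := pvge_div hA0 sA0 uA0 hq.
  by rewrite ![_ + (_ %% _)]addrC ![_ + (_ %/ _)]addrC !addrK; split;
    [apply: (pvgeW _ hb)|apply: (pvgeW _ ha)]; vlia.
have [||A' [sA' lA']] := @poly_geometric_limit (fun k => AA k - A0) r.
- by move=> k; case: (HI k).
- by move=> k; rewrite opprB addrA subrK; case: (step k).
have [||B [sB lB]] := @poly_geometric_limit BB (n - r).+1.
- by move=> k; case: (HI k).
- by move=> k; case: (step k).
exists (A' + A0), B; split => //.
  apply/eqP; rewrite -subr_eq0; apply/eqP; apply: pvge_eq0 => k.
  have [h1 h2 h3 _ _] := HI k.
  have hA : pvge (A' + A0) 0.
    apply: pvgeD => //.
    rewrite -[A'](subrK (AA 0%N - A0)); apply: pvgeD; first exact: lA'.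
    by case: (HI 0%N) => _ h _ _ _; apply: pvgeW h.
  have hB : pvge (BB k) 0.
    by rewrite -[BB k](subrK 1); apply: pvgeD; [apply: pvgeW h3|apply: pvge1].
  have -> : g - (A' + A0) * B = (g - AA k * BB k) - (A' - (AA k - A0)) * BB k - (A' + A0) * (B - BB k).
    by ring.
  apply: pvgeB; last by rewrite -[k%:Z]add0r; apply: pvgeM.
  apply: pvgeB; first by apply: pvgeW h1; vlia.
  by rewrite -[k%:Z]addr0; apply: pvgeM.
by rewrite addrC size_polyDl sA0.
Qed.

End Factor.

(** Otherwise divide [g] by a coefficient of least, hence negative, valuation. In the resulting
    primitive [G] the constant and leading coefficients lie in the maximal ideal, so the last unit
    coefficient has index [r] with [0 < r < n], and [hensel_factor] produces a proper factor of
    degree [r]. *)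
Lemma irreducible_monic_integral (g : {poly K}) :
  irreducible_poly g -> g \is monic -> vge v g`_0 0 -> pvge g 0.
Proof.
move=> irr mon h0.
have [n sg] : exists n, size g = n.+1.
  by exists (size g).-1; case: irr; vlia.
have gn : g`_n = 1 by move/monicP: mon; rewrite lead_coefE sg.
apply: contrapT => nint.
have {nint} [i0 hi0] : exists i, ~~ vge v g`_i 0.
  apply: contrapT => H; apply: nint => i; apply/negPn/negP => hi.
  by apply: H; exists i.
have i0n : (i0 < n.+1)%N.
  rewrite -sg ltnNge; apply/negP => h; move: hi0; rewrite nth_default //.
  by rewrite vge0.
pose P (i : 'I_n.+1) := g`_i != 0.
have Pi0 : P (Ordinal i0n) by apply: contraNneq hi0 => /= ->; rewrite vge0.
have [i1 Pi1 mini1] := @arg_minP _ _ _ (Ordinal i0n) P (fun i => v g`_i) Pi0.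
have mu_neg : v g`_i1 < 0.
  apply: (le_lt_trans (mini1 _ Pi0)) => /=.
  move: hi0; rewrite /vge negb_or ltNge => /andP[_] //.
pose c := (g`_i1)^-1.
have c0 : c != 0 by rewrite invr_neq0.
have vc : v c = - v g`_i1 by rewrite (valV Hv).
pose G := c *: g.
have sG : size G = n.+1 by rewrite size_scale.
have hG : pvge G 0.
  move=> i; rewrite coefZ (vgeMlE Hv) // vc.
  have [hi|hi] := ltnP i n.+1; last by rewrite nth_default ?vge0 ?sg.
  have [->|gi0] := eqVneq g`_i 0; first by rewrite vge0.
  rewrite vgeE //; have := mini1 (Ordinal hi) gi0 => /= h.
  by move: h; move: (v _) (v _) => a b; vlia.
have GE j : (j <= n)%N -> g`_j != 0 -> v G`_j = v g`_j - v g`_i1.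
  by move=> hj gj; rewrite coefZ (dv_mul Hv) // vc addrC.
pose Q i := ~~ vge v G`_i 1 && (i <= n)%N.
have Q1 : Q i1.
  rewrite /Q -ltnS ltn_ord andbT coefZ (vgeMlE Hv) // vc.
  by rewrite vgeE //; move: (v _) => a; vlia.
have [|r /andP[Qr rn] maxr] := @ex_maxnP Q n (ex_intro (fun i => is_true (Q i)) _ Q1).
  by move=> i /andP[].
have gr0 : G`_r != 0 by apply: val_unit_neq0 Qr.
have [_ ugr] := val_unit (hG r) Qr.
have hgr i : (r < i)%N -> vge v G`_i 1.
  move=> ri; apply/negPn/negP => h.
  have [le|gt] := leqP i n; last by move: h; rewrite nth_default ?vge0 ?sG.
  by have := maxr i; rewrite /Q h le => /(_ isT); vlia.
have r0 : (0 < r)%N.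
  rewrite lt0n; apply: contraNneq Qr => ->.
  rewrite coefZ (vgeMlE Hv) // vc; apply: vgeW h0.
  by move: mu_neg; move: (v _) => a; vlia.
have rn' : (r < n)%N.
  rewrite ltn_neqAle rn andbT; apply: contraNneq Qr => ->.
  rewrite coefZ (vgeMlE Hv) // vc gn vgeE ?oner_eq0 // dval1 //.
  by move: mu_neg; move: (v _) => a; vlia.
have [A [B [E sA sB]]] := hensel_factor hG sG rn gr0 ugr hgr.
have dA : A %| g.
  by rewrite -(dvdpZr _ _ c0) -/G E dvdp_mulr.
have := irr.2 A; rewrite sA => /(_ _ dA)/eqp_size; rewrite sA sg.
by move=> H; have := H (ltac:(by vlia)); vlia.
Qed.

Lemma pvge_factor_theorem (Q : {poly K}) x : pvge Q 0 -> vge v x 0 ->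
  exists R : {poly K}, Q = R * ('X - x%:P) + Q.[x]%:P /\ pvge R 0.
Proof.
move=> hQ hx.
have hA : pvge ('X - x%:P) 0.
  move=> i; rewrite coefB coefX coefC; apply: vgeB => //.
    by case: eqP => _; [apply: vge_1|apply: vge0].
  by case: eqP => _ //; apply: vge0.
have uA : v ('X - x%:P)`_1 = 0 by rewrite coefB coefX coefC /= subr0 dval1.
have [h1 h2] := pvge_div hA (size_XsubC x) uA hQ.
by exists (Q %/ ('X - x%:P)); split => //; rewrite -modp_XsubC -divp_eq.
Qed.

Lemma hensel_root (Q : {poly K}) a : pvge Q 0 -> vge v a 0 ->
  vge v Q.[a] 1 -> ~~ vge v Q^`().[a] 1 ->
  exists b, root Q b /\ vge v (b - a) 1.
Proof.
move=> hQ ha hQa uQ'.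
pose c := Q^`().[a].
have hQ' : pvge Q^`() 0 by move=> i; rewrite coef_deriv; apply: vgeMn.
have [c0 vc] : c != 0 /\ v c = 0 by apply: val_unit => //; apply: pvge_horner.
(* Newton's iteration with the slope frozen at [a]: the difference quotients of [Q] near [a] are
   congruent to [c], so [T] is a contraction. *)
pose T x := x - Q.[x] / c.
pose y k := iter k T a.
have key x : vge v x 0 -> vge v (x - a) 1 -> forall z n, 1 <= n -> vge v (z - x) n ->
    vge v (T z - T x) (n + 1).
  move=> hx hxa z n n1 hz.
  have hz0 : vge v z 0 by rewrite -[z](subrK x); apply: vgeD => //; apply: vgeW hz; vlia.
  have [R [ER hR]] := pvge_factor_theorem hQ hx.
  have ERz : Q.[z] - Q.[x] = R.[z] * (z - x).
    by rewrite {1}ER !(hornerE) addrK.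
  have Rx : R.[x] = Q^`().[x].
    by rewrite ER derivD derivC addr0 derivM !hornerE derivXsubC !hornerE subrr mulr0 add0r.
  have cong (P : {poly K}) u t m : pvge P 0 -> vge v t 0 -> vge v u 0 -> vge v (u - t) m -> vge v (P.[u] - P.[t]) m.
    move=> hP ht hu hut; have [S [ES hS]] := pvge_factor_theorem hP ht.
    have -> : P.[u] - P.[t] = S.[u] * (u - t) by rewrite {1}ES !(hornerE) addrK.
    by apply: vgeMl => //; apply: pvge_horner.
  have -> : T z - T x = (z - x) * (c - R.[z]) / c.
    rewrite /T; have -> : z - Q.[z] / c - (x - Q.[x] / c) = (z - x) - (Q.[z] - Q.[x]) / c by field.
    by rewrite ERz; field.
  rewrite (vge_divE Hv) // vc addr0; apply: vgeM => //.
  have -> : c - R.[z] = (c - R.[x]) - (R.[z] - R.[x]) by ring.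
  apply: vgeB => //; last by apply: cong => //; apply: vgeW hz; vlia.
  by rewrite Rx (vgeBC Hv); apply: cong.
have hy k : vge v (y k) 0 /\ vge v (y k - a) 1 /\ vge v (y k.+1 - y k) (k%:Z + 1).
  elim: k => [|k [h1 [h2 h3]]].
    split => //; split; first by rewrite subrr vge0.
    by rewrite /y /= /T addrAC subrr sub0r vgeN // (vge_divE Hv) // vc addr0 add0r.
  have h4 : vge v (y k.+1 - a) 1.
    by rewrite -[y k.+1](subrK (y k)) -addrA; apply: vgeD => //; apply: vgeW h3; vlia.
  split; first by rewrite -[y k.+1](subrK a); apply: vgeD => //; apply: vgeW h4; vlia.
  split => //.
  have -> : k.+1%:Z + 1 = (k%:Z + 1) + 1 by vlia.
  by apply: key => //; vlia.
have [k|b hb] := geometric_limit (a := y).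
  by have [_ [_ h]] := hy k; apply: vgeW h; vlia.
have hba : vge v (b - a) 1.
  apply: (@vge_trans _ _ Hv _ (y 1%N)); first exact: (hb 1%N).
  by case: (hy 1%N) => _ [].
have hb0 : vge v b 0 by rewrite -[b](subrK a); apply: vgeD => //; apply: vgeW hba; vlia.
exists b; split => //.
suff E : Q.[b] / c = 0 by apply/rootP; rewrite -[Q.[b]](divfK c0) E mul0r.
apply: (@vge_eq0_nat _ v _ 0) => k; rewrite add0r.
have -> : Q.[b] / c = (b - y k.+1) - (T b - T (y k)).
  by rewrite /y iterS -/(y k) /T; ring.
apply: vgeB => //; first by apply: vgeW (hb k.+1); vlia.
have [h1 [h2 _]] := hy k.
case: k h1 h2 {key} (key) => [|k] h1 h2 key.
  by apply: (vgeW _ (key _ h1 h2 b 1 isT hba)).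
by apply: (vgeW _ (key _ h1 h2 b k.+1%:Z _ (hb _))); lia.
Qed.

End Hensel.

(** * Extension of the valuation *)

Lemma vgeX_iff (F : fieldType) (w : F -> int) (x : F) n : dvaluation w ->
  (0 < n)%N -> vge w (x ^+ n) 0 = vge w x 0.
Proof.
move=> Hw n0; have [->|x0] := eqVneq x 0; first by rewrite expr0n eqn0Ngt n0 !vge0.
rewrite !vgeE ?expf_neq0 // (valX Hw) //; move: (w x) => a; nia.
Qed.

Lemma integral_root (F : fieldType) (w : F -> int) (P : {poly F}) z :
  dvaluation w -> P \is monic -> (forall i, vge w P`_i 0) -> root P z -> vge w z 0.
Proof.
move=> Hw mP hP rz; apply/negPn/negP => hz.
have z0 : z != 0 by apply: contraNneq hz => ->; exact: vge0.
have wz : w z < 0 by move: hz; rewrite vgeE // -ltNge.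
have [d sd] : exists d, size P = d.+1.
  by exists (size P).-1; rewrite prednK // size_poly_gt0 monic_neq0.
move/rootP: rz; rewrite horner_coef sd big_ord_recr /=.
have -> : P`_d = 1 by move/monicP: mP; rewrite lead_coefE sd.
rewrite mul1r addrC => E.
have [||n0 _] := val_addl Hw (x := z ^+ d) (y := \sum_(i < d) P`_i * z ^+ i).
- by rewrite expf_neq0.
- apply: (vge_sum Hw) => i _; apply: (vgeMl Hw) => //.
  by rewrite vgeE ?expf_neq0 // !(valX Hw) //; have := ltn_ord i; move: wz; move: (w z) => a; nia.
by rewrite E eqxx in n0.
Qed.

Section Norm.
Variables (K : fieldType) (M : splittingFieldType K).
Hypothesis galM1 : galois 1%AS {:M}.
Notation gT := (gal_of {:M}).

Lemma galT : 'Gal({:M} / 1%AS)%g = [set: gT].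
Proof.
apply/setP => s; rewrite inE gal_kHom ?sub1v // k1HomE.
exact: (valP (gal_repr s)).
Qed.

Lemma galMx (s t : gT) (x : M) : (s * t)%g x = t (s x).
Proof. by rewrite galM ?memvf. Qed.

Lemma gal_alg (s : gT) (k : K) : s k%:A = k%:A.
Proof. by rewrite linearZ /= rmorph1. Qed.

Lemma gal_ext (s t : gT) : (forall x : M, s x = t x) -> s = t.
Proof. by move=> h; apply/eqP/gal_eqP => x _; exact: h. Qed.

Lemma gal_neq0 (s : gT) (x : M) : (s x != 0) = (x != 0).
Proof. by rewrite fmorph_eq0. Qed.

Lemma galVK (s : gT) (x : M) : (s^-1)%g (s x) = x.
Proof. by rewrite -galMx mulgV gal_id. Qed.

Lemma galKV (s : gT) (x : M) : s ((s^-1)%g x) = x.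
Proof. by rewrite -galMx mulVg gal_id. Qed.

Lemma alg_inj : injective (fun k : K => k%:A : M).
Proof. exact: (fmorph_inj (in_alg M)). Qed.

Lemma norm_ex (x : M) : exists k : K, k%:A = galNorm 1 {:M} x.
Proof.
have /vlineP[k E] : galNorm 1 {:M} x \in 1%VS := mem_galNorm galM1 (memvf x).
by exists k.
Qed.

Definition normK (x : M) : K := sval (cid (norm_ex x)).

Lemma normKE x : (normK x)%:A = \prod_(s : gT) s x.
Proof.
rewrite /normK; case: cid => k /= ->; rewrite /galNorm galT.
by apply: eq_bigl => s; rewrite inE.
Qed.

Lemma normKM x y : normK (x * y) = normK x * normK y.
Proof.
apply: alg_inj; rewrite -[(_ * _)%:A]/(in_alg M _) rmorphM /= !normKE -big_split /=.
by apply: eq_bigr => s _; rewrite rmorphM.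
Qed.

Lemma normK_alg k : normK k%:A = k ^+ #|[set: gT]|.
Proof.
apply: alg_inj; rewrite normKE -[_%:A in RHS]/(in_alg M _) rmorphXn /=.
rewrite (eq_bigr (fun _ => k%:A)) => [|s _]; last exact: gal_alg.
by rewrite prodr_const; congr (_ ^+ _); apply: eq_card => s; rewrite inE.
Qed.

Lemma normK1 : normK 1 = 1.
Proof. by rewrite -(scale1r 1) normK_alg expr1n. Qed.

Lemma normK_eq0 x : (normK x == 0) = (x == 0).
Proof.
rewrite -(fmorph_eq0 (in_alg M)) /= normKE prodf_seq_eq0.
apply/hasP/eqP => [[s _ /=]|->]; first by rewrite fmorph_eq0 => /eqP.
by exists 1%g; rewrite ?mem_index_enum //= rmorph0.
Qed.

Lemma normK_gal (s : gT) x : normK (s x) = normK x.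
Proof.
apply: alg_inj; rewrite !normKE [RHS](reindex_inj (mulgI s)) /=.
by apply: eq_bigr => t _; rewrite galMx.
Qed.

Lemma normKX x n : normK (x ^+ n) = normK x ^+ n.
Proof. by elim: n => [|n IH]; rewrite ?normK1 // !exprS normKM IH. Qed.

Lemma normK_prod (I : Type) (r : seq I) (E : I -> M) :
  normK (\prod_(i <- r) E i) = \prod_(i <- r) normK (E i).
Proof. by elim/big_rec2: _ => [|i x y _ <-]; rewrite ?normK1 ?normKM. Qed.

Lemma minpoly_conjugates (z : M) : exists (q : {poly K}) (r : seq gT),
  [/\ irreducible_poly q, q \is monic, (0 < size r)%N
    & map_poly (in_alg M) q = \prod_(s <- r) ('X - (s z)%:P)].
Proof.
have /galois_factors : galois 1%AS {:M} by [].
move=> /(_ (sub1v _)) /(_ z (memvf z)) [r /= [_ _ E]].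
have /polyOver1P[q Eq] := minPolyOver 1 z.
exists q, r; have mon : q \is monic.
  by rewrite -(map_monic (in_alg M)) /= -Eq monic_minPoly.
have sq : size q = size (minPoly 1 z) by rewrite Eq size_map_poly.
split => //; last by rewrite -Eq E big_map.
- split; first by rewrite sq size_minPoly ltnS adjoin_degreeE divn_gt0 ?adim_gt0 // dimvS // subv_adjoin.
  move=> d sd dq; have := minPoly_irr (K := 1%AS) (x := z) (p := map_poly (in_alg M) d).
  rewrite alg_polyOver Eq dvdp_map => /(_ isT dq) /orP[]; rewrite ?eqp_map // => h.
  by move: sd; rewrite -(size_map_poly (in_alg M)) (eqp_size h) size_poly1 eqxx.
- have := size_minPoly 1 z; rewrite E size_prod_XsubC size_map => -[->].
  by rewrite adjoin_degreeE divn_gt0 ?adim_gt0 // dimvS // subv_adjoin.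
Qed.

(** The conjugates [s (c - z)] have the same norm, so taking norms of [q.[c]], their product, gives
    the identity; the exponent on the left appears because [normK] raises an element of [K] to the
    order of the group. At [c = 0] and [c = -1] this links the norms of [z] and [1 + z] to values of
    one polynomial. *)
Lemma minpoly_eval_norm (z : M) : exists (q : {poly K}) (d : nat),
  [/\ irreducible_poly q, q \is monic, (0 < d)%N, root (map_poly (in_alg M) q) z
    & forall c, q.[c] ^+ #|[set: gT]| = normK (c%:A - z) ^+ d].
Proof.
have [q [r [irr mon r0 E]]] := minpoly_conjugates z.
have Ec c : q.[c] ^+ #|[set: gT]| = normK (c%:A - z) ^+ size r.
  rewrite -normK_alg.
  have -> : q.[c]%:A = \prod_(s <- r) s (c%:A - z).
    have := horner_map (in_alg M) q c; rewrite /= E horner_prod => <-.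
    by apply: eq_bigr => s _; rewrite !hornerE rmorphB /= gal_alg.
  rewrite normK_prod (eq_bigr (fun _ => normK (c%:A - z))) => [|s _]; last exact: normK_gal.
  by rewrite big_const_seq count_predT; elim: (size r) => //= n ->; rewrite exprS.
exists q, (size r); split => //.
case: r r0 E {Ec} => // s r _ E.
have : root (map_poly (in_alg M) q) (s z) by rewrite E big_cons rootM root_XsubC eqxx.
rewrite /root => /eqP h; apply/eqP; apply: (fmorph_inj s); rewrite rmorph0 -h -horner_map.
congr (_.[_]); rewrite -map_poly_comp; apply: eq_map_poly => k /=.
exact: gal_alg.
Qed.

End Norm.

Section ExtendedValuation.
Variables (K : fieldType) (v : K -> int) (M : splittingFieldType K).
Hypothesis galM1 : galois 1%AS {:M}.
Hypothesis Hv : dvaluation v.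
Hypothesis Hc : forall a : nat -> K,
      (forall N : int, exists n0 : nat, forall i j : nat,
          (n0 <= i)%N -> (n0 <= j)%N -> vge v (a i - a j) N) ->
      exists l : K, forall N : int, exists n0 : nat, forall i : nat,
          (n0 <= i)%N -> vge v (a i - l) N.
Notation gT := (gal_of {:M}).
Let N (x : M) := normK galM1 x.

Let nG : (0 < #|[set: gT]|)%N. Proof. by apply/card_gt0P; exists 1%g. Qed.

Let normN x : vge v (N (- x)) 0 = vge v (N x) 0.
Proof.
rewrite -mulN1r /N normKM (vgeM_unit Hv) //.
  by rewrite normK_eq0 oppr_eq0 oner_eq0.
have : (-1 : M) = (-1 : K)%:A by rewrite scaleN1r.
move=> ->; rewrite normK_alg (valX Hv) ?oppr_eq0 ?oner_eq0 //.
by rewrite dvalN1 // mul0r.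
Qed.

Lemma norm_integral_minpoly z : vge v (N z) 0 -> exists (q : {poly K}) d,
  [/\ pvge v q 0, q \is monic, root (map_poly (in_alg M) q) z, (0 < d)%N
    & forall c, q.[c] ^+ #|[set: gT]| = N (c%:A - z) ^+ d].
Proof.
move=> hz; have [q [d [irr mon d0 rz E]]] := minpoly_eval_norm galM1 z.
exists q, d; split => //; apply: irreducible_monic_integral => //.
rewrite -horner_coef0 -(vgeX_iff _ Hv nG) E vgeX_iff //.
by rewrite scale0r sub0r normN.
Qed.

(** This is the ultrametric inequality for the valuation defined by the norm: the minimal polynomial
    of [z] is integral, and its value at [-1] controls the norm of [1 + z]. *)
Lemma norm_integral_add1 z : vge v (N z) 0 -> vge v (N (1 + z)) 0.
Proof.
move=> hz; have [q [d [hq mon rz d0 E]]] := norm_integral_minpoly hz.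
rewrite -normN -(vgeX_iff _ Hv d0).
have -> : - (1 + z) = (-1)%:A - z by rewrite scaleN1r opprD.
rewrite -E vgeX_iff //; apply: pvge_horner => //.
by rewrite vgeN // vge_1.
Qed.

Lemma ext_val_alg (w : M -> int) (k : K) n : ext_val v w -> vge v k n ->
  exists2 e0 : int, (0 < e0) & vge w k%:A (e0 * n).
Proof.
move=> [Hw [e0 [e00 He]]] hk; exists e0 => //.
have [->|k0] := eqVneq k 0; first by rewrite scale0r vge0.
rewrite vgeE ?He //; last by rewrite (fmorph_eq0 (in_alg M)).
by move: hk; rewrite vgeE //; move: (v k) => a; nia.
Qed.

Lemma norm_integral (w : M -> int) z : ext_val v w ->
  vge v (N z) 0 -> vge w z 0.
Proof.
move=> Hw hz; have [q [d [hq mon rz _ _]]] := norm_integral_minpoly hz.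
apply: (integral_root (P := map_poly (in_alg M) q)) => //.
- by case: Hw.
- by rewrite map_monic.
- move=> i; rewrite coef_map /=.
  by have [e0 _] := ext_val_alg Hw (hq i); rewrite mulr0.
Qed.

(** Two elements of equal norm have a quotient of norm [1], which is integral for every extension of
    [v], and so is its inverse. *)
Lemma ext_val_gal (w : M -> int) (s : gT) z : ext_val v w -> w (s z) = w z.
Proof.
move=> Hw; have Hw' : dvaluation w by case: Hw.
have [->|z0] := eqVneq z 0; first by rewrite rmorph0.
have sz0 : s z != 0 by rewrite gal_neq0.
have key x y : x != 0 -> y != 0 -> N x = N y -> w y <= w x.
  move=> x0 y0 E.
  have : vge w (x / y) 0.
    apply: norm_integral => //.
    have -> : N (x / y) = 1.
      apply: (mulIf (x := N y)); first by rewrite /N normK_eq0.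
      by rewrite mul1r /N -normKM divfK.
    by rewrite vge_1.
  by rewrite (vge_divE Hw') // add0r vgeE.
by apply/eqP; rewrite eq_le !key // /N normK_gal.
Qed.

(** The candidate is [v] composed with the norm, divided by the positive generator of its group of
    values. *)
Lemma ext_val_exists : exists w : M -> int, ext_val v w.
Proof.
pose W x := v (N x).
have N0 x : x != 0 -> N x != 0 by rewrite normK_eq0.
have WM x y : x != 0 -> y != 0 -> W (x * y) = W x + W y.
  by move=> x0 y0; rewrite /W /N normKM (dv_mul Hv) ?N0.
have [pi [pi0 vpi]] := dv_norm Hv.
have Walg k : k != 0 -> W k%:A = v k * #|[set: gT]|%:Z.
  by move=> k0; rewrite /W /N normK_alg (valX Hv).
have algn0 k : k != 0 -> (k%:A : M) != 0 by rewrite (fmorph_eq0 (in_alg M)).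
(* The shift by one makes [g.+1] below the least positive value. *)
pose P n := `[< exists x : M, x != 0 /\ W x = n.+1%:Z >].
have [|g /asboolP[x0 [x00 Wx0]] ming] := @ex_minnP P.
  exists #|[set: gT]|.-1; apply/asboolP; exists pi%:A; split; first exact: algn0.
  by rewrite Walg // vpi mul1r prednK.
have W1 : W 1 = 0 by rewrite /W /N normK1 dval1.
have WV x : x != 0 -> W x^-1 = - W x.
  move=> xn0; have := WM _ _ xn0 (invr_neq0 xn0); rewrite mulfV // W1 => h.
  by move: h; move: (W _) (W _) => a b; lia.
have WX x n : x != 0 -> W (x ^+ n) = W x * n%:Z.
  by move=> xn0; rewrite /W /N normKX (valX Hv) // N0.
have dvdW x : x != 0 -> (g.+1%:Z %| W x)%Z.
  move=> xn0.
  pose q := (W x %/ g.+1%:Z)%Z.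
  have [y [y0 Wy]] : exists y, y != 0 /\ W y = - (q * g.+1%:Z).
    have [le|gt] := lerP q 0.
      exists (x0 ^+ `|q|%N); rewrite expf_neq0 // WX // Wx0; split => //.
      by rewrite -[in RHS](opprK q) mulNr opprK [in RHS]mulrC; congr (_ * _); lia.
    exists ((x0 ^+ `|q|%N)^-1); rewrite invr_neq0 ?expf_neq0 // WV ?expf_neq0 // WX // Wx0.
    by split => //; rewrite mulrC; congr (- (_ * _)); lia.
  have Wr : W (x * y) = (W x %% g.+1%:Z)%Z.
    rewrite WM // Wy {1}(divz_eq (W x) g.+1%:Z) -/q; lia.
  apply/dvdz_mod0P; apply: contrapT => r0.
  have rlt : (W x %% g.+1%:Z)%Z < g.+1%:Z by exact: ltz_pmod.
  have rge : 0 <= (W x %% g.+1%:Z)%Z by rewrite modz_ge0.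
  have : P (`|(W x %% g.+1%:Z)%Z|.-1)%N.
    apply/asboolP; exists (x * y); rewrite mulf_neq0 // Wr; split => //.
    by move: r0 rge; move: (_ %% _)%Z => a; lia.
  by move=> /ming; move: r0 rge rlt; move: (_ %% _)%Z => a; lia.
pose w x := (W x %/ g.+1%:Z)%Z.
have wW x : x != 0 -> W x = w x * g.+1%:Z by move=> /dvdW /divzK.
exists w; split; last first.
  exists (w pi%:A); have wpi : W pi%:A = w pi%:A * g.+1%:Z by rewrite wW // algn0.
  move: (wpi); rewrite Walg // vpi mul1r => Epi; split; first by move: Epi nG; move: (w _) #|_| => a b; nia.
  move=> k k0; have := wW _ (algn0 _ k0); rewrite Walg // Epi => E.
  by move: E; move: (w _) (w _) (v _) => a b c; nia.
have w_int x y n : x != 0 -> y != 0 -> n <= w x -> w x <= w y -> vge w (x + y) n.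
  move=> xn0 yn0 hx hxy.
  have [E|s0] := eqVneq (x + y) 0; first by rewrite E vge0.
  rewrite vgeE //; apply: (le_trans hx).
  have h : vge v (N (y / x)) 0.
    rewrite vgeE ?N0 ?mulf_neq0 ?invr_neq0 // -/(W _) WM ?invr_neq0 // WV // !wW //.
    by move: (w x) (w y) hxy => a b; nia.
  have := norm_integral_add1 h.
  have -> : 1 + y / x = (x + y) / x by rewrite mulrDl mulfV.
  rewrite vgeE ?N0 ?mulf_neq0 ?invr_neq0 // -/(W _) WM ?invr_neq0 // WV // !wW //.
  by move: (w x) (w _) => a b; nia.
split.
- move=> x y xn0 yn0; have := WM _ _ xn0 yn0; rewrite !wW ?mulf_neq0 //.
  by move: (w _) (w _) (w _) => a b c; nia.
- move=> x y n.
  have [->|xn0] := eqVneq x 0; first by rewrite add0r.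
  have [->|yn0] := eqVneq y 0; first by rewrite addr0.
  rewrite (@vgeE _ w _ _ xn0) (@vgeE _ w _ _ yn0) => hx hy.
  have [le|/ltW le] := lerP (w x) (w y); first exact: w_int.
  by rewrite addrC; exact: w_int.
- exists x0; split => //.
  by have := wW _ x00; rewrite Wx0; move: (w _) => a; nia.
Qed.

End ExtendedValuation.

(** * Residue fields *)

(** [red] is a total function constrained only on integral elements, where it is a surjective ring
    morphism with kernel the maximal ideal. *)
Record residue_map (F : fieldType) (w : F -> int) (k : fieldType) (red : F -> k) : Prop := {
  redD : forall x y, vge w x 0 -> vge w y 0 -> red (x + y) = red x + red y;
  redM : forall x y, vge w x 0 -> vge w y 0 -> red (x * y) = red x * red y;
  red1 : red 1 = 1;
  red_eq0 : forall x, vge w x 0 -> (red x == 0) = vge w x 1;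
  red_surj : forall a, exists2 x, vge w x 0 & red x = a }.

Section ResidueField.
Variables (F : fieldType) (w : F -> int).
Hypothesis Hw : dvaluation w.
Variable s : seq F.
Hypothesis cover : forall x, vge w x 0 -> exists2 y, y \in s & vge w (x - y) 1.

(** Congruent elements define the same predicate, on which [choose] returns the same witness; [rep]
    thus picks one representative per class, and the residue field is carried by its fixed
    points. *)
Let rep x := choose (fun y => vge w (y - x) 1) x.

Let rep_congr x : vge w (rep x - x) 1.
Proof. by apply: (@chooseP _ (fun y => vge w (y - x) 1)); rewrite subrr vge0. Qed.

Let rep_eq x y : vge w (x - y) 1 -> rep x = rep y.
Proof.
move=> h; rewrite /rep.
have -> : (fun z => vge w (z - x) 1) = (fun z => vge w (z - y) 1).
  apply: funext => z; apply/idP/idP => h2; first exact: (vge_trans Hw h2 h).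
  by apply: (vge_trans Hw h2); rewrite (vgeBC Hw).
by apply: (@choose_id _ (fun z => vge w (z - y) 1)); rewrite ?subrr ?vge0.
Qed.

Let rep_int x : vge w x 0 -> vge w (rep x) 0.
Proof.
move=> h; rewrite -[rep x](subrK x); apply: (vgeD Hw) => //.
by apply: vgeW (rep_congr x).
Qed.

Let repK x : rep (rep x) = rep x.
Proof. by apply: rep_eq; apply: rep_congr. Qed.

Definition residue := {x : F | (vge w x 0) && (rep x == x)}.
HB.instance Definition _ := Choice.on residue.

Let zres : residue.
Proof.
exists (rep 0); rewrite repK eqxx andbT; apply: rep_int; exact: vge0.
Defined.

Let red (x : F) : residue := insubd zres (rep x).

Let val_red x : vge w x 0 -> val (red x) = rep x.
Proof. by move=> h; rewrite val_insubd rep_int // repK eqxx. Qed.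

Let val_int (a : residue) : vge w (val a) 0.
Proof. by case/andP: (valP a). Qed.

Let redK (a : residue) : red (val a) = a.
Proof.
apply: val_inj; rewrite val_red ?val_int //.
by case/andP: (valP a) => _ /eqP.
Qed.

Let redP x y : vge w x 0 -> vge w y 0 -> (red x == red y) = vge w (x - y) 1.
Proof.
move=> hx hy; apply/eqP/idP => [E|h]; last by rewrite /red (rep_eq h).
have {}E : rep x = rep y by rewrite -!val_red // E.
apply: (@vge_trans _ _ Hw _ (rep y)); last exact: rep_congr.
by rewrite (vgeBC Hw) -E.
Qed.

Let red_congr x y : vge w x 0 -> vge w y 0 -> vge w (x - y) 1 -> red x = red y.
Proof. by move=> hx hy h; apply/eqP; rewrite redP. Qed.

Let val_red_congr x : vge w x 0 -> vge w (val (red x) - x) 1.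
Proof. by move=> h; rewrite val_red. Qed.

Let ind (P : residue -> Prop) : (forall x, vge w x 0 -> P (red x)) -> forall a, P a.
Proof. by move=> h a; rewrite -(redK a); apply: h. Qed.

Let addr_ (a b : residue) := red (val a + val b).
Let oppr_ (a : residue) := red (- val a).
Let mulr_ (a b : residue) := red (val a * val b).
Let invr_ (a : residue) := if a == red 0 then a else red (val a)^-1.

Let addE x y : vge w x 0 -> vge w y 0 -> addr_ (red x) (red y) = red (x + y).
Proof.
move=> hx hy; apply: red_congr.
- by apply: vgeD.
- exact: vgeD.
- by rewrite opprD addrACA; apply: (vgeD Hw); apply: val_red_congr.
Qed.

Let oppE x : vge w x 0 -> oppr_ (red x) = red (- x).
Proof.
move=> hx; apply: red_congr; rewrite ?vgeN //.
by rewrite -opprD vgeN //; exact: val_red_congr.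
Qed.

Let mulE x y : vge w x 0 -> vge w y 0 -> mulr_ (red x) (red y) = red (x * y).
Proof.
move=> hx hy; apply: red_congr.
- by apply: vgeMl.
- by apply: vgeMl.
- have -> : val (red x) * val (red y) - x * y = val (red x) * (val (red y) - y) + (val (red x) - x) * y.
    by ring.
  by apply: (vgeD Hw); [apply: vgeMl|apply: vgeMr] => //; apply: val_red_congr.
Qed.

Let M0 x y : vge w x 0 -> vge w y 0 -> vge w (x * y) 0.
Proof. by move=> hx hy; apply: vgeMl. Qed.
Let D0 x y : vge w x 0 -> vge w y 0 -> vge w (x + y) 0.
Proof. exact: vgeD. Qed.

Let addA : associative addr_.
Proof.
elim/ind=> x hx; elim/ind=> y hy; elim/ind=> z hz.
by rewrite !addE ?addrA ?D0.
Qed.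
Let addC : commutative addr_.
Proof. by elim/ind=> x hx; elim/ind=> y hy; rewrite !addE // addrC. Qed.
Let add0 : left_id (red 0) addr_.
Proof. by elim/ind=> x hx; rewrite addE ?vge0 // add0r. Qed.
Let addN : left_inverse (red 0) oppr_ addr_.
Proof. by elim/ind=> x hx; rewrite oppE // addE ?vgeN // addNr. Qed.
HB.instance Definition _ := GRing.isZmodule.Build residue addA addC add0 addN.

Let mulA : associative mulr_.
Proof.
elim/ind=> x hx; elim/ind=> y hy; elim/ind=> z hz.
by rewrite !mulE ?mulrA ?M0.
Qed.
Let mulC : commutative mulr_.
Proof. by elim/ind=> x hx; elim/ind=> y hy; rewrite !mulE // mulrC. Qed.
Let mul1 : left_id (red 1) mulr_.
Proof. by elim/ind=> x hx; rewrite mulE ?vge_1 // mul1r. Qed.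
Let mulD : left_distributive mulr_ +%R.
Proof.
elim/ind=> x hx; elim/ind=> y hy; elim/ind=> z hz.
rewrite -![_ + _]/(addr_ _ _).
by rewrite !(addE, mulE) ?mulrDl ?D0 ?M0.
Qed.
Let one_neq0 : red 1 != 0.
Proof.
rewrite -[0]/(red 0) redP ?vge0 ?vge_1 // subr0 vgeE ?oner_neq0 //.
by rewrite dval1.
Qed.
HB.instance Definition _ := GRing.Zmodule_isComNzRing.Build residue mulA mulC mul1 mulD one_neq0.

Let mulV (a : residue) : a != 0 -> invr_ a * a = 1.
Proof.
elim/ind: a => x hx; rewrite -[0]/(red 0) /invr_ => n0; rewrite (negbTE n0).
move: n0; rewrite redP ?vge0 // subr0 => ux.
set y := val (red x).
have hyx : vge w (y - x) 1 by exact: val_red_congr.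
have hy : vge w y 0 by exact: val_int.
have uy : ~~ vge w y 1.
  by apply: contra ux => h; rewrite -[x](subKr y); apply: (vgeB Hw).
have [y0 wy] := val_unit hy uy.
have hyi : vge w y^-1 0 by rewrite vgeE ?invr_neq0 // (valV Hw) // wy.
rewrite -[_ * _]/(mulr_ _ _) mulE // -[1]/(red 1); apply: red_congr; rewrite ?vge_1 ?M0 //.
have -> : y^-1 * x - 1 = - (y^-1 * (y - x)) by rewrite mulrBr mulVf //; ring.
by rewrite vgeN //; apply: vgeMl.
Qed.
Let inv0 : invr_ 0 = 0.
Proof. by rewrite /invr_ eqxx. Qed.
HB.instance Definition _ := GRing.ComNzRing_isField.Build residue mulV inv0.

Let u : seq residue := map red s.
Let mem_u a : a \in u.
Proof.
elim/ind: a => x hx; have [y ys hxy] := cover hx.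
apply/mapP; exists y => //; apply: red_congr => //.
by rewrite -[y](subKr x); apply: (vgeB Hw) => //; apply: vgeW hxy.
Qed.
Let toI (a : residue) : 'I_(size u) := Ordinal (ltac:(by rewrite index_mem) : (index a u < size u)%N).
Let ofI (i : 'I_(size u)) := nth (red 0) u i.
Let toIK : cancel toI ofI.
Proof. by move=> a; rewrite /ofI /= nth_index. Qed.
HB.instance Definition _ : isCountable residue := CanIsCountable toIK.
HB.instance Definition _ : isFinite residue := CanIsFinite toIK.

Lemma residue_field : exists (k : finFieldType) (r : F -> k), residue_map w r.
Proof.
exists residue, red; split.
- by move=> x y hx hy; rewrite -addE.
- by move=> x y hx hy; rewrite -mulE.
- by [].
- by move=> x hx; rewrite -[0]/(red 0) redP ?vge0 // subr0.
- by elim/ind => x hx; exists x.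
Qed.
End ResidueField.

Section ResidueTheory.
Variables (F : fieldType) (w : F -> int) (k : finFieldType) (red : F -> k) (p : nat).
Hypothesis Hw : dvaluation w.
Hypothesis Hr : residue_map w red.

Lemma red0 : red 0 = 0.
Proof. by apply/eqP; rewrite (red_eq0 Hr) vge0. Qed.

Lemma redN x : vge w x 0 -> red (- x) = - red x.
Proof.
move=> hx; apply/eqP; rewrite -addr_eq0 -(redD Hr) ?vgeN //.
by rewrite addNr red0.
Qed.

Lemma redB x y : vge w x 0 -> vge w y 0 -> red (x - y) = red x - red y.
Proof. by move=> hx hy; rewrite (redD Hr) ?vgeN // redN. Qed.

Lemma red_eq x y : vge w x 0 -> vge w y 0 -> (red x == red y) = vge w (x - y) 1.
Proof. by move=> hx hy; rewrite -subr_eq0 -redB // (red_eq0 Hr) //; apply: vgeB. Qed.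

Lemma redX x n : vge w x 0 -> red (x ^+ n) = red x ^+ n.
Proof.
move=> hx; elim: n => [|n IH]; first by rewrite !expr0 (red1 Hr).
by rewrite !exprS (redM Hr) ?IH //; apply: vgeX0.
Qed.

Lemma red_nat n : red n%:R = n%:R.
Proof.
elim: n => [|n IH]; first by rewrite !mulr0n red0.
by rewrite -addn1 !natrD (redD Hr) ?IH ?(red1 Hr) //; [apply: vge_nat|apply: vge_1].
Qed.

Lemma red_sum (I : Type) (r : seq I) (P : pred I) (E : I -> F) :
  (forall i, P i -> vge w (E i) 0) ->
  red (\sum_(i <- r | P i) E i) = \sum_(i <- r | P i) red (E i).
Proof.
move=> h; suff [] : red (\sum_(i <- r | P i) E i) = \sum_(i <- r | P i) red (E i) /\
  vge w (\sum_(i <- r | P i) E i) 0 by [].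
elim/big_ind2: _ => [|x1 x2 y1 y2 [h1 h2] [h3 h4]|i Pi].
- by rewrite red0 vge0.
- by rewrite (redD Hr) // h1 h3; split => //; apply: vgeD.
- by split => //; apply: h.
Qed.

Hypothesis rc : residue_char w p.

Lemma residue_pchar : p \in [pchar k].
Proof.
rewrite inE (residue_char_prime rc) /= -red_nat (red_eq0 Hr) ?vge_nat //.
exact: residue_char_val rc.
Qed.

Lemma card_residue : exists2 d, (0 < d)%N & #|k| = (p ^ d)%N.
Proof.
have pp := residue_char_prime rc.
have pk : (p.-group [set: k])%g.
  apply/pgroupP => q qp; case/Cauchy => // x _ ox.
  have : (x ^+ p)%g = 1%g by rewrite FinRing.zmodXgE -mulr_natr (pcharf0 residue_pchar) mulr0.
  move/eqP; rewrite -order_dvdn ox dvdn_prime2 //.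
have [d E] := p_natP pk; rewrite cardsT in E.
exists d => //; rewrite lt0n; apply/negP => /eqP d0.
by have := finNzRing_gt1 k; rewrite -[#|k|]/(#|_|) {}E d0.
Qed.

Lemma residue_generator : exists g : k, forall a, a != 0 -> exists j, a = g ^+ j.
Proof.
have /cyclicP[g Eg] := field_unit_group_cyclic [set: {unit k}]%G.
exists (FinRing.uval g) => a a0; have ua : a \is a GRing.unit by rewrite unitfE.
have : FinRing.unit k ua \in <[g]>%g by rewrite -Eg inE.
case/cycleP => j E; exists j.
by have := congr1 val E; rewrite /= FinRing.val_unitX.
Qed.

End ResidueTheory.

Section FiniteResidueExtension.
Variables (K : fieldType) (v : K -> int) (M : splittingFieldType K) (w : M -> int).
Hypothesis Hv : dvaluation v.
Hypothesis Hw : ext_val v w.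
Variable s : seq K.
Hypothesis cover : forall x, vge v x 0 -> exists2 y, y \in s & vge v (x - y) 1.

Let Hw' : dvaluation w. Proof. by case: Hw. Qed.

Let algv1 c : vge v c 1 -> vge w c%:A 1.
Proof. by move=> h; have [e0 e00] := ext_val_alg Hw h; apply: vgeW; lia. Qed.

(** The residues of the [om i] are linearly independent over the residue field of [K]. *)
Let indep d (om : 'I_d -> M) := (forall i, vge w (om i) 0) /\
  forall c : 'I_d -> K, (forall i, vge v (c i) 0) ->
    vge w (\sum_(i < d) c i *: om i) 1 -> forall i, vge v (c i) 1.

(** A nontrivial relation over [K], divided by its coefficient of least valuation, would be an
    integral relation with a unit coefficient. *)
Let indep_dim d om : @indep d om -> (d <= \dim {:M})%N.
Proof.
move=> [h1 h2].
pose X : d.-tuple M := [tuple om i | i < d].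
suff /eqnP fX : free X by rewrite -[d](size_tuple X) -fX dimvS ?subvf.
apply/freeP => c Ec i.
have {}Ec : \sum_(i < d) c i *: om i = 0.
  by rewrite -[RHS]Ec; apply: eq_bigr => j _; rewrite (nth_map j) ?size_enum_ord // nth_ord_enum.
apply/eqP; apply/negPn/negP => ci0.
have [j cj0 minj] := @arg_minP _ _ _ i (fun i => c i != 0) (fun i => v (c i)) ci0.
have E0 : \sum_(l < d) (c l / c j) *: om l = 0.
  under eq_bigr => l _ do rewrite mulrC -scalerA.
  by rewrite -scaler_sumr Ec scaler0.
have hc l : vge v (c l / c j) 0.
  have [->|cl0] := eqVneq (c l) 0; first by rewrite mul0r vge0.
  by rewrite (vge_divE Hv) // add0r vgeE // minj.
have := h2 (fun l => c l / c j) hc; rewrite E0 vge0 => /(_ isT j).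
by rewrite divff // vgeE ?oner_neq0 // dval1.
Qed.

(** Finiteness of the residue field of [M]: in a maximal family with independent residues, every
    integral [x] is congruent to an integral combination, whose coefficients may be replaced by
    elements of [s]. *)
Lemma residue_cover_ext :
  exists s' : seq M, forall x, vge w x 0 -> exists2 y, y \in s' & vge w (x - y) 1.
Proof.
pose P d := `[< exists om, @indep d om >].
have exP : exists d, P d.
  exists 0%N; apply/asboolP; exists (fun=> 0); split; first by case.
  by move=> c _ _; case.
have bound d : P d -> (d <= \dim {:M})%N.
  by move=> /asboolP[om] /indep_dim.
have [d /asboolP[om [om0 ind]] maxd] := ex_maxnP exP bound.
pose comb (c : {ffun 'I_d -> 'I_(size s)}) := \sum_(i < d) (nth 0 s (c i)) *: om i.
exists [seq comb c | c : {ffun 'I_d -> 'I_(size s)}] => x hx.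
pose om' (i : 'I_d.+1) := if unlift ord_max i is Some j then om j else x.
have nind : ~ indep om'.
  move=> h; suff : P d.+1 by move/maxd; rewrite ltnn.
  by apply/asboolP; exists om'.
have om'0 i : vge w (om' i) 0 by rewrite /om'; case: unliftP.
have sumE c : \sum_(i < d.+1) c i *: om' i =
    \sum_(i < d) c (widen_ord (leqnSn d) i) *: om i + c ord_max *: x.
  rewrite big_ord_recr /= /om' unlift_none; congr (_ + _).
  apply: eq_bigr => i _.
  have -> : widen_ord (leqnSn d) i = lift ord_max i by apply: ord_inj; rewrite lift_max.
  by rewrite liftK.
have [c [hc hs nc]] : exists c : 'I_d.+1 -> K, [/\ forall i, vge v (c i) 0,
    vge w (\sum_(i < d.+1) c i *: om' i) 1 & ~ forall i, vge v (c i) 1].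
  apply: contrapT => H; apply: nind; split => // c hc hs.
  by apply: contrapT => h; apply: H; exists c.
rewrite sumE in hs.
have um : ~~ vge v (c ord_max) 1.
  apply/negP => hm; apply: nc => i.
  have hs' : vge w (\sum_(i < d) c (widen_ord (leqnSn d) i) *: om i) 1.
    rewrite -[X in vge w X 1](addrK (c ord_max *: x)); apply: vgeB => //.
    by rewrite -mulr_algl; apply: vgeMr => //; apply: algv1.
  have := ind _ (fun i => hc _) hs'.
  case: (unliftP ord_max i) => [j ->|->] // h.
  have := h j; congr (vge v (c _) 1).
  by apply: ord_inj; rewrite lift_max.
have [cm0 vcm] := val_unit (hc ord_max) um.
pose b (i : 'I_d) := - (c (widen_ord (leqnSn d) i) / c ord_max).
have hb i : vge v (b i) 0 by rewrite vgeN // (vge_divE Hv) // vcm addr0.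
have /choice[y hy] : forall i, exists j : 'I_(size s), vge v (b i - nth 0 s j) 1.
  move=> i; have [y ys hy] := cover (hb i).
  have iy : (index y s < size s)%N by rewrite index_mem.
  by exists (Ordinal iy); rewrite nth_index.
exists (comb (finfun y)); first by apply: map_f; rewrite mem_enum.
apply: (@vge_trans _ _ Hw' _ (\sum_(i < d) b i *: om i)).
  rewrite -(@vgeM_unit _ _ Hw' (c ord_max)%:A); last first.
  - by case: Hw => _ [e0 [_ ->]] //; rewrite vcm mulr0.
  - by rewrite (fmorph_eq0 (in_alg M)).
  rewrite mulr_algl scalerBr scaler_sumr addrC.
  move: hs; congr (vge w (_ + _) 1); rewrite -sumrN; apply: eq_bigr => i _.
  by rewrite scalerA /b mulrN scaleNr opprK mulrC divfK.
rewrite /comb -sumrB; apply: vge_sum => // i _.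
rewrite -scalerBl ffunE -mulr_algl; apply: vgeMr => //.
exact: algv1.
Qed.

End FiniteResidueExtension.

(** * Elements generating a dense subring of the integers *)

Definition zdense (F : fieldType) (w : F -> int) (x : F) :=
  forall (n : nat) y, vge w y 0 ->
    exists g : {poly int}, vge w (y - (map_poly intr g).[x]) n%:Z.

Section DenseElement.
Variables (F : fieldType) (w : F -> int) (k : finFieldType) (red : F -> k) (p : nat).
Hypothesis Hw : dvaluation w.
Hypothesis Hr : residue_map w red.
Hypothesis rc : residue_char w p.

Lemma zdense_exists : exists2 x, vge w x 0 & zdense w x.
Proof.
have [d d0 Ek] := card_residue Hw Hr rc.
have [gam Hgam] := residue_generator k.
have [g g0 Eg] := red_surj Hr gam.
have [pi [pi0 wpi]] := dv_norm Hw.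
pose Q := (p ^ d)%N.
have frob y : vge w y 0 -> vge w (y ^+ Q - y) 1.
  move=> hy; rewrite -(red_eq Hw Hr) ?(redX Hw Hr) //; last exact: vgeX0.
  by rewrite /Q -Ek expf_card.
(* Replacing [g] by its [Q]-th power makes [a ^+ Q - a] of valuation at least [2], so that
   [x ^+ Q - x] is congruent to [- pi] and is itself a uniformizer, in [Z[x]]. *)
pose a := g ^+ Q.
have a0 : vge w a 0 by exact: vgeX0.
have pi1 : vge w pi 1 by rewrite vgeE // wpi.
pose x := a + pi.
have x0 : vge w x 0 by apply: vgeD => //; apply: vgeW pi1.
have xa : vge w (x - a) 1 by rewrite /x addrC addKr.
have rx : red x = gam.
  rewrite -Eg; apply/eqP; rewrite (red_eq Hw Hr) //.
  by apply: (vge_trans Hw xa); exact: frob.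
pose R := x ^+ Q - x.
have [R0 wR] : R != 0 /\ w R = 1.
  rewrite -wpi -[w pi](valN Hw); apply: (val_congr Hw); first by rewrite oppr_eq0.
  rewrite valN // wpi.
  have -> : R - - pi = (x ^+ Q - a ^+ Q) + (a ^+ Q - a) by rewrite /R /x; ring.
  apply: (vgeD Hw).
    by apply: (vgeW _ (pow_congr_iter Hw d rc x0 a0 xa)); lia.
  by apply: (vgeW _ (pow_congr_iter Hw d rc a0 g0 (frob _ g0))); lia.
exists x => // n; elim: n => [|n IH] y hy.
  by exists 0; rewrite rmorph0 horner0 subr0.
have [g1 hg1] : exists g1 : {poly int}, vge w (y - (map_poly intr g1).[x]) 1.
  have [E|ry] := eqVneq (red y) 0.
    by exists 0; rewrite rmorph0 horner0 subr0 -(red_eq0 Hr) // E.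
  have [j Ej] := Hgam _ ry.
  exists 'X^j; rewrite map_polyXn hornerXn -(red_eq Hw Hr) //; last exact: vgeX0.
  by rewrite (redX Hw Hr) // rx Ej.
set y1 := y - _ in hg1.
have hy1 : vge w (y1 / R) 0 by rewrite (vge_divE Hw) // add0r wR.
have [g2 hg2] := IH _ hy1.
(* One digit of the expansion of [y] in powers of the uniformizer [R], with digits [0] or powers of
   [x]. *)
exists (g1 + ('X^Q - 'X) * g2).
rewrite rmorphD rmorphM rmorphB /= map_polyXn map_polyX !hornerE -/R.
have -> : y - ((map_poly intr g1).[x] + R * (map_poly intr g2).[x]) =
   R * (y1 / R - (map_poly intr g2).[x]).
  by rewrite mulrBr mulrCA divff // mulr1 /y1 opprD addrA.
by rewrite (vgeMlE Hw) // wR; apply: vgeW hg2; lia.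
Qed.

End DenseElement.

Section Nodes.
Variables (F : fieldType) (w : F -> int).
Hypothesis Hw : dvaluation w.

(* An integral polynomial which is almost constant on distinct nodes [zs] is as close to that
   constant at [x] as the product of the distances from [x] to the nodes allows (the division
   of [g - c] by [\prod ('X - z)] is iterated, [C] bounding the loss at each step). *)
Lemma nodes_bound (zs : seq F) (x : F) (S : int) :
  uniq zs -> all (fun z => vge w z 0) zs -> vge w x 0 -> x \notin zs ->
  exists C : int, forall (g : {poly F}) c, pvge w g 0 -> vge w c 0 ->
    (forall z, z \in zs -> vge w (g.[z] - c) C) ->
   vge w (g.[x] - c) (Num.min S (\sum_(z <- zs) w (x - z))).
Proof.
elim: zs S => [|z zs IH] S /=.
  move=> _ _ hx _; exists 0 => g c hg hc _; rewrite big_nil.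
  by apply: (@vgeW _ _ _ 0); [rewrite ge_min lexx orbT|apply: vgeB => //; apply: pvge_horner].
move=> /andP[zzs uzs] /andP[hz hzs] hx; rewrite inE negb_or => /andP[xz xzs].
have [C HC] := IH (S - w (x - z)) uzs hzs hx xzs.
pose D := \sum_(y <- zs) `|w (y - z)|.
exists (Num.max (C + D) S) => g c hg hc H.
have [R [ER hR]] := pvge_factor_theorem Hw hg hz.
have Eg u : g.[u] - g.[z] = R.[u] * (u - z) by rewrite {1}ER !hornerE addrK.
have H2 : forall y, y \in zs -> vge w (R.[y] - 0) C.
  move=> y yzs; have yz : y - z != 0.
    by rewrite subr_eq0; apply: contraNneq zzs => <-.
  have : vge w (R.[y] * (y - z)) (C + D).
    rewrite -Eg; have -> : g.[y] - g.[z] = (g.[y] - c) - (g.[z] - c) by ring.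
    by apply: (vgeB Hw); apply: (vgeW _ (H _ _)); rewrite ?inE ?eqxx ?yzs ?orbT ?le_max ?lexx.
  rewrite mulrC (vgeMlE Hw) // subr0; apply: vgeW.
  have : `|w (y - z)| <= D.
    rewrite /D (big_rem y) //= lerDl; apply: sumr_ge0 => i _; exact: normr_ge0.
  by move: (w _) => a; lia.
have := HC R 0 hR (vge0 _ _) H2; rewrite subr0 => hRx.
have -> : g.[x] - c = R.[x] * (x - z) + (g.[z] - c) by rewrite -Eg; ring.
have xz0 : x - z != 0 by rewrite subr_eq0.
apply: (vgeD Hw).
  rewrite mulrC (vgeMlE Hw) // big_cons; apply: vgeW hRx.
  by move: (w _) (\sum_(_ <- _) _) => a b; lia.
apply: (vgeW _ (H z _)); last by rewrite inE eqxx.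
by rewrite le_max !ge_min lexx !orbT.
Qed.

End Nodes.

(** * Ramification groups *)

Section RamificationIndex.
Variables (K : fieldType) (M : splittingFieldType K) (w : M -> int) (xs : M).
Hypothesis galM1 : galois 1%AS {:M}.
Hypothesis Hw : dvaluation w.
Notation gT := (gal_of {:M}).
Implicit Types (s t : gT).
Hypothesis wgal : forall (s : gT) x, w (s x) = w x.
Hypothesis xs_int : vge w xs 0.
Hypothesis xs_dense : zdense w xs.

Lemma vge_gal (s : gT) x n : vge w (s x) n = vge w x n.
Proof. by rewrite /vge fmorph_eq0 wgal. Qed.

Lemma gal_intpoly (s : gT) (g : {poly int}) x :
  s ((map_poly intr g).[x]) = (map_poly intr g).[s x].
Proof.
rewrite -horner_map -map_poly_comp; congr (_.[_]); apply: eq_map_poly => z /=.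
exact: rmorph_int.
Qed.

Lemma pvge_intpoly (g : {poly int}) : pvge w (map_poly intr g) 0.
Proof.
move=> i; rewrite coef_map /=; case: (g`_i) => n.
  exact: vge_nat.
by rewrite NegzE mulrNz vgeN //; apply: vge_nat.
Qed.

(** For [y = g(xs)] with [g] over the integers, [s y - y = g(s xs) - g(xs)] is divisible by
    [s xs - xs]; density gives the rest. *)
Lemma gal_dense_min (s : gT) y n : vge w (s xs - xs) n -> vge w y 0 -> vge w (s y - y) n.
Proof.
move=> hs hy; have [g hg] := xs_dense `|n|%N hy.
have -> : s y - y = s (y - (map_poly intr g).[xs]) - (y - (map_poly intr g).[xs])
   + ((map_poly intr g).[s xs] - (map_poly intr g).[xs]).
  by rewrite rmorphB /= gal_intpoly; ring.
apply: (vgeD Hw); first by apply: (vgeB Hw); rewrite ?vge_gal; apply: vgeW hg; lia.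
have [R [ER hR]] := pvge_factor_theorem Hw (pvge_intpoly g) xs_int.
rewrite {1}ER !hornerE addrK; apply: (vgeMl Hw) => //.
by apply: pvge_horner => //; rewrite vge_gal.
Qed.

Lemma gal_xs_neq (s : gT) : s != 1%g -> s xs - xs != 0.
Proof.
apply: contra => /eqP h; apply/eqP; apply: gal_ext => x; rewrite gal_id.
have int_fixed y : vge w y 0 -> s y = y.
  move=> hy; apply/eqP; rewrite -subr_eq0; apply/eqP; apply: (@vge_eq0 _ w) => n.
  by apply: gal_dense_min => //; rewrite h vge0.
have [->|x0] := eqVneq x 0; first by rewrite rmorph0.
have [le|gt] := lerP 0 (w x); first by apply: int_fixed; rewrite vgeE.
apply: invr_inj; rewrite -fmorphV; apply: int_fixed.
by rewrite vgeE ?invr_neq0 // (valV Hw) //; move: gt; move: (w _) => a; lia.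
Qed.

(** A finite stand-in for the infinite index of the identity, above all other indices. The [.+2]
    makes it at least [2], so that [inertial_wild] also holds for the identity. *)
Definition ramidx_bound := (\max_(s : gT) `|w (s xs - xs)|%N).+2.
Definition ramidx (s : gT) := if s == 1%g then ramidx_bound else `|w (s xs - xs)|%N.
Local Notation idx := ramidx.

Lemma ramidxE s : s != 1%g -> (idx s)%:Z = w (s xs - xs).
Proof.
move=> s1; rewrite /idx (negbTE s1).
have : vge w (s xs - xs) 0 by apply: (vgeB Hw); rewrite ?vge_gal.
by rewrite vgeE ?gal_xs_neq //; move: (w _) => a; lia.
Qed.

Lemma ramidx1 : idx 1%g = ramidx_bound. Proof. by rewrite /idx eqxx. Qed.

Lemma ramidx_lt s : s != 1%g -> (idx s < ramidx_bound)%N.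
Proof.
move=> s1; rewrite /idx (negbTE s1) ltnS; apply: leqW.
exact: (@leq_bigmax _ (fun s : gT => `|w (s xs - xs)|%N)).
Qed.

Lemma ramidx_le s : (idx s <= ramidx_bound)%N.
Proof. by have [->|/ramidx_lt/ltnW//] := eqVneq s 1%g; rewrite ramidx1. Qed.

Lemma ramidx_vge s n : vge w (s xs - xs) n = (s == 1%g) || (n <= (idx s)%:Z).
Proof.
have [->|s1] := eqVneq s 1%g; first by rewrite gal_id subrr vge0.
by rewrite vgeE ?gal_xs_neq // ramidxE.
Qed.

Lemma ramidxP (s : gT) n : (s == 1%g) || (n <= (idx s)%:Z) <->
  forall y, vge w y 0 -> vge w (s y - y) n.
Proof.
rewrite -ramidx_vge; split; last by apply.
by move=> h y; apply: gal_dense_min.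
Qed.

Lemma ramidx_vgeP (s : gT) y : vge w y 0 -> vge w (s y - y) (idx s)%:Z.
Proof. by move: y; apply/ramidxP; rewrite lexx orbT. Qed.

Lemma ramidx_geP (s : gT) c : (c <= ramidx_bound)%N ->
  (forall y, vge w y 0 -> vge w (s y - y) c%:Z) -> (c <= idx s)%N.
Proof.
by move=> cB /ramidxP /orP[/eqP->|//]; rewrite ramidx1.
Qed.

Lemma ramidxM s t : (minn (idx s) (idx t) <= idx (s * t)%g)%N.
Proof.
apply: ramidx_geP => [|y hy]; first by rewrite geq_min ramidx_le.
rewrite galMx; have -> : t (s y) - y = t (s y - y) + (t y - y) by rewrite rmorphB; ring.
apply: (vgeD Hw); rewrite ?vge_gal; apply: vgeW (ramidx_vgeP _ hy); lia.
Qed.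

Lemma ramidxV s : idx s^-1%g = idx s.
Proof.
have key t : (idx t <= idx t^-1%g)%N.
  apply: ramidx_geP => [|y hy]; first exact: ramidx_le.
  rewrite -(vge_gal t) rmorphB /= galKV (vgeBC Hw); exact: ramidx_vgeP.
by apply/eqP; rewrite eqn_leq key -{2}[s]invgK key.
Qed.

Lemma mem_lower_ram s n : (s \in lower_ram w n) = (s == 1%g) || (n + 1 <= (idx s)%:Z).
Proof.
rewrite inE galT // inE /=; apply/asboolP/idP => /ramidxP //.
Qed.

(** The lower group of index [c - 1]. Beyond [ramidx_bound] even the identity is lost, hence the
    [minn] in the next lemma. *)
Definition ramsub c : {set gT} := [set s | c <= idx s]%N.

Lemma group_set_ramsub c : group_set (ramsub (minn c ramidx_bound)).
Proof.
apply/group_setP; split; first by rewrite inE ramidx1 geq_minr.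
by move=> s t; rewrite !inE => hs ht; apply: leq_trans (ramidxM s t); rewrite leq_min hs.
Qed.

Lemma lower_ramE (j : nat) : (j < ramidx_bound)%N -> lower_ram w j%:Z = ramsub j.+1.
Proof.
move=> jB; apply/setP => s; rewrite mem_lower_ram inE.
have [->|s1] /= := eqVneq s 1%g; first by rewrite ramidx1 jB.
by lia.
Qed.

(** For the whole group and [c] up to [ramidx_bound] this is [|G_0| (phi(c - 1) + 1)], with [phi]
    the Herbrand function: counting by layers turns the sum of minima into the sum of the orders of
    the lower groups. *)
Definition phisum (A : {set gT}) (c : nat) := (\sum_(s in A) minn (idx s) c)%N.
Local Notation Phi := (phisum [set: gT]).

Lemma phisum_layers A c : phisum A c = (\sum_(0 <= j < c) #|A :&: ramsub j.+1|)%N.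
Proof.
have -> : phisum A c = (\sum_(s in A) \sum_(0 <= j < c) (s \in ramsub j.+1))%N.
  apply: eq_bigr => s _; elim: c => [|c IH]; first by rewrite big_nil minn0.
  by rewrite big_nat_recr //= -IH inE; lia.
rewrite exchange_big /=; apply: eq_bigr => j _.
by rewrite -big_mkcondr /= sum1dep_card; apply: eq_card => s; rewrite !inE.
Qed.

Lemma herbrand_neg n : n < 0 -> herbrand w n = n%:~R.
Proof. by rewrite /herbrand => ->. Qed.

Lemma herbrand_ge0 n : 0 <= n -> 0 <= herbrand w n.
Proof.
move=> h; rewrite /herbrand ifF; last by lia.
by rewrite divr_ge0 ?ler0n // sumr_ge0 // => i _; rewrite ler0n.
Qed.

Lemma card_lower_gt0 n : (0 < #|lower_ram w n|)%N.
Proof. by apply/card_gt0P; exists 1%g; rewrite mem_lower_ram eqxx. Qed.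

Lemma herbrand_mono m n : m <= n -> herbrand w m <= herbrand w n.
Proof.
move=> mn; have [n0|n0] := ltrP n 0.
  by rewrite !herbrand_neg ?ler_int //; lia.
have [m0|m0] := ltrP m 0.
  by apply: le_trans (herbrand_ge0 n0); rewrite herbrand_neg // lerz0 ltW.
rewrite /herbrand !ifF; [|lia|lia].
apply: ler_wpM2r; first by rewrite invr_ge0 ler0n.
rewrite (@big_cat_nat _ _ _ `|m|.+1 1 `|n|.+1) //=; last by lia.
by rewrite lerDl sumr_ge0 // => i _; rewrite ler0n.
Qed.

Lemma herbrand_phisum (c : nat) : (c <= ramidx_bound)%N ->
  (herbrand w (c%:Z - 1) + 1) * #|lower_ram w 0|%:R = (Phi c)%:R.
Proof.
have g0 : (#|lower_ram w 0|%:R : rat) != 0 by rewrite pnatr_eq0 -lt0n card_lower_gt0.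
case: c => [|c] cB.
  by rewrite herbrand_neg // sub0r rmorphN /= addNr mul0r /phisum big1 // => s _; rewrite minn0.
have -> : c.+1%:Z - 1 = c%:Z by lia.
rewrite /herbrand ltz_nat ltn0 /= mulrDl mul1r divfK // phisum_layers [X in _ = X%:R]big_nat_recl //= natrD addrC.
congr (_ + _).
  by congr (_%:R); apply: eq_card => s; rewrite setTI lower_ramE.
rewrite natr_sum big_add1 /= big_nat_cond [RHS]big_nat_cond; apply: eq_bigr => i /andP[/andP[_ ic] _].
by rewrite setTI lower_ramE //; lia.
Qed.

Lemma mem_upper_ram s u : (s \in upper_ram w u) =
  (s == 1%g) || ((u + 1) * #|lower_ram w 0|%:R <= (Phi (idx s))%:R).
Proof.
have g0 : (0 < #|lower_ram w 0|%:R :> rat) by rewrite ltr0n card_lower_gt0.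
rewrite inE; have [->|s1] /= := eqVneq s 1%g.
  (* The identity lies in every lower group, so any [n] with [phi n >= u] will do; each lower group
     has at least one element, whence [phi n >= n / |G_0|]. *)
  apply/asboolP; pose n := Num.bound (u * #|lower_ram w 0|%:R).
  exists n%:Z; split => //; split; first by rewrite mem_lower_ram eqxx.
  rewrite /herbrand ltz_nat ltn0 /= ler_pdivlMr //.
  apply: (le_trans (ler_norm _)); apply: (le_trans (ltW (archi_boundP (normr_ge0 _)))).
  rewrite -/n -natr_sum ler_nat.
  have -> : Num.bound `|u * #|lower_ram w 0|%:R| = n.
    by rewrite /n /Num.bound normr_id.
  rewrite -{1}[n]subn0 -[(n - 0)%N]muln1 -sum_nat_const_nat big_add1 /=.
  by apply: leq_sum => i _; exact: card_lower_gt0.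
rewrite -herbrand_phisum ?ramidx_le // ler_pM2r // lerD2r.
apply/asboolP/idP => [[n [n1 []]]|h].
  rewrite mem_lower_ram (negbTE s1) /= => h1 h2; apply: (le_trans h2).
  by apply: herbrand_mono; lia.
exists ((idx s)%:Z - 1); split; first by lia.
by rewrite mem_lower_ram subrK lexx orbT.
Qed.

Section Quotient.
Variable N : {group gT}.
Variable s : gT.
Hypothesis sN : s \notin N.

Lemma coset_neq1 r : r \in N -> (r * s)%g != 1%g.
Proof.
move=> rN; apply: contra sN => /eqP E.
by rewrite -(groupMl _ rN) E group1.
Qed.

(** Approximate [y] by [g(xs)]. At each node [(r * s) xs] with [r] in [N] the polynomial [g] is
    close to the same constant [s y], because [y] is fixed by [N]; [nodes_bound] then controls
    [g(xs) - s y]. *)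
Lemma fixed_val_ge y : vge w y 0 -> (forall r, r \in N -> r y = y) ->
  vge w (s y - y) (\sum_(r in N) idx (r * s)%g)%N%:Z.
Proof.
move=> hy yN; set S := (\sum_(r in N) _)%N.
pose zs := [seq (r * s)%g xs | r <- enum N].
have [||||C HC] := @nodes_bound _ w Hw zs xs S%:Z.
- rewrite map_inj_in_uniq ?enum_uniq // => r1 r2 _ _ E; apply: (mulIg s).
  apply/eqP; rewrite eq_mulgV1; apply: contraT => /gal_xs_neq.
  by rewrite galMx E -galMx mulgV gal_id subrr eqxx.
- by apply/allP => _ /mapP[r _ ->]; rewrite vge_gal.
- exact: xs_int.
- apply/negP => /mapP[r]; rewrite mem_enum => rN E.
  by have := gal_xs_neq (coset_neq1 rN); rewrite -E subrr eqxx.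
have [g hg] := xs_dense (`|C|%N + S)%N hy.
have := HC (map_poly intr g) (s y) (pvge_intpoly g); rewrite vge_gal => /(_ hy).
have -> : \sum_(z <- zs) w (xs - z) = S%:Z.
  rewrite /zs big_map big_enum /S /= -[RHS]natz natr_sum; apply: eq_bigr => r rN.
  by rewrite -(valN Hw) opprB natz ramidxE // coset_neq1.
rewrite minxx => H.
have -> : s y - y = - ((map_poly intr g).[xs] - s y) - (y - (map_poly intr g).[xs]) by ring.
apply: (vgeB Hw); last by apply: vgeW hg; lia.
rewrite vgeN //; apply: H => z /mapP[r]; rewrite mem_enum => rN ->.
rewrite -gal_intpoly; have -> : s y = (r * s)%g y by rewrite galMx (yN r rN).
by rewrite -rmorphB vge_gal (vgeBC Hw); apply: vgeW hg; lia.
Qed.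

(** The polynomial with roots [r xs], [r] in [N], has coefficients fixed by [N]. Its image under [s]
    takes at [xs] the value [\prod_r (xs - (r * s) xs)], of valuation exactly the sum, while the
    polynomial vanishes there; some coefficient must attain the bound. *)
Lemma fixed_val_attained : exists y, [/\ vge w y 0, forall r, r \in N -> r y = y
  & ~~ vge w (s y - y) ((\sum_(r in N) idx (r * s)%g)%N%:Z + 1)].
Proof.
set S := (\sum_(r in N) _)%N.
pose f : {poly M} := \prod_(r in N) ('X - (r xs)%:P).
have fN t : t \in N -> map_poly t f = f.
  move=> tN; rewrite rmorph_prod /= [RHS](reindex_inj (mulIg t)) /=.
  apply: eq_big => r; first by rewrite groupMr.
  by move=> _; rewrite rmorphB /= map_polyX map_polyC /= galMx.
have f0 : pvge w f 0.
  rewrite /f; elim/big_rec: _ => [|r g _ hg]; first exact: pvge1.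
  rewrite -[0](addr0 0); apply: pvgeM => // i; rewrite coefB coefX coefC.
  by apply: (vgeB Hw); case: eqP => _; rewrite ?vge0 ?vge_1 ?vge_gal.
apply: contrapT => H.
have hc : pvge w (map_poly s f - f) (S%:Z + 1).
  move=> i; rewrite coefB coef_map /=; apply/negPn/negP => h; apply: H.
  exists f`_i; split => // r rN.
  by have := congr1 (fun q : {poly M} => q`_i) (fN r rN); rewrite coef_map.
have : vge w (map_poly s f - f).[xs] (S%:Z + 1).
  rewrite horner_coef; apply: (vge_sum Hw) => i _; apply: (vgeMr Hw); first exact: hc.
  exact: vgeX0.
have -> : (map_poly s f - f).[xs] = \prod_(r in N) (xs - (r * s)%g xs).
  rewrite hornerD hornerN [f.[xs]](_ : _ = 0) ?subr0.
    rewrite rmorph_prod horner_prod; apply: eq_bigr => r _ /=.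
    by rewrite rmorphB /= map_polyX map_polyC !hornerE galMx.
  rewrite horner_prod (bigD1 1%g) ?group1 //= !hornerE gal_id subrr mul0r //.
have n0 r : r \in N -> xs - (r * s)%g xs != 0.
  by move=> rN; rewrite -oppr_eq0 opprB gal_xs_neq // coset_neq1.
rewrite vgeE; last by apply/prodf_neq0.
rewrite (val_prod Hw) //.
have -> : \sum_(r in N) w (xs - (r * s)%g xs) = S%:Z.
  rewrite /S -[RHS]natz natr_sum; apply: eq_bigr => r rN.
  by rewrite -(valN Hw) opprB natz ramidxE // coset_neq1.
by lia.
Qed.

End Quotient.

Section OneJump.
Variable N : {group gT}.
Local Notation S s := (\sum_(r in N) idx (r * s)%g)%N.

(** If [s] has the largest index in its coset, then [idx (r * s)] is the minimum of [idx r] and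
    [idx s] for every [r] in [N]. *)
Lemma coset_sum_max s : (forall r, r \in N -> (idx (r * s)%g <= idx s)%N) ->
  S s = phisum N (idx s).
Proof.
move=> smax; apply: eq_bigr => r rN; apply/eqP; rewrite eqn_leq ramidxM andbT.
rewrite leq_min smax // andbT.
have [le|lt] := leqP (idx s) (idx r); first exact: leq_trans (smax _ rN) le.
have := ramidxM (r * s)%g s^-1%g; rewrite mulgK ramidxV geq_min => /orP[] //.
by rewrite leqNgt lt.
Qed.

Lemma coset_max_exists s : exists2 r, r \in N &
  forall r', r' \in N -> (idx (r' * (r * s))%g <= idx (r * s)%g)%N.
Proof.
have [r rN rmax] := @arg_maxnP _ 1%g (mem N) (fun r => idx (r * s)%g) (group1 N).
by exists r => // r' r'N; rewrite mulgA; apply: rmax; apply: groupM.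
Qed.

Lemma coset_sum_mulg s r : r \in N -> S (r * s)%g = S s.
Proof.
move=> rN; rewrite [RHS](reindex_inj (mulIg r)) /=.
by apply: eq_big => t; rewrite ?groupMr // => _; rewrite mulgA.
Qed.

(** The identity alone contributes [c], so the sum is strictly increasing up to [ramidx_bound]. *)
Lemma phisum_inj c d : (c <= ramidx_bound)%N -> (d <= ramidx_bound)%N ->
  phisum N c = phisum N d -> c = d.
Proof.
wlog le : c d / (c <= d)%N.
  by move=> H hc hd E; have [/H->//|/ltnW/H->//] := leqP c d.
move=> hc hd E; apply/eqP; rewrite eqn_leq le /=.
have : (\sum_(s in N | s != 1%g) minn (idx s) c <= \sum_(s in N | s != 1%g) minn (idx s) d)%N.
  by apply: leq_sum => s _; lia.
move: E; rewrite /phisum (bigD1 1%g) ?group1 //= [RHS](bigD1 1%g) ?group1 //= ramidx1.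
by move: (bigop _ _ _) (bigop _ _ _) => a b; lia.
Qed.

(** Every coset of [N] contributes [phisum N c]: for [N] itself this is the definition, and outside
    [N] the truncation at [c] has no effect. This converts the jump of [G / N] into a value of the
    Herbrand function of [G]. *)
Lemma phisum_cosets c : (forall s, s \notin N -> (idx s <= c)%N) ->
  (c <= ramidx_bound)%N ->
  (forall s, s \notin N -> S s = phisum N c) ->
  Phi c = (#|[set: gT] : N|%g * phisum N c)%N.
Proof.
move=> hc cB hS.
have S1 s : (\sum_(r in N) minn (idx (r * s)%g) c = phisum N c)%N.
  have [sN|sN] := boolP (s \in N).
    rewrite /phisum [RHS](reindex_inj (mulIg s)) /=.
    by apply: eq_bigl => r; rewrite groupMr.
  rewrite -(hS _ sN); apply: eq_bigr => r rN.
  by apply/minn_idPl/hc; rewrite groupMl.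
rewrite [LHS]/phisum (partition_big (fun s => (N :* s)%g) (mem (rcosets N [set: gT]))) /=; last first.
  by move=> s _; apply/rcosetsP; exists s.
rewrite -sum_nat_const; apply: eq_bigr => A /rcosetsP[s _ ->].
rewrite -(S1 s) (reindex_inj (mulIg s)) /=.
apply: eq_bigl => r; rewrite inE /=.
apply/eqP/idP => [E|rN]; last by rewrite rcosetM rcoset_id.
by have := rcoset_refl N (r * s)%g; rewrite E mem_rcoset mulgK.
Qed.

End OneJump.

End RamificationIndex.

(** * Inertia *)

(** Dedekind's argument for multiplicative maps; it is applied to the maps which powers of an
    automorphism induce on the residue field. *)
Lemma artin_independence (T : nzRingType) (F : fieldType) (I : finType)
    (chi : I -> T -> F) (c : I -> F) (P : pred I) (i : I) :
  (forall j x y, chi j (x * y) = chi j x * chi j y) -> (forall j, chi j 1 = 1) ->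
  (forall j l, j != l -> exists x, chi j x != chi l x) ->
  P i -> c i != 0 -> exists x, \sum_(j | P j) c j * chi j x != 0.
Proof.
move=> chiM chi1 chiD.
have [n] := ubnP #|P|; elim: n c i P => // n IHn c i P lePn Pi nz_ci.
rewrite ltnS (cardD1x Pi) in lePn; move/IHn: lePn => {n IHn}/=IH_P.
have [/eqfun_inP c0 | ] := boolP [forall (j | P j && (j != i)), c j == 0].
  exists 1; rewrite (bigD1 i Pi) /= chi1 mulr1.
  by rewrite big1 ?addr0 // => j /c0 ->; rewrite mul0r.
case/forall_inPn => j Pj nz_cj.
have [a nz_a] := chiD j i (ltac:(by case/andP: Pj)).
pose d l := c l * (chi l a - chi i a).
have /IH_P[//|b nz_b] : d j != 0 by rewrite mulf_neq0 // subr_eq0.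
have [sumb_0|] := eqVneq (\sum_(l | P l) c l * chi l b) 0; last by exists b.
exists (a * b).
rewrite -subr_eq0 -[z in _ - z](mulr0 (chi i a)) -[in z in _ - z]sumb_0.
rewrite mulr_sumr -sumrB (bigD1 i Pi) chiM /= mulrCA subrr add0r.
congr (_ != 0): nz_b; apply: eq_bigr => l _.
by rewrite mulrCA chiM -mulrBr -mulrBl mulrA.
Qed.

Lemma index_le_inj (gT : finGroupType) (G N : {group gT}) (T : finType) (f : gT -> T) :
  N \subset G ->
  (forall s t, s \in G -> t \in G -> f s = f t -> (s * t^-1)%g \in N) ->
  (#|G : N|%g <= #|T|)%N.
Proof.
move=> NG H; rewrite /indexg -(card_in_imset (f := fun A : {set gT} => f (repr A))).
  exact: max_card.
move=> _ _ /rcosetsP[s sG ->] /rcosetsP[t tG ->].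
have hr x : x \in G -> repr (N :* x)%g \in G.
  move=> xG; case: (repr_rcosetP N x) => r rN.
  by rewrite groupM // (subsetP NG).
move=> /H; rewrite !hr // => /(_ isT isT) h.
by rewrite -(rcoset_repr N s) -(rcoset_repr N t); apply/rcoset_eqP; rewrite mem_rcoset.
Qed.


Section ValueGroups.
Variables (K : fieldType) (M : splittingFieldType K) (w : M -> int) (xs : M).
Variables (k : finFieldType) (red : M -> k) (p : nat).
Hypothesis galM1 : galois 1%AS {:M}.
Hypothesis Hw : dvaluation w.
Notation gT := (gal_of {:M}).
Implicit Types (s t : gT).
Hypothesis wgal : forall (s : gT) x, w (s x) = w x.
Hypothesis xs_int : vge w xs 0.
Hypothesis xs_dense : zdense w xs.
Hypothesis Hr : residue_map w red.
Hypothesis rc : residue_char w p.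
Hypothesis abelG : (p.-abelem [set: gT])%g.

Let vgal (s : gT) x n : vge w (s x) n = vge w x n.
Proof. exact: vge_gal. Qed.
Let pp : prime p. Proof. exact: residue_char_prime rc. Qed.

Lemma galC s t (x : M) : s (t x) = t (s x).
Proof.
rewrite -!galMx; congr (gal_repr _ x).
by have /abelemP-/(_ pp)[/centsP cG _] := abelG; apply: cG; rewrite inE.
Qed.

Lemma galXp s : (s ^+ p)%g = 1%g.
Proof. by have /abelemP-/(_ pp)[_ ] := abelG; apply; rewrite inE. Qed.

Lemma card_pnat (N : {group gT}) : exists a, #|N| = (p ^ a)%N.
Proof.
have /p_natP[a E] : (p.-group N)%g by apply: pgroupS (abelem_pgroup abelG); apply: subsetT.
by exists a.
Qed.

Lemma index_pnat (N : {group gT}) : exists a, #|[set: gT] : N|%g = (p ^ a)%N.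
Proof.
have [a E] := card_pnat [group of [set: gT]].
have : (#|[set: gT] : N|%g %| p ^ a)%N by rewrite -E dvdn_indexg.
by case/dvdn_pfactor => // b _ ->; exists b.
Qed.

Definition inertial s := forall y, vge w y 0 -> vge w (s y - y) 1.

Lemma ramsub1P s : s \in ramsub w xs 1 <-> inertial s.
Proof.
rewrite inE; have := ramidxP galM1 Hw wgal xs_int xs_dense s 1.
have -> : (s == 1%g) || (1 <= (ramidx w xs s)%:Z) = (0 < ramidx w xs s)%N => //.
by have [->|] := eqVneq s 1%g; rewrite ?ramidx1.
Qed.

Lemma red_prod (I : Type) (r : seq I) (P : pred I) (E : I -> M) :
  (forall i, P i -> vge w (E i) 0) ->
  red (\prod_(i <- r | P i) E i) = \prod_(i <- r | P i) red (E i).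
Proof.
move=> h; suff [] : red (\prod_(i <- r | P i) E i) = \prod_(i <- r | P i) red (E i) /\
  vge w (\prod_(i <- r | P i) E i) 0 by [].
elim/big_ind2: _ => [|x1 x2 y1 y2 [h1 h2] [h3 h4]|i Pi].
- by rewrite (red1 Hr) vge_1.
- by rewrite (redM Hr) // h1 h3; split => //; apply: vgeMl.
- by split => //; apply: h.
Qed.

Lemma inertial_norm_congr (N : {group gT}) : (forall s, s \in N -> inertial s) ->
  exists j, forall c, vge w c 0 ->
    vge w (\prod_(r in N) r (c ^+ (p ^ j)) - c) 1.
Proof.
move=> inN; have [a Ea] := card_pnat N.
have [d d0 Ek] := card_residue Hw Hr rc.
(* On residues the norm over [N] is the power [p ^ a]. The exponent is completed to [p ^ (d * a)], a
   power of the cardinal of the residue field, which acts trivially. *)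
exists (a * d.-1)%N => c hc.
have hcj : vge w (c ^+ (p ^ (a * d.-1))) 0 by exact: vgeX0.
rewrite -(red_eq Hw Hr) //; last first.
  by apply: vge_prod0 => // r _; rewrite vgal.
rewrite red_prod; last by move=> r _; rewrite vgal.
rewrite (eq_bigr (fun=> red (c ^+ (p ^ (a * d.-1))))) => [|r rN]; last first.
  by apply/eqP; rewrite (red_eq Hw Hr) ?vgal //; apply: inN.
rewrite prodr_const Ea !(redX Hw Hr) // -exprM -expnD.
have -> : (a * d.-1 + a = d * a)%N by rewrite -{2}[d]prednK // mulSn mulnC addnC.
apply/eqP; elim: a {Ea hcj} => [|a IH]; first by rewrite muln0 expr1.
by rewrite mulnS expnD exprM -Ek expf_card IH.
Qed.

Lemma prod_gal_fixed (N : {group gT}) x t : t \in N ->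
  t (\prod_(r in N) r x) = \prod_(r in N) r x.
Proof.
move=> tN; rewrite rmorph_prod [RHS](reindex_inj (mulIg t)) /=.
apply: eq_big => r; first by rewrite groupMr.
by move=> _; rewrite galMx.
Qed.

Lemma prod_gal_fixed_comm (N : {group gT}) x t : t x = x ->
  t (\prod_(r in N) r x) = \prod_(r in N) r x.
Proof.
by move=> tx; rewrite rmorph_prod; apply: eq_bigr => r _ /=; rewrite galC tx.
Qed.

(** The norm of a suitable power represents the residue of [c] in the fixed field of [N]; as the
    group is abelian, whatever fixes [c] still fixes this norm. *)
Lemma inertial_rep (N : {group gT}) c : (forall s, s \in N -> inertial s) ->
  vge w c 0 -> exists c', [/\ vge w c' 0, vge w (c' - c) 1,
    forall r, r \in N -> r c' = c' & forall t, t c = c -> t c' = c'].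
Proof.
move=> inN hc; have [j hj] := inertial_norm_congr inN.
exists (\prod_(r in N) r (c ^+ (p ^ j))); split.
- by apply: vge_prod0 => // r _; rewrite vgal; apply: vgeX0.
- exact: hj.
- by move=> r rN; apply: prod_gal_fixed.
- by move=> t tc; apply: prod_gal_fixed_comm; rewrite rmorphXn /= tc.
Qed.

(** There is no tame part: the product of the conjugates of [s pi / pi] under powers of [s]
    telescopes to [1], so its residue is a [p]-th root of unity in characteristic [p], that is [1].
    Writing [y = c' + pi z] with [c'] fixed by [s] extends the bound from [pi] to all integers. *)
Lemma inertial_wild s : inertial s -> (1 < ramidx w xs s)%N.
Proof.
move=> ins; have [pi [pi0 wpi]] := dv_norm Hw.
have inS t : t \in <[s]>%g -> inertial t.
  case/cycleP => j ->; elim: j => [|j IH] y hy; first by rewrite expg0 gal_id subrr vge0.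
  rewrite expgS galMx.
  apply: (vge_trans Hw (y := (s y))); last exact: ins.
  by apply: IH; rewrite vgal.
have hpi : vge w (s pi - pi) 2.
  pose u := s pi / pi.
  have u0 : vge w u 0 by rewrite (vge_divE Hw) // wpi vgal vgeE // wpi.
  have hn n : \prod_(j < n) (s ^+ j)%g u = (s ^+ n)%g pi / pi.
    elim: n => [|n IH]; first by rewrite big_ord0 expg0 gal_id divff.
    rewrite big_ord_recr /= IH /u rmorphM fmorphV /= -!galMx -expgS expgSr.
    have np0 : (s ^+ n)%g pi != 0 by rewrite gal_neq0.
    by rewrite !galMx; field; rewrite np0 pi0.
  have ru : red u = 1.
    have E : red u ^+ p = 1.
      have E1 : (s ^+ p)%g pi = pi by rewrite galXp gal_id.
      rewrite -(red1 Hr) -(divff pi0) -{1}E1 -hn red_prod; last first.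
        by move=> j _; rewrite vgal.
      rewrite (eq_bigr (fun=> red u)) ?prodr_const ?card_ord // => j _.
      by apply/eqP; rewrite (red_eq Hw Hr) ?vgal //; apply: inS => //; apply: mem_cycle.
    apply/eqP; rewrite -subr_eq0; apply/eqP.
    have := pFrobenius_autB_comm (residue_pchar Hw Hr rc) (commr1 (red u)).
    rewrite !pFrobenius_autE expr1n E subrr => /eqP.
    by rewrite expf_eq0 => /andP[_ /eqP].
  have -> : s pi - pi = (u - 1) * pi by rewrite /u mulrBl divfK // mul1r.
  rewrite -[2]/(1 + 1); apply: (vgeM Hw); last by rewrite vgeE // wpi.
  by rewrite -(red_eq Hw Hr) ?vge_1 // ru (red1 Hr).
suff /(ramidxP galM1 Hw wgal xs_int xs_dense s 2) : forall y, vge w y 0 -> vge w (s y - y) 2.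
  by have [->|] := eqVneq s 1%g => // _; rewrite ramidx1.
move=> y hy.
have [c' [hc' hcy fixc _]] := inertial_rep inS hy.
pose z := (y - c') / pi.
have hz : vge w z 0 by rewrite (vge_divE Hw) // wpi add0r (vgeBC Hw).
have Ey : y = c' + pi * z by rewrite /z mulrCA divff // mulr1 addrC subrK.
have -> : s y - y = (s pi - pi) * s z + pi * (s z - z).
  by rewrite Ey rmorphD rmorphM /= fixc ?cycle_id //; ring.
apply: (vgeD Hw); first by apply: (vgeMr Hw) => //; rewrite vgal.
rewrite -[2]/(1 + 1); apply: (vgeM Hw); first by rewrite vgeE // wpi.
exact: ins.
Qed.
End ValueGroups.

Lemma prime_subfield (k : finFieldType) p (c : k) :
  p \in [pchar k] -> c ^+ p = c -> exists n, c = n%:R.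
Proof.
move=> pk Ec; apply: contrapT => H.
have pp := pcharf_prime pk.
pose rs := c :: [seq n%:R | n <- iota 0 p].
have inj m n : (m <= n < p)%N -> m%:R = n%:R :> k -> m = n.
  move=> /andP[mn np] E; apply/eqP; rewrite eqn_leq mn /= -subn_eq0.
  have : (p %| n - m)%N by rewrite (dvdn_pcharf pk) natrB // E subrr.
  by apply: contraLR => nm; rewrite gtnNdvd ?lt0n //; lia.
have f0 : ('X^p - 'X : {poly k}) != 0.
  by rewrite -size_poly_gt0 size_polyDl ?size_polyXn // size_polyN size_polyX ltnS prime_gt1.
have rts : all (root ('X^p - 'X)) rs.
  apply/allP => x; rewrite inE => /orP[/eqP->|/mapP[n _ ->]].
    by rewrite /root !hornerE Ec subrr.
  by rewrite /root !hornerE -(pFrobenius_autE pk) pFrobenius_aut_nat subrr.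
have urs : uniq rs.
  rewrite /= map_inj_in_uniq ?iota_uniq ?andbT.
    by apply/negP => /mapP[n _ E]; apply: H; exists n.
  move=> m n; rewrite !mem_iota /= !add0n => hm hn E.
  have [le|/ltnW le] := leqP m n; first by apply: inj => //; rewrite le.
  by apply/esym/inj => //; rewrite le.
have := max_poly_roots f0 rts urs.
rewrite /= size_map size_iota size_polyDl ?size_polyXn ?ltnn //.
by rewrite size_polyN size_polyX ltnS prime_gt1.
Qed.
Section InertiaIndex.
Variables (K : fieldType) (M : splittingFieldType K) (w : M -> int) (xs : M).
Variables (k : finFieldType) (red : M -> k) (p : nat).
Hypothesis galM1 : galois 1%AS {:M}.
Hypothesis Hw : dvaluation w.
Notation gT := (gal_of {:M}).
Implicit Types (s t : gT).
Hypothesis wgal : forall (s : gT) x, w (s x) = w x.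
Hypothesis xs_int : vge w xs 0.
Hypothesis xs_dense : zdense w xs.
Hypothesis Hr : residue_map w red.
Hypothesis rc : residue_char w p.
Hypothesis abelG : (p.-abelem [set: gT])%g.
Let vgal (s : gT) x n : vge w (s x) n = vge w x n.
Proof. exact: vge_gal. Qed.
Let pp : prime p. Proof. exact: residue_char_prime rc. Qed.

Section Generator.
Variables (d : nat) (g : M) (gam : k).
Hypotheses (d0 : (0 < d)%N) (Ek : #|k| = (p ^ d)%N) (hg : vge w g 0) (Eg : red g = gam).
Hypothesis Hgam : forall a : k, a != 0 -> exists j, a = gam ^+ j.

(** The polynomial with roots the Frobenius conjugates of [gam] has coefficients in the prime field.
    These lift to natural numbers, which [s] fixes, so the residue of [s g] is again one of its
    roots. *)
Lemma residue_gal_frob s : exists2 i, (i < d)%N & vge w (s g - g ^+ (p ^ i)) 1.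
Proof.
have pk := residue_pchar Hw Hr rc.
pose f : {poly k} := \prod_(0 <= i < d) ('X - (gam ^+ (p ^ i))%:P).
have Ef : map_poly (pFrobenius_aut pk) f = f.
  rewrite rmorph_prod /=.
  rewrite (eq_bigr (fun i => 'X - (gam ^+ (p ^ i.+1))%:P)) => [|i _]; last first.
    by rewrite rmorphB /= map_polyX map_polyC /= pFrobenius_autE -exprM -expnSr.
  rewrite /f -(prednK d0) big_nat_recr //= [RHS]big_nat_recl //= mulrC; congr (_ * _).
  by rewrite prednK // -Ek expf_card expn0 expr1.
have /choice[c Ec] : forall i, exists n, f`_i = n%:R.
  move=> i; apply: (prime_subfield pk).
  by rewrite -(pFrobenius_autE pk) -coef_map Ef.
pose ev (y : M) := \sum_(i < size f) (c i)%:R * y ^+ i.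
have red_ev y : vge w y 0 -> red (ev y) = f.[red y].
  move=> hy; rewrite (red_sum Hw Hr) => [|i _]; last by apply: vgeMl; rewrite ?vge_nat ?vgeX0.
  rewrite horner_coef; apply: eq_bigr => i _.
  by rewrite (redM Hr) ?vge_nat ?vgeX0 // (red_nat Hw Hr) (redX Hw Hr) // Ec.
have ev_int y : vge w y 0 -> vge w (ev y) 0.
  by move=> hy; apply: vge_sum => // i _; apply: vgeMl; rewrite ?vge_nat ?vgeX0.
have ev_gal : s (ev g) = ev (s g).
  rewrite rmorph_sum; apply: eq_bigr => i _ /=.
  by rewrite rmorphM rmorphXn rmorph_nat.
have f0 : f.[gam] = 0.
  apply/rootP; rewrite /f -(prednK d0) big_nat_recl //= rootM expn0 expr1.
  by rewrite root_XsubC eqxx.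
have : root f (red (s g)).
  apply/rootP; rewrite -red_ev ?vgal // -ev_gal; apply/eqP.
  rewrite (red_eq0 Hr) ?vgal ?ev_int // -(red_eq0 Hr) ?ev_int //.
  by rewrite red_ev // Eg f0.
rewrite /f big_mkord /root horner_prod => /prodf_eq0[i _].
rewrite !hornerE subr_eq0 => h; exists i => //.
by rewrite -(red_eq Hw Hr) ?vgal ?vgeX0 // (redX Hw Hr) // Eg.
Qed.

Lemma inertial_generator s t : vge w (s g - t g) 1 -> inertial w (s * t^-1)%g.
Proof.
move=> hst y hy; rewrite galMx -(vgal t) rmorphB /= galKV.
have [ry|ry] := eqVneq (red y) 0.
  by apply: (vgeB Hw); rewrite vgal -(red_eq0 Hr) // ry.
have [j Ej] := Hgam ry.
have hyj : vge w (y - g ^+ j) 1 by rewrite -(red_eq Hw Hr) ?vgeX0 // (redX Hw Hr) // Eg Ej.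
have -> : s y - t y = s (y - g ^+ j) - t (y - g ^+ j) + (s g ^+ j - t g ^+ j).
  by rewrite !rmorphB !rmorphXn /=; ring.
apply: (vgeD Hw); first by apply: (vgeB Hw); rewrite vgal.
by rewrite -(red_eq Hw Hr) ?vgeX0 ?vgal // !(redX Hw Hr) ?vgal //;
  apply/eqP; congr (_ ^+ _); apply/eqP; rewrite (red_eq Hw Hr) ?vgal.
Qed.

(** Otherwise, with [r] the remainder of [i] modulo [d], all [p ^ d] elements of the residue field
    would be roots of [X^(p^r) - X]. *)
Lemma frob_generator_dvd i : vge w (g ^+ (p ^ i) - g) 1 -> (d %| i)%N.
Proof.
rewrite -(red_eq Hw Hr) ?vgeX0 // (redX Hw Hr) // Eg => /eqP h.
have h2 : gam ^+ (p ^ (i %% d)) = gam.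
  rewrite -{2}h {2}(divn_eq i d) expnD exprM; congr (_ ^+ _).
  elim: (i %/ d)%N => [|n IH]; first by rewrite mul0n expr1.
  by rewrite mulSn expnD exprM -Ek expf_card.
apply: contraT => ndvd.
have r0 : (0 < i %% d)%N by rewrite lt0n.
have rd : (i %% d < d)%N by rewrite ltn_mod.
set r := (i %% d)%N in h2 r0 rd.
pose P : {poly k} := 'X^(p ^ r) - 'X.
have sP : size P = (p ^ r).+1.
  rewrite size_polyDl ?size_polyXn // size_polyN size_polyX ltnS.
  by apply: (leq_trans (prime_gt1 pp)); rewrite -{1}(expn1 p) leq_exp2l ?prime_gt1.
have P0 : P != 0 by rewrite -size_poly_eq0 sP.
have := max_poly_roots P0 (rs := enum k); rewrite enum_uniq sP -cardE Ek => /(_ _ isT).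
have -> : all (root P) (enum k).
  apply/allP => a _; rewrite /root !hornerE subr_eq0.
  have [->|a0] := eqVneq a 0; first by rewrite expr0n expn_eq0 eqn0Ngt prime_gt0.
  by have [j ->] := Hgam a0; rewrite -exprM mulnC exprM h2.
move=> /(_ isT); rewrite ltnS leqNgt ltn_exp2l ?prime_gt1 // rd //.
Qed.

Lemma frob_iter s i n : vge w (s g - g ^+ (p ^ i)) 1 ->
  vge w ((s ^+ n)%g g - g ^+ (p ^ (n * i))) 1.
Proof.
move=> h; elim: n => [|n IH]; first by rewrite expg0 gal_id mul0n expn0 expr1 subrr vge0.
rewrite expgSr galMx mulSn expnD exprM.
apply: (vge_trans Hw (y := s (g ^+ (p ^ (n * i))))).
  by rewrite -rmorphB vgal.
rewrite rmorphXn /= -(red_eq Hw Hr) ?vgeX0 ?vgal // !(redX Hw Hr) ?vgeX0 ?vgal //.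
apply/eqP; congr (_ ^+ _); apply/eqP; rewrite -(redX Hw Hr) //.
by rewrite (red_eq Hw Hr) ?vgeX0 ?vgal.
Qed.

End Generator.

(** If [s] acts on residues as the power [p ^ i] with [i < d], then [s ^+ p = 1] forces [d] to
    divide [p * i], leaving at most [p] values of [i], and [i] determines [s] up to inertia. *)
Lemma inertia_index_le (N : {group gT}) :
  (forall s, inertial w s -> s \in N) -> (#|[set: gT] : N|%g <= p)%N.
Proof.
move=> inN; have [d d0 Ek] := card_residue Hw Hr rc.
have [gam Hgam] := residue_generator k.
have [g g0 Eg] := red_surj Hr gam.
have /choice[i Hi] : forall s, exists i, (i < d)%N /\ vge w (s g - g ^+ (p ^ i)) 1.
  by move=> s; have [i] := residue_gal_frob d0 Ek g0 Eg s; exists i.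
have dvd s : (d %| p * i s)%N.
  apply: (frob_generator_dvd d0 Ek g0 Eg Hgam); rewrite (vgeBC Hw).
  have := frob_iter g0 p (Hi s).2; rewrite (galXp rc abelG) gal_id.
  by rewrite mulnC.
have lt s : ((p * i s) %/ d < p)%N.
  by rewrite ltn_divLR // ltn_mul2l prime_gt0 //; case: (Hi s).
have := @index_le_inj _ [group of [set: gT]] N _ (fun s => Ordinal (lt s)) (subsetT _).
rewrite card_ord; apply => s t _ _ [E].
have {}E : i s = i t.
  have : (p * i s = p * i t)%N by rewrite -(divnK (dvd s)) -(divnK (dvd t)) E.
  by move/eqP; rewrite eqn_pmul2l ?prime_gt0 // => /eqP.
apply: inN; apply: (inertial_generator g0 Eg Hgam).
apply: (vge_trans Hw (y := g ^+ (p ^ i s))); first by case: (Hi s).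
by rewrite (vgeBC Hw) E; case: (Hi t).
Qed.

End InertiaIndex.

(** * Value groups of fixed fields *)

Section InertiaGroup.
Variables (K : fieldType) (M : splittingFieldType K) (w : M -> int) (xs : M).
Variables (k : finFieldType) (red : M -> k) (p : nat).
Hypothesis galM1 : galois 1%AS {:M}.
Hypothesis Hw : dvaluation w.
Notation gT := (gal_of {:M}).
Implicit Types (s t : gT).
Hypothesis wgal : forall (s : gT) x, w (s x) = w x.
Hypothesis xs_int : vge w xs 0.
Hypothesis xs_dense : zdense w xs.
Hypothesis Hr : residue_map w red.
Hypothesis rc : residue_char w p.
Hypothesis abelG : (p.-abelem [set: gT])%g.
Let vgal (s : gT) x n : vge w (s x) n = vge w x n.
Proof. exact: vge_gal. Qed.
Let pp : prime p. Proof. exact: residue_char_prime rc. Qed.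

Definition inertia : {set gT} := [set s | `[< inertial w s >]].

Lemma mem_inertia s : (s \in inertia) <-> inertial w s.
Proof. by rewrite inE; split => [/asboolP|h] //; apply/asboolP. Qed.

Lemma inertia_group_set : group_set inertia.
Proof.
apply/group_setP; split.
  by apply/mem_inertia => y _; rewrite gal_id subrr vge0.
move=> s t /mem_inertia hs /mem_inertia ht; apply/mem_inertia => y hy.
rewrite galMx; apply: (vge_trans Hw (y := s y)); last exact: hs.
by apply: ht; rewrite vgal.
Qed.
Canonical inertia_group := Group inertia_group_set.

Lemma inertia_lower : inertia = lower_ram w 0.
Proof.
by apply/setP => s; rewrite !inE (galT M) inE.
Qed.

Lemma inertia_ramsub : inertia = ramsub w xs 1.
Proof.
apply/setP => s; apply/idP/idP => [/mem_inertia|] h.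
  by apply/(ramsub1P galM1 Hw wgal xs_int xs_dense).
by apply/mem_inertia/(ramsub1P galM1 Hw wgal xs_int xs_dense).
Qed.

(** Take the trace of [c * pi] over the powers of [s]. Modulo the maximal ideal, its quotient by
    [pi] is a combination of the characters induced by these powers, which are distinct because [s]
    is not inertial; independence gives [c] making it a unit. *)
Lemma uniformizer_fixed s : ~ inertial w s ->
  exists pi, [/\ pi != 0, w pi = 1 & s pi = pi].
Proof.
move=> nin; have [pi [pi0 wpi]] := dv_norm Hw.
have /choice[lift Hl] : forall a : k, exists x, vge w x 0 /\ red x = a.
  by move=> a; have [x] := red_surj Hr a; exists x.
pose chi (j : 'I_p) (a : k) := red ((s ^+ j)%g (lift a)).
have chiE j x : vge w x 0 -> chi j (red x) = red ((s ^+ j)%g x).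
  move=> hx; apply/eqP; have [h1 h2] := Hl (red x).
  by rewrite (red_eq Hw Hr) ?vgal // -rmorphB vgal -(red_eq Hw Hr) // h2.
have chiM j a b : chi j (a * b) = chi j a * chi j b.
  have [h1 h2] := Hl a; have [h3 h4] := Hl b.
  rewrite -{1}h2 -{1}h4 -(redM Hr) // chiE; last exact: vgeMl.
  by rewrite rmorphM (redM Hr) ?vgal.
have chi1 j : chi j 1 = 1.
  by rewrite -{1}(red1 Hr) chiE ?vge_1 // rmorph1 (red1 Hr).
have s_in m : (0 < m < p)%N -> (s ^+ m)%g \in inertia -> False.
  move=> /andP[m0 mp] hm; apply: nin; apply/mem_inertia.
  have cop : coprime m p.
    by rewrite coprime_sym prime_coprime //; apply: contraL mp => /dvdn_leq; rewrite -leqNgt => ->.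
  case: (egcdnP p m0) => a b E _.
  have := groupX a hm; rewrite -expgM mulnC E (eqP cop) expgD expg1 mulnC expgM (galXp rc abelG).
  by rewrite expg1n mul1g.
have chiD j l : j != l -> exists x, chi j x != chi l x.
  move=> jl; apply: contrapT => H.
  have eq x : chi j x = chi l x by apply/eqP; apply: contraT => h; case: H; exists x.
  have {H} key (a b : 'I_p) : (a < b)%N -> (forall x, chi a x = chi b x) -> False.
    move=> ab E; apply: (s_in (b - a)%N); first by have := ltn_ord b; lia.
    apply/mem_inertia => y hy.
    rewrite -(vgal (s ^+ a)%g) rmorphB /= -galMx -expgD subnK; last exact: ltnW.
    by rewrite -(red_eq Hw Hr) ?vgal // -!chiE // E.
  have [lt|gt|E] := ltngtP j l; first exact: (key _ _ lt).
    by apply: (key _ _ gt) => x; rewrite eq.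
  by move/eqP: jl; apply; apply: ord_inj.
pose u (j : 'I_p) := (s ^+ j)%g pi / pi.
have u0 j : vge w (u j) 0 by rewrite (vge_divE Hw) // wpi vgal vgeE // wpi.
have [|a Ha] := @artin_independence k k 'I_p chi (fun j => red (u j)) predT (Ordinal (prime_gt0 pp)) chiM chi1 chiD isT.
  by rewrite /u expg0 gal_id divff // (red1 Hr) oner_neq0.
pose c := lift a; have [hc _] := Hl a.
pose pi' := \sum_(0 <= j < p) (s ^+ j)%g (c * pi).
have E : pi' = pi * \sum_(j < p) u j * (s ^+ j)%g c.
  rewrite /pi' big_mkord mulr_sumr; apply: eq_bigr => j _.
  by rewrite rmorphM /u /=; field.
have hsum : vge w (\sum_(j < p) u j * (s ^+ j)%g c) 0.
  by apply: vge_sum => // j _; apply: vgeMl; rewrite ?vgal.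
have [n0 w0] : \sum_(j < p) u j * (s ^+ j)%g c != 0 /\ w (\sum_(j < p) u j * (s ^+ j)%g c) = 0.
  apply: val_unit => //; rewrite -(red_eq0 Hr) // (red_sum Hw Hr); last first.
    by move=> j _; apply: vgeMl; rewrite ?vgal.
  apply: contra Ha => /eqP E0; apply/eqP; rewrite -[RHS]E0; apply: eq_bigr => j _.
  by rewrite (redM Hr (u0 j)) ?vgal.
exists pi'; rewrite E; split; first by rewrite mulf_neq0.
  by rewrite (dv_mul Hw) // wpi w0.
rewrite -E /pi' rmorph_sum.
rewrite (eq_bigr (fun j => (s ^+ j.+1)%g (c * pi))) => [|j _]; last by rewrite /= -galMx -expgSr.
rewrite -[in LHS](prednK (prime_gt0 pp)) -[in RHS](prednK (prime_gt0 pp)).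
rewrite big_nat_recr //= [RHS]big_nat_recl //= addrC; congr (_ + _).
by rewrite (prednK (prime_gt0 pp)) (galXp rc abelG) expg0.
Qed.

Lemma valXz (x : M) (n : int) : x != 0 -> w (x ^ n) = w x * n.
Proof.
move=> x0; case: n => n; first by rewrite -exprnP (valX Hw).
by rewrite NegzE -exprnN (valV Hw) ?expf_neq0 // (valX Hw) // mulrN.
Qed.

Section InertialSubgroup.
Variable N : {group gT}.
Hypothesis inN : forall s, s \in N -> inertial w s.

(** The inequality between ramification index and degree. If [e1 < #|N|], combinations of
    [1, pi, ..., pi ^ (e1 - 1)] with [N]-fixed coefficients are dense, since powers of [z1] and
    fixed residue representatives supply every leading term. A linear relation between the elements
    of [N] that holds on these [e1] powers then holds everywhere, against independence of
    automorphisms. *)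
Lemma fixed_val_lower (z1 : M) e1 : z1 != 0 -> (forall r, r \in N -> r z1 = z1) ->
  w z1 = e1%:Z -> (0 < e1)%N -> (#|N| <= e1)%N.
Proof.
move=> z10 z1N wz1 e10; rewrite leqNgt; apply/negP => e1N.
have [pi [pi0 wpi]] := dv_norm Hw.
pose V z := exists2 b : 'I_e1 -> M, (forall i r, r \in N -> r (b i) = b i)
  & z = \sum_i b i * pi ^+ i.
have dense z n0 (n : nat) : vge w z n0 -> exists2 v, V v & vge w (z - v) (n0 + n%:Z).
  move=> hz; elim: n => [|n [v [b bN Ev] hv]].
    exists 0; last by rewrite subr0 addr0.
    exists (fun=> 0); first by move=> i r _; rewrite rmorph0.
    by rewrite big1 // => i _; rewrite mul0r.
  have [hv1|hv1] := boolP (vge w (z - v) (n0 + n.+1%:Z)).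
    by exists v => //; exists b.
  set u := z - v in hv hv1.
  have u0 : u != 0 by apply: contraNneq hv1 => ->; apply: vge0.
  set l := n0 + n%:Z in hv.
  have wu : w u = l.
    by move: hv hv1; rewrite !vgeE // /l; move: (w u) => a; lia.
  pose a := (l %/ e1%:Z)%Z; pose j := (l %% e1%:Z)%Z.
  have El : l = e1%:Z * a + j by rewrite /a /j mulrC -divz_eq.
  have j0 : 0 <= j by rewrite modz_ge0 // eqz_nat -lt0n.
  have jlt : (`|j| < e1)%N.
    have : j < e1%:Z by apply: ltz_pmod; rewrite ltz_nat.
    by rewrite -ltz_nat gez0_abs.
  pose q := z1 ^ a * pi ^+ `|j|%N.
  have q0 : q != 0 by rewrite mulf_neq0 ?expfz_neq0 ?expf_neq0.
  have wq : w q = l.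
    rewrite /q (dv_mul Hw) ?expfz_neq0 ?expf_neq0 // valXz // (valX Hw) // wz1 wpi El mul1r.
    by rewrite gez0_abs.
  have hc : vge w (u / q) 0 by rewrite (vge_divE Hw) // wq add0r vgeE // wu.
  have [c' [hc' hcc' c'N _]] := inertial_rep Hw wgal Hr rc abelG inN hc.
  exists (v + c' * q).
    exists (fun i => b i + (if i == Ordinal jlt then c' * z1 ^ a else 0)).
      move=> i r rN; rewrite rmorphD /= bN //; congr (_ + _); case: ifP => _; rewrite ?rmorph0 //.
      by rewrite rmorphM /= c'N // fmorphXz /= z1N.
    under [RHS]eq_bigr => i _ do rewrite mulrDl.
    rewrite big_split -Ev /=; congr (_ + _).
    rewrite (bigD1 (Ordinal jlt)) //= eqxx big1 ?addr0; first by rewrite /q mulrA.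
    by move=> i /negbTE ->; rewrite mul0r.
  have -> : z - (v + c' * q) = (u / q - c') * q by rewrite mulrBl divfK // /u opprD addrA.
  have -> : n0 + n.+1%:Z = 1 + l by rewrite /l intS addrCA.
  apply: (vgeM Hw); last by rewrite vgeE // wq.
  by rewrite (vgeBC Hw).
pose A : 'M[M]_(#|N|, e1) := \matrix_(i, j) (enum_val i : gT) (pi ^+ j).
have : kermx A != 0.
  rewrite kermx_eq0 /row_free; apply: contraTneq e1N => E.
  by rewrite -leqNgt -E rank_leq_col.
case/rowV0Pn => c /sub_kermxP Ec c0.
pose ci (s : gT) := c 0 (enum_rank_in (group1 N) s).
have sumE z : \sum_(s in N) ci s * s z = \sum_(i < #|N|) c 0 i * (enum_val i : gT) z.
  rewrite big_enum_val /=; apply: eq_bigr => i _; congr (c 0 _ * _).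
  exact: enum_valK_in.
have sum_pi j : (j < e1)%N -> \sum_(s in N) ci s * s (pi ^+ j) = 0.
  move=> je; have := congr1 (fun B : 'rV_e1 => B 0 (Ordinal je)) Ec.
  rewrite !mxE sumE => h; rewrite -[RHS]h; apply: eq_bigr => i _.
  by rewrite mxE.
have sumV v : V v -> \sum_(s in N) ci s * s v = 0.
  move=> [b bN ->].
  rewrite (eq_bigr (fun s => \sum_(i < e1) b i * (ci s * s (pi ^+ i)))) => [|s sN]; last first.
    rewrite rmorph_sum mulr_sumr; apply: eq_bigr => i _ /=.
    by rewrite rmorphM /= bN //; ring.
  rewrite exchange_big big1 //= => i _.
  by rewrite -mulr_sumr sum_pi ?mulr0.
pose B := - \sum_(i < #|N|) `|w (c 0 i)|.
have hB s : vge w (ci s) B.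
  have [->|n0] := eqVneq (ci s) 0; first exact: vge0.
  rewrite vgeE // /ci /B; set i := enum_rank_in _ _.
  rewrite (bigD1 i) //=.
  have : 0 <= \sum_(j < #|N| | j != i) `|w (c 0 j)| by apply: sumr_ge0.
  by move: (w _) (bigop _ _ _) => a b; lia.
have sum0 z : \sum_(s in N) ci s * s z = 0.
  have [n0 hz] : exists n0, vge w z n0.
    have [->|zn0] := eqVneq z 0; first by exists 0; rewrite vge0.
    by exists (w z); rewrite vgeE.
  apply: (@vge_eq0_nat _ w _ (B + n0)) => n.
  have [v Vv hv] := dense z n0 n hz.
  have -> : \sum_(s in N) ci s * s z = \sum_(s in N) ci s * s (z - v).
    rewrite [RHS](eq_bigr (fun s : gT => ci s * s z - ci s * s v)).
      by rewrite sumrB (sumV v Vv) subr0.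
    by move=> s _; rewrite rmorphB mulrBr.
  apply: vge_sum => // s _; rewrite -addrA.
  by apply: (vgeM Hw) => //; rewrite vgal.
case/rV0Pn: c0 => i; apply/negP; rewrite negbK.
have := @gal_independent _ _ {:M}%AS (mem N) ci (fun z _ => sum0 z) (enum_val i) (enum_valP i).
by rewrite /ci enum_valK_in => ->.
Qed.

End InertialSubgroup.
End InertiaGroup.

Section FixedValuation.
Variables (K : fieldType) (M : splittingFieldType K) (w : M -> int) (xs : M).
Variables (k : finFieldType) (red : M -> k) (p : nat).
Hypothesis galM1 : galois 1%AS {:M}.
Hypothesis Hw : dvaluation w.
Notation gT := (gal_of {:M}).
Implicit Types (s t : gT).
Hypothesis wgal : forall (s : gT) x, w (s x) = w x.
Hypothesis xs_int : vge w xs 0.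
Hypothesis xs_dense : zdense w xs.
Hypothesis Hr : residue_map w red.
Hypothesis rc : residue_char w p.
Hypothesis abelG : (p.-abelem [set: gT])%g.
Let pp : prime p. Proof. exact: residue_char_prime rc. Qed.
Local Notation I := (inertia_group Hw wgal).

(** Inertia has index at most [p], so it generates the whole group together with any non-inertial
    [s]. *)
Lemma inertia_cover s t : ~ inertial w s ->
  exists2 r, inertial w r & exists j, t = (r * s ^+ j)%g.
Proof.
move=> nin.
have sI : s \notin I by apply/negP => /mem_inertia.
have cG : abelian [set: gT] by apply: abelem_abelian abelG.
have nI : <[s]>%g \subset 'N(I)%g.
  exact: subset_trans (subsetT _) (sub_abelian_norm cG (subsetT _)).
pose H := (I <*> <[s]>)%G.
have IH : I \subset H by apply: joing_subl.
have sH : s \in H by apply: (subsetP (joing_subr _ _)); apply: cycle_id.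
have idx : (#|[set: gT] : I|%g <= p)%N.
  have := @inertia_index_le _ _ _ _ _ _ Hw wgal Hr rc abelG I; apply.
  by move=> u /mem_inertia.
have [a Ea] := index_pnat rc abelG I.
have E := Lagrange_index (subsetT H) IH.
have a1 : (a <= 1)%N.
  by rewrite leqNgt; apply: contraL idx => a1; rewrite -ltnNge Ea -{1}(expn1 p) (ltn_exp2l _ _ (prime_gt1 pp)).
have HI : (1 < #|H : I|%g)%N.
  rewrite ltnNge; apply/negP => h; case/negP: sI.
  have E1 : #|H : I|%g = 1%N by move: h (indexg_gt0 H I); lia.
  by have EI := index1g IH E1; rewrite EI.
have HT : H = [set: gT] :> {set gT}.
  apply/eqP; rewrite eqEsubset subsetT /= -indexg_eq1.
  have : (#|H : I|%g %| p ^ a)%N by rewrite -Ea -E dvdn_mull.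
  case/(dvdn_pfactor _ _ pp) => b ba Eb.
  have b1 : b = a.
    by move: HI; rewrite Eb; case: b {Eb} ba => [|b] ba _ //; apply/eqP; rewrite eqn_leq ba (leq_trans a1).
  move: E; rewrite Ea Eb b1 => /eqP.
  by rewrite -{2}[(p ^ a)%N]mul1n eqn_pmul2r // expn_gt0 prime_gt0.
have : t \in (I * <[s]>)%g by rewrite -(norm_joinEr nI) -[(_ <*> _)%g]/(H : {set gT}) HT inE.
by case/mulsgP => r x /mem_inertia hr /cycleP[j ->] ->; exists r => //; exists j.
Qed.

Lemma val_prod_gal (N : {group gT}) x : x != 0 ->
  w (\prod_(r in N) r x) = w x * #|N|%:Z.
Proof.
move=> x0; rewrite (val_prod Hw) => [|r _]; last by rewrite gal_neq0.
rewrite (eq_bigr (fun=> w x)) => [|r _]; last exact: wgal.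
by rewrite sumr_const -mulr_natr natz.
Qed.

(** When [N] is not inertial, the norm over [N :&: I] is taken of a uniformizer already fixed by
    some [s] in [N] outside [I]; such an [s] and [N :&: I] generate [N]. *)
Lemma fixed_val_exists (N : {group gT}) : exists y,
  [/\ y != 0, forall r, r \in N -> r y = y & w y = #|N :&: I|%:Z].
Proof.
have [sub|/subsetPn[s sN sI]] := boolP (N \subset I).
  have [pi [pi0 wpi]] := dv_norm Hw.
  exists (\prod_(r in N) r pi); split.
  - by apply/prodf_neq0 => r _; rewrite gal_neq0.
  - by move=> r rN; apply: prod_gal_fixed.
  - by rewrite val_prod_gal // wpi mul1r; move/setIidPl: sub => ->.
have nin : ~ inertial w s by move/mem_inertia; apply/negP.
have [pi [pi0 wpi spi]] := uniformizer_fixed galM1 Hw wgal xs_int Hr rc abelG nin.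
pose N0 := (N :&: I)%G.
exists (\prod_(r in N0) r pi); split.
- by apply/prodf_neq0 => r _; rewrite gal_neq0.
- move=> t tN; have [r hr [j Et]] := inertia_cover t nin.
  have sy : s (\prod_(r in N0) r pi) = \prod_(r in N0) r pi.
    exact: (prod_gal_fixed_comm rc abelG).
  have sjy : (s ^+ j)%g (\prod_(r in N0) r pi) = \prod_(r in N0) r pi.
    by elim: j {Et} => [|j IH]; rewrite ?gal_id // expgSr galMx IH.
  have rN0 : r \in N0.
    rewrite !inE; apply/andP; split; last exact/asboolP.
    by rewrite -(groupMr _ (groupX j sN)) -Et.
  by rewrite Et galMx prod_gal_fixed.
- by rewrite val_prod_gal // wpi mul1r.
Qed.

(** A nonzero remainder would be the value of an element fixed by [N :&: I], smaller than
    [fixed_val_lower] allows. *)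
Lemma fixed_val_dvd (N : {group gT}) z : z != 0 -> (forall r, r \in N -> r z = z) ->
  (#|N :&: I|%:Z %| w z)%Z.
Proof.
move=> z0 zN; pose N0 := (N :&: I)%G.
have [y [y0 yN wy]] := fixed_val_exists N.
set n0 := #|N :&: I| in wy *.
have n00 : (0 < n0)%N by rewrite /n0 (cardG_gt0 N0).
apply/dvdz_mod0P; apply: contrapT => r0.
have rge : 0 <= (w z %% n0%:Z)%Z by rewrite modz_ge0 // eqz_nat -lt0n.
have rlt : (w z %% n0%:Z)%Z < n0%:Z by rewrite ltz_pmod // ltz_nat.
pose z1 := z * y ^ (- (w z %/ n0%:Z)%Z).
have z10 : z1 != 0 by rewrite mulf_neq0 ?expfz_neq0.
have wz1 : w z1 = (w z %% n0%:Z)%Z.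
  rewrite (dv_mul Hw) ?expfz_neq0 // (valXz Hw) // wy.
  by rewrite {1}(divz_eq (w z) n0%:Z) mulrN [n0%:Z * _]mulrC addrAC subrr add0r.
have z1N r : r \in N0 -> r z1 = z1.
  by case/setIP => rN _; rewrite rmorphM /= fmorphXz /= zN // yN.
have inN0 r : r \in N0 -> inertial w r by case/setIP => _ /mem_inertia.
have := fixed_val_lower galM1 Hw wgal xs_int Hr rc abelG inN0 z10 z1N (e1 := `|(w z %% n0%:Z)%Z|%N).
rewrite wz1 -/n0 gez0_abs // => /(_ erefl).
rewrite lt0n absz_eq0 => /(_ (introN eqP r0)).
by rewrite leqNgt -ltz_nat gez0_abs // rlt.
Qed.

End FixedValuation.

(** * Extensions with one jump *)

Section Shift.
Variables (F : fieldType) (w : F -> int) (p : nat) (sig : F -> F) (pi : F) (t : nat).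
Hypothesis Hw : dvaluation w.
Hypothesis rc : residue_char w p.
Hypothesis sigD : forall x y, sig (x + y) = sig x + sig y.
Hypothesis sigM : forall x y, sig (x * y) = sig x * sig y.
Hypothesis sig1 : sig 1 = 1.
Hypothesis wsig : forall x, w (sig x) = w x.
Hypothesis t0 : (0 < t)%N.
Hypothesis (pi0 : pi != 0) (wpi : w pi = 1).
Hypothesis (dpi0 : sig pi - pi != 0) (wdpi : w (sig pi - pi) = 1 + t%:Z).
Hypothesis dint : forall y, vge w y 0 -> vge w (sig y - y) (1 + t%:Z).

Let pp : prime p. Proof. exact: residue_char_prime rc. Qed.
Let sig0 : sig 0 = 0.
Proof. by apply: (addIr (sig 0)); rewrite -sigD !add0r. Qed.
Let sign0 x : x != 0 -> sig x != 0.
Proof.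
move=> x0; apply: contra_neq (oner_neq0 F) => E.
by rewrite -sig1 -(mulfV x0) sigM E mul0r.
Qed.
Let sigV x : sig x^-1 = (sig x)^-1.
Proof.
have [->|x0] := eqVneq x 0; first by rewrite invr0 sig0 invr0.
by apply: (mulIf (sign0 x0)); rewrite -sigM !mulVf ?sig1 // sign0.
Qed.
Let sigX x n : sig (x ^+ n) = sig x ^+ n.
Proof. by elim: n => [|n IH]; rewrite ?sig1 // !exprS sigM IH. Qed.
Let sigXz x (n : int) : sig (x ^ n) = sig x ^ n.
Proof. by case: n => n; rewrite ?NegzE -?exprnP -?exprnN ?sigV sigX. Qed.
Let wXz x (n : int) : x != 0 -> w (x ^ n) = w x * n.
Proof.
move=> x0; case: n => n; first by rewrite -exprnP (valX Hw).
by rewrite NegzE -exprnN (valV Hw) ?expf_neq0 // (valX Hw) // mulrN.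
Qed.

Local Notation d := (fun x => sig x - x).
Let a := sig pi / pi - 1.

Let wa : a != 0 /\ w a = t%:Z.
Proof.
have -> : a = (sig pi - pi) / pi by rewrite /a mulrBl divff.
by rewrite mulf_neq0 ?invr_neq0 // (val_div Hw) // wdpi wpi; split => //; lia.
Qed.

Let va n : n <= t%:Z -> vge w a n.
Proof. by case: wa => a0 E h; rewrite vgeE // E. Qed.

Let pow1a (k : nat) : vge w ((1 + a) ^+ k - 1 - k%:R * a) (1 + t%:Z).
Proof.
elim: k => [|k IH]; first by rewrite expr0 mul0r subrr subr0 vge0.
have -> : (1 + a) ^+ k.+1 - 1 - k.+1%:R * a =
   ((1 + a) ^+ k - 1 - k%:R * a) * (1 + a) + k%:R * (a * a).
  by rewrite exprSr -addn1 natrD; ring.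
apply: (vgeD Hw).
  by apply: (vgeMr Hw) => //; apply: (vgeD Hw); rewrite ?vge_1 ?va.
apply: (vgeMl Hw); first exact: vge_nat.
apply: vgeW (vgeM Hw (va (lexx _)) (va (lexx _))); lia.
Qed.

Let a1 : 1 + a != 0 /\ w (1 + a) = 0.
Proof.
have -> : 1 + a = sig pi / pi by rewrite /a addrC subrK.
by rewrite mulf_neq0 ?invr_neq0 ?sign0 // (val_div Hw) ?sign0 // wsig subrr.
Qed.

Let pow1az (k : int) : vge w ((1 + a) ^ k - 1 - k%:~R * a) (1 + t%:Z).
Proof.
case: k => k; first by rewrite -exprnP -pmulrn pow1a.
rewrite NegzE -exprnN mulrNz -pmulrn; set n := k.+1.
have h := pow1a n; set b := (1 + a) ^+ n in h *.
have [b0 wb] : b != 0 /\ w b = 0.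
  by rewrite /b expf_neq0 ?(valX Hw) ?a1.1 // a1.2 mul0r.
pose ep := b - 1 - n%:R * a.
have -> : b^-1 - 1 - - n%:R * a = (- ep + n%:R * n%:R * (a * a) + n%:R * a * ep) / b.
  by rewrite /ep; field.
rewrite (vge_divE Hw) // wb addr0.
have hn : vge w (n%:R * a) 0 by apply: (vgeMl Hw); rewrite ?vge_nat ?va.
apply: (vgeD Hw); last by apply: (vgeMl Hw).
apply: (vgeD Hw); first by rewrite vgeN.
apply: (vgeMl Hw); first by apply: (vgeMl Hw); apply: vge_nat.
apply: vgeW (vgeM Hw (va (lexx _)) (va (lexx _))); lia.
Qed.

Let w_int (k : int) : ~~ (p %| `|k|)%N -> k%:~R != 0 :> F /\ w k%:~R = 0.
Proof.
move=> pk; have cop : coprime `|k| p by rewrite coprime_sym prime_coprime.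
have [h1 h2] := val_natr_coprime Hw rc cop.
by case: k pk cop h1 h2 => n pk cop /=; rewrite ?NegzE ?mulrNz ?oppr_eq0 ?(valN Hw) -?pmulrn.
Qed.

Let v_int (k : int) : (p %| `|k|)%N -> vge w (k%:~R : F) 1.
Proof.
move=> pk; have h := vge_mulrn_dvd Hw rc pk.
by case: k pk h => n /=; rewrite ?NegzE ?mulrNz ?vgeN // -!pmulrn.
Qed.

(** Write [x = u * pi ^ l]: the unit [u] moves by valuation at least [1 + t], while [pi ^ l] is
    multiplied by [(1 + a) ^ l], which is [1 + l a] up to higher order. Hence the first-order term
    [l a x], of exact valuation [l + t] when [p] does not divide [l]. *)
Let shift_expand x : x != 0 ->
  exists2 y, x != 0 & [/\ vge w y (w x + t%:Z + 1), d x = (w x)%:~R * a * x + y & True].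
Proof.
move=> x0; set l := w x.
pose u := x / pi ^ l.
have pl0 : pi ^ l != 0 by rewrite expfz_neq0.
have wpl : w (pi ^ l) = l by rewrite wXz // wpi mul1r.
have hu : vge w u 0 by rewrite (vge_divE Hw) // wpl add0r vgeE.
have Ex : x = u * pi ^ l by rewrite /u divfK.
have Es : sig (pi ^ l) = (1 + a) ^ l * pi ^ l.
  by rewrite sigXz -expfzMl /a [1 + _]addrC subrK divfK.
exists ((sig u - u) * sig (pi ^ l) + x * ((1 + a) ^ l - 1 - l%:~R * a)) => //; split => //.
  apply: (vgeD Hw).
    have -> : l + t%:Z + 1 = (1 + t%:Z) + l by lia.
    by apply: (vgeM Hw); [apply: dint|rewrite vgeE ?sign0 // wsig wpl].
  have -> : l + t%:Z + 1 = l + (1 + t%:Z) by lia.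
  by apply: (vgeM Hw); [rewrite vgeE|apply: pow1az].
have Ed : sig x = sig u * ((1 + a) ^ l * pi ^ l) by rewrite {1}Ex sigM Es.
rewrite /= Ed Es; clearbody u l; rewrite Ex; ring.
Qed.

Lemma val_shift_ge x : x != 0 -> vge w (d x) (w x + t%:Z).
Proof.
move=> x0; have [y _ [hy -> _]] := shift_expand x0.
apply: (vgeD Hw); last by apply: vgeW hy; rewrite lerDl.
rewrite -mulrA; apply: (vgeMl Hw).
  by case: (w x) => n; rewrite ?NegzE ?mulrNz ?vgeN // -pmulrn; apply: vge_nat.
by rewrite addrC; apply: (vgeM Hw); rewrite ?va // vgeE.
Qed.

Lemma val_shift_dvd x : x != 0 -> (p %| `|w x|)%N -> vge w (d x) (w x + t%:Z + 1).
Proof.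
move=> x0 px; have [y _ [hy -> _]] := shift_expand x0.
apply: (vgeD Hw) => //.
have -> : w x + t%:Z + 1 = (1 + t%:Z) + w x by rewrite [RHS]addrC; vlia.
apply: (vgeM Hw); last by rewrite vgeE.
by apply: (vgeM Hw); [apply: v_int|apply: va].
Qed.

Lemma val_shift x : x != 0 -> ~~ (p %| `|w x|)%N -> d x != 0 /\ w (d x) = w x + t%:Z.
Proof.
move=> x0 px; have [y _ [hy -> _]] := shift_expand x0.
have [k0 wk] := w_int px; have [a0 ea] := wa.
have n0 : (w x)%:~R * a * x != 0 by rewrite !mulf_neq0.
have E : w ((w x)%:~R * a * x) = w x + t%:Z.
  by rewrite !(dv_mul Hw) ?mulf_neq0 // wk ea add0r addrC.
by rewrite -E; apply: (val_addl Hw); rewrite // E.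
Qed.

(** The binomial theorem for the additive operator [sig = 1 + d]. *)
Lemma iter_binomial n x : iter n sig x = \sum_(i < n.+1) iter i d x *+ 'C(n, i).
Proof.
elim: n => [|n IH]; first by rewrite big_ord1 bin0.
have sig_sum m (E : 'I_m -> F) : sig (\sum_(i < m) E i) = \sum_(i < m) sig (E i).
  by elim/big_rec2: _ => [|i x1 x2 _ <-]; rewrite ?sig0 ?sigD.
have sigMn y m : sig (y *+ m) = sig y *+ m.
  by elim: m => [|m IHm]; rewrite ?mulr0n ?sig0 // !mulrS sigD IHm.
rewrite iterS IH sig_sum.
have E i : sig (iter i d x *+ 'C(n, i)) = iter i d x *+ 'C(n, i) + iter i.+1 d x *+ 'C(n, i).
  by rewrite sigMn -mulrnDl iterS /= addrC subrK.
under eq_bigr => i _ do rewrite E.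
rewrite big_split /= [RHS]big_ord_recl bin0 /= mulr1n.
rewrite [X in X + _]big_ord_recl bin0 /= mulr1n -addrA; congr (_ + _).
rewrite [RHS](eq_bigr (fun i : 'I_n.+1 => iter i.+1 d x *+ 'C(n, i.+1) + iter i.+1 d x *+ 'C(n, i))) => [|i _]; last first.
  by rewrite /bump /= add1n binS mulrnDr.
rewrite [RHS]big_split /= [X in _ = X + _]big_ord_recr /= bin_small // mulr0n addr0.
by congr (_ + _).
Qed.

Hypothesis sigp : forall x, iter p sig x = x.
Hypothesis p0 : p%:R != 0 :> F.

(* [(1 + d)^p = 1], so [p d + ... + d^p] vanishes; the middle binomials are divisible by [p]. *)
Let relation x n : (forall i, (1 < i < p)%N -> vge w (iter i d x) n) ->
  vge w (p%:R * d x + iter p d x) (w p%:R + n).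
Proof.
move=> H.
have E0 := iter_binomial p x; rewrite sigp big_ord_recl /= bin0 mulr1n in E0.
have := esym (addrI x (etrans (addr0 x) E0)).
have p1 := prime_gt1 pp.
have [q Ep] : exists q, p = q.+2 by exists p.-2; move: p1; clear; lia.
move: H p1 p0 pp; rewrite {}Ep => H p1 pn0 ppr.
rewrite big_ord_recl big_ord_recr /= /bump /= !add1n !add0n bin1 binn mulr1n mulr_natl.
set S := \sum_(i < q) _ => E.
have -> : d x *+ q.+2 + iter q.+2 d x = - S.
  by apply/eqP; rewrite -addr_eq0 -E; apply/eqP; rewrite -[LHS]addrA [S + _]addrC.
rewrite vgeN //; apply: vge_sum => // i _; rewrite /bump /= !add1n.
have ib : (0 < i.+2 < q.+2)%N by have := ltn_ord i; lia.
have /dvdnP[c Ec] := prime_dvd_bin ppr ib.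
rewrite Ec mulrnA -[X in vge w X _]mulr_natl; apply: (vgeM Hw); first by rewrite vgeE.
by apply: vgeMn => //; apply: (H i.+2); have := ltn_ord i; lia.
Qed.

Lemma jump_coprime : ~~ (p %| t)%N -> (p%:Z - 1) * t%:Z < w p%:R.
Proof.
move=> pt; have p1 := prime_gt1 pp.
(* Starting from valuation [t], the iterates have valuations [t, 2 t, ..., p t]. The first one
   divisible by [p] is the last, so only the [p]-th application of [d] gains more than [t]; if
   [w p <= (p - 1) t], nothing could then cancel [p d x]. *)
pose x := pi ^+ t.
have x0 : x != 0 by rewrite expf_neq0.
have wx : w x = t%:Z by rewrite /x (valX Hw) // wpi mul1r.
have hi i : (i < p)%N -> iter i d x != 0 /\ w (iter i d x) = i.+1%:Z * t%:Z.
  elim: i => [|i IH] ip; first by rewrite mul1r.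
  have [n0 wn] := IH (ltnW ip).
  have [] := val_shift n0; last first.
    by move=> h1 h2; rewrite iterS h2 wn; split => //; clear; lia.
  rewrite wn abszM /= Euclid_dvdM // negb_or pt andbT.
  by apply: contraL ip => /dvdn_leq h; rewrite -leqNgt h.
have hge i : (1 < i < p)%N -> vge w (iter i d x) (2 * t%:Z + 1).
  move=> /andP[i1 ip]; have [n0 wn] := hi i ip.
  by rewrite vgeE // wn; move: i1 t0; clear; nia.
have hrel := relation hge.
have [d0 wd] : d x != 0 /\ w (d x) = 2 * t%:Z by have := hi 1%N p1.
have hp : vge w (iter p d x) (p%:Z * t%:Z + t%:Z + 1).
  have [q Ep] : exists q, p = q.+1 by exists p.-1; move: p1; clear; lia.
  have [n0 wn] := hi q ltac:(by rewrite Ep).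
  rewrite {1}Ep iterS.
  have := val_shift_dvd n0; rewrite wn -Ep; apply.
  by rewrite abszM /= dvdn_mulr.
rewrite ltNge; apply/negP => le.
have : vge w (p%:R * d x) (w p%:R + (2 * t%:Z + 1)).
  rewrite -[X in vge w X _](addrK (iter p d x)); apply: (vgeB Hw) => //.
  by apply: vgeW hp; move: le; move: (w _) => b; clear; lia.
by rewrite vgeE ?mulf_neq0 // (dv_mul Hw) // wd; move: (w _) => b; clear; lia.
Qed.

Section JumpDivisible.
Hypothesis pt : (p %| t)%N.

Let hi i : iter i d pi != 0 /\ w (iter i d pi) = 1 + i%:Z * t%:Z.
Proof.
elim: i => [|i [n0 wn]]; first by rewrite mul0r addr0.
have [] := val_shift n0; last first.
  by move=> h1 h2; rewrite iterS h2 wn; split => //; clear; lia.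
rewrite wn; apply/negP => h.
move: h; have -> : 1 + i%:Z * t%:Z = (1 + i * t)%N%:Z by rewrite PoszD PoszM.
by rewrite absz_nat dvdn_addl ?dvdn_mull // dvdn1 => /eqP E; have := prime_gt1 pp; rewrite E.
Qed.

Let hrel : vge w (p%:R * d pi + iter p d pi) (w p%:R + (2 + t%:Z)).
Proof.
apply: relation => i /andP[i1 ip]; have [n0 wn] := hi i.
by rewrite vgeE // wn; move: i1 t0; clear; nia.
Qed.

(** Starting from [pi], all valuations [1 + i t] are prime to [p], so those of [p d pi] and of the
    [p]-th iterate are exact; the two terms must cancel, hence have equal valuation. *)
Lemma jump_divisible : (p%:Z - 1) * t%:Z = w p%:R.
Proof.
have [n0 wn] := hi p; have [d0 wd] := hi 1%N.
have wpd : w (p%:R * d pi) = w p%:R + 1 + t%:Z.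
  by rewrite (dv_mul Hw) //= wd; move: (w _) => b; clear; lia.
have pd0 : p%:R * d pi != 0 by rewrite mulf_neq0.
have := val_congr Hw (x := - (p%:R * d pi)) (y := iter p d pi).
rewrite oppr_eq0 opprK (valN Hw) wpd [iter p d pi + _]addrC => /(_ pd0) [].
  by apply: vgeW hrel; move: (w _) => b; clear; lia.
by move=> _; rewrite wn; move: (w _) => b; clear; lia.
Qed.

(** As [rho] is fixed by [sig], the [i]-th iterate of [d] at [pi] is [rho^i S^i pi] to first order;
    dividing the relation by [rho^p pi] leaves an equation for the residue of [S]. *)
Lemma jump_divisible_residue rho S : rho != 0 -> w rho = t%:Z -> sig rho = rho ->
  S = d pi / (rho * pi) ->
  vge w (p%:R / rho ^+ p.-1 * S + S ^+ p) 1.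
Proof.
move=> r0 wr sr ES.
have S0 : S != 0 by rewrite ES mulf_neq0 ?invr_neq0 ?mulf_neq0.
have wS : w S = 0.
  by rewrite ES (val_div Hw) ?mulf_neq0 // (dv_mul Hw) // wr wpi wdpi [X in _ - X]addrC subrr.
have Ed : d pi = rho * S * pi.
  by rewrite ES; field; rewrite r0 pi0.
have Hi i : vge w (iter i d pi - rho ^+ i * S ^+ i * pi) (2 + i%:Z * t%:Z).
  elim: i => [|i IH]; first by rewrite !expr0 !mul1r subrr vge0.
  set ep := iter i d pi - _ in IH.
  have Ei : iter i d pi = rho ^+ i * S ^+ i * pi + ep by rewrite /ep addrC subrK.
  have vS j : vge w (S ^+ j) 0 by apply: vgeX0 => //; rewrite vgeE // wS.
  have vri j : vge w (rho ^+ j) (j%:Z * t%:Z).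
    by rewrite vgeE ?expf_neq0 // (valX Hw) // wr mulrC.
  have -> : iter i.+1 d pi - rho ^+ i.+1 * S ^+ i.+1 * pi =
      rho ^+ i * (d (S ^+ i) * sig pi) + d ep.
    rewrite iterS Ei /= sigD !sigM !sigX sr.
    have Esp : sig pi = pi + rho * S * pi by rewrite -Ed addrC subrK.
    by rewrite Esp !exprS; ring.
  apply: (vgeD Hw).
    have -> : 2 + i.+1%:Z * t%:Z = i%:Z * t%:Z + ((1 + t%:Z) + 1) by clear; lia.
    apply: (vgeM Hw) => //; apply: (vgeM Hw); first exact: dint.
    by rewrite vgeE ?sign0 // wsig wpi.
  have [->|ep0] := eqVneq ep 0; first by rewrite /= sig0 subrr vge0.
  apply: vgeW (val_shift_ge ep0).
  by move: IH; rewrite vgeE //; move: (w _) => b; clear; lia.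
have : vge w (p%:R * d pi + rho ^+ p * S ^+ p * pi) (2 + p%:Z * t%:Z).
  have -> : p%:R * d pi + rho ^+ p * S ^+ p * pi =
     (p%:R * d pi + iter p d pi) - (iter p d pi - rho ^+ p * S ^+ p * pi) by ring.
  apply: (vgeB Hw); last exact: Hi.
  by apply: vgeW hrel; rewrite -jump_divisible; clear; lia.
have Ep : rho ^+ p = rho ^+ p.-1 * rho by rewrite -exprSr prednK // prime_gt0.
have -> : p%:R * d pi + rho ^+ p * S ^+ p * pi =
   (rho ^+ p * pi) * (p%:R / rho ^+ p.-1 * S + S ^+ p).
  by rewrite Ed Ep; field; rewrite expf_neq0.
rewrite (vgeMlE Hw) ?mulf_neq0 ?expf_neq0 // (dv_mul Hw) ?expf_neq0 // (valX Hw) // wr wpi.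
by apply: vgeW; clear; lia.
Qed.

End JumpDivisible.

End Shift.

Section OneJumpLocal.
Variables (p : nat) (K : fieldType) (v : K -> int) (M : splittingFieldType K) (w : M -> int).
Variables (xs : M) (k : finFieldType) (red : M -> k) (e0 : int) (e : nat).
Hypothesis galM1 : galois 1%AS {:M}.
Hypothesis Hv : dvaluation v.
Hypothesis Hw : dvaluation w.
Notation gT := (gal_of {:M}).
Implicit Types (s t : gT).
Hypothesis wgal : forall (s : gT) x, w (s x) = w x.
Hypothesis xs_int : vge w xs 0.
Hypothesis xs_dense : zdense w xs.
Hypothesis Hr : residue_map w red.
Hypothesis rc : residue_char w p.
Hypothesis abelG : (p.-abelem [set: gT])%g.
Hypothesis e00 : 0 < e0.
Hypothesis walg : forall c : K, c != 0 -> w c%:A = e0 * v c.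
Hypothesis char0 : forall n : nat, (0 < n)%N -> n%:R != 0 :> K.
Hypothesis ve : v p%:R = e%:Z.

Let vgal (s : gT) x n : vge w (s x) n = vge w x n.
Proof. exact: vge_gal. Qed.
Let pp : prime p. Proof. exact: residue_char_prime rc. Qed.
Local Notation I := (inertia_group Hw wgal).
Local Notation idx := (ramidx w xs).

Lemma alg_neq0 (c : K) : (c%:A != 0 :> M) = (c != 0).
Proof. by rewrite (fmorph_eq0 (in_alg M)). Qed.

Lemma fixed_algP (y : M) : (forall s, s y = y) -> exists c : K, y = c%:A.
Proof.
move=> h; have : y \in fixedField ('Gal({:M} / 1%AS))%g.
  by apply/fixedFieldP; rewrite ?memvf.
have /galois_fixedField -> := galM1.
by case/vlineP => c ->; exists c.
Qed.

(** A uniformizer of [K] has value [e0], a multiple of [#|I|]; conversely some element fixed by the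
    whole group, hence in [K], has value [#|I|]. *)
Lemma e0_card : e0 = #|I|%:Z.
Proof.
have [y [y0 yG wy]] := fixed_val_exists galM1 Hw wgal xs_int Hr rc abelG [group of [set: gT]].
have [c Ec] := fixed_algP (fun s => yG s (in_setT s)).
rewrite setTI in wy.
have [pi [pi0 vpi]] := dv_norm Hv.
have := fixed_val_dvd galM1 Hw wgal xs_int Hr rc abelG (N := [group of [set: gT]]) (z := pi%:A).
rewrite alg_neq0 walg // vpi mulr1 setTI => /(_ pi0) /(_ (fun r _ => gal_alg r pi)) d1.
move: wy; rewrite Ec walg -?alg_neq0 -?Ec // => E.
have d2 : (e0 %| #|I|%:Z)%Z by apply/dvdzP; exists (v c); rewrite -E mulrC.
have : (`|e0| %| #|I|)%N by [].
have : (#|I| %| `|e0|)%N by [].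
move=> h1 h2; have := @gtz0_abs e0 e00 => <-; congr (Posz _).
by apply/eqP; rewrite eqn_dvd h2 h1.
Qed.

Lemma w_p : w p%:R = #|I|%:Z * e%:Z.
Proof.
have -> : p%:R = (p%:R : K)%:A :> M by rewrite -[_%:A]/(in_alg M _) rmorph_nat.
by rewrite walg ?char0 ?prime_gt0 // e0_card ve.
Qed.

Section Fixed.
Variable H : {group gT}.
Hypothesis totram : forall s, exists2 r, r \in H & inertial w (r * s)%g.
Local Notation n0 := #|H :&: I|.

Lemma n0_gt0 : (0 < n0)%N. Proof. exact: (cardG_gt0 (H :&: I)%G). Qed.

Lemma totram_card : #|I| = (#|[set: gT] : H|%g * n0)%N.
Proof.
have HI : (H * I)%g = [set: gT].
  apply/setP => s; rewrite inE; have [r rH hr] := totram s.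
  apply/mulsgP; exists r^-1%g (r * s)%g; rewrite ?groupV ?mulKg //.
  by apply/mem_inertia.
have := mul_cardG H I; rewrite HI.
rewrite -(Lagrange (subsetT H)) -mulnA => /eqP.
by rewrite eqn_pmul2l ?cardG_gt0 // => /eqP.
Qed.

(** [totram] says that [H] and inertia generate the group, that is, the fixed field of [H] is
    totally ramified over [K]. A representative fixed by inertia and by everything fixing [y] then
    lies in [K]. *)
Lemma fixed_residue y : vge w y 0 -> (forall r, r \in H -> r y = y) ->
  exists2 c : K, vge w c%:A 0 & vge w (c%:A - y) 1.
Proof.
move=> hy yH.
have inI s : s \in I -> inertial w s by move/mem_inertia.
have [c' [h1 h2 h3 h4]] := inertial_rep Hw wgal Hr rc abelG inI hy.
have [c Ec] : exists c : K, c' = c%:A.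
  apply: fixed_algP => s; have [r rH hr] := totram s.
  have -> : s = (r^-1 * (r * s))%g by rewrite mulKg.
  rewrite galMx h4 ?h3 //; first by apply/mem_inertia.
  by apply: yH; rewrite groupV.
by exists c; rewrite -Ec.
Qed.

(** Take [y] attaining the coset sum and subtract [a] in [K] with the same residue: [y = a + pi z]
    with [z] integral. If [s pi - pi] exceeded the bound, then so would [s y - y]. *)
Lemma onejump_uniformizer s (t : nat) pi : s \notin H ->
  (\sum_(r in H) idx (r * s)%g = n0 * (1 + t))%N ->
  pi != 0 -> (forall r, r \in H -> r pi = pi) -> w pi = n0%:Z ->
  s pi - pi != 0 /\ w (s pi - pi) = n0%:Z * (1 + t%:Z).
Proof.
move=> sH E pi0 piH wpi.
have n00 := n0_gt0.
have En : (n0 * (1 + t))%N%:Z = n0%:Z * (1 + t%:Z) by rewrite PoszM PoszD.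
have hge y : vge w y 0 -> (forall r, r \in H -> r y = y) -> vge w (s y - y) (n0%:Z * (1 + t%:Z)).
  by move=> hy yH; rewrite -En -E; apply: (fixed_val_ge galM1 Hw wgal xs_int xs_dense sH).
have [y [hy yH]] := fixed_val_attained galM1 Hw wgal xs_int xs_dense sH.
rewrite E En => hny.
have [a ha hay] := fixed_residue hy yH.
have hya : vge w (y - a%:A) n0%:Z.
  have [->|ya0] := eqVneq (y - a%:A) 0; first exact: vge0.
  have : (n0%:Z %| w (y - a%:A))%Z.
    apply: (fixed_val_dvd galM1 Hw wgal xs_int Hr rc abelG) => // r rH.
    by rewrite rmorphB /= yH // gal_alg.
  move: hay; rewrite (vgeBC Hw) !vgeE // => h /dvdzP[q Eq].
  have q0 : 0 < q * n0%:Z by rewrite -Eq; move: h; move: (w _) => b; clear; lia.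
  by rewrite Eq ler_peMl // -gtz0_ge1 -(@pmulr_lgt0 _ n0%:Z) // ltz_nat.
pose z := (y - a%:A) / pi.
have hz : vge w z 0 by rewrite (vge_divE Hw) // wpi add0r.
have zH r : r \in H -> r z = z.
  by move=> rH; rewrite rmorphM fmorphV rmorphB /= yH // gal_alg piH.
have Ey : y = a%:A + pi * z by rewrite /z mulrCA divff // mulr1 addrC subrK.
have Es : s y - y = (s pi - pi) * s z + pi * (s z - z).
  by rewrite Ey rmorphD rmorphM /= gal_alg; ring.
have hpi : ~~ vge w (s pi - pi) (n0%:Z * (1 + t%:Z) + 1).
  apply: contra hny => h; rewrite Es; apply: (vgeD Hw).
    by apply: (vgeMr Hw) => //; rewrite vgal.
  apply: vgeW (vgeM Hw (_ : vge w pi n0%:Z) (hge z hz zH)); last by rewrite vgeE // wpi.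
  by move: n00; clear; lia.
have d0 : s pi - pi != 0 by apply: contraNneq hpi => ->; apply: vge0.
split => //.
have := hge pi; rewrite !vgeE ?wpi // => /(_ isT piH).
by move: hpi; rewrite vgeE //; move: (w _) (n0%:Z * _) => a1 b1; clear; lia.
Qed.

Let E := fixedField_aspace H : {subfield M}.
Let F := subvs_of E.
Let val (x : F) : M := vsval x.

Let memE (x : M) : (x \in E) <-> (forall r, r \in H -> r x = x).
Proof. by split => [h|h]; [case: (mem_fixedFieldP h)|apply/fixedFieldP; rewrite ?memvf]. Qed.

Let valH (x : F) r : r \in H -> r (val x) = val x.
Proof. exact: ((memE (val x)).1 (subvsP x) r). Qed.

(** The normalized valuation of the fixed field, [n0] being the ramification index of [M] over it;
    the abstract results on shifts are applied to this field. *)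
Let wF (x : F) : int := (w (val x) %/ n0%:Z)%Z.

Let val0 (x : F) : (val x == 0) = (x == 0).
Proof. by rewrite /val fmorph_eq0. Qed.

Let wFE (x : F) : x != 0 -> w (val x) = n0%:Z * wF x.
Proof.
move=> x0; have : (n0%:Z %| w (val x))%Z.
  apply: (fixed_val_dvd galM1 Hw wgal xs_int Hr rc abelG); first by rewrite val0.
  by move=> r; apply: valH.
by move/divzK; rewrite mulrC /wF => ->.
Qed.

Let vgeF (x : F) n : vge wF x n = vge w (val x) (n0%:Z * n).
Proof.
have [->|x0] := eqVneq x 0; first by rewrite /val rmorph0 !vge0.
rewrite !vgeE ?val0 // wFE //; have := n0_gt0; move: (wF x) => a b.
by rewrite ler_pM2l // ltz_nat.
Qed.

Let Hwf : dvaluation wF.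
Proof.
have n00 := n0_gt0.
split.
- move=> x y x0 y0.
  have /eqP := wFE (mulf_neq0 x0 y0).
  rewrite {1}/val rmorphM /= (dv_mul Hw) ?val0 // !wFE // -mulrDr.
  by rewrite (inj_eq (mulfI _)) ?eqz_nat -?lt0n // => /eqP.
- by move=> x y n; rewrite !vgeF /val rmorphD; apply: (vgeD Hw).
- have [pi [pi0 piH wpi]] := fixed_val_exists galM1 Hw wgal xs_int Hr rc abelG H.
  have piE : pi \in E by apply/memE.
  exists (vsproj E pi); have vpi : val (vsproj E pi) = pi by rewrite /val vsprojK.
  split; first by rewrite -val0 vpi.
  by rewrite /wF vpi wpi divzz eqz_nat -lt0n n00.
Qed.

Let sF (s : gT) (x : F) : F := vsproj E (s (val x)).
Let valsF s x : val (sF s x) = s (val x).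
Proof.
rewrite /sF /val vsprojK //; apply/memE => r rH.
by rewrite (galC rc abelG) valH.
Qed.

Let valI : injective val. Proof. exact: fmorph_inj. Qed.
Let val_lift (x : M) : (forall r, r \in H -> r x = x) -> val (vsproj E x) = x.
Proof. by move=> h; rewrite /val vsprojK //; apply/memE. Qed.

Section Jump.
Variables (s : gT) (t : nat).
Hypotheses (sH : s \notin H) (t0 : (0 < t)%N).
Hypothesis sum_t : (\sum_(r in H) idx (r * s)%g = n0 * (1 + t))%N.

Let sD x y : sF s (x + y) = sF s x + sF s y.
Proof. by apply: valI; rewrite valsF /val !rmorphD /= -/(val _) -!valsF. Qed.
Let sM x y : sF s (x * y) = sF s x * sF s y.
Proof. by apply: valI; rewrite valsF /val !rmorphM /= -/(val _) -!valsF. Qed.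
Let s1 : sF s 1 = 1.
Proof. by apply: valI; rewrite valsF /val !rmorph1. Qed.
Let ws x : wF (sF s x) = wF x.
Proof. by rewrite /wF valsF wgal. Qed.
Let sp x : iter p (sF s) x = x.
Proof.
have it n : val (iter n (sF s) x) = (s ^+ n)%g (val x).
  by elim: n => [|n IH]; rewrite ?gal_id // iterS valsF IH expgSr galMx.
by apply: valI; rewrite it (galXp rc abelG) gal_id.
Qed.
Let rcF : residue_char wF p.
Proof.
split => //; rewrite vgeF /val rmorph_nat mulr1 vgeE; last first.
  have -> : p%:R = (p%:R : K)%:A :> M by rewrite -[_%:A]/(in_alg M _) rmorph_nat.
  by rewrite alg_neq0 char0 // prime_gt0.
rewrite w_p totram_card PoszM.
have := residue_char_val rc; rewrite vgeE; last first.
  have -> : p%:R = (p%:R : K)%:A :> M by rewrite -[_%:A]/(in_alg M _) rmorph_nat.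
  by rewrite alg_neq0 char0 // prime_gt0.
rewrite w_p => h; have e1 : (0 < e)%N.
  by move: h; case: (e) => //; rewrite mulr0.
by rewrite -!PoszM lez_nat mulnAC leq_pmull // muln_gt0 indexg_gt0.
Qed.
Let p0F : p%:R != 0 :> F.
Proof.
rewrite -val0 /val rmorph_nat.
have -> : p%:R = (p%:R : K)%:A :> M by rewrite -[_%:A]/(in_alg M _) rmorph_nat.
by rewrite alg_neq0 char0 // prime_gt0.
Qed.
Let wFp : wF p%:R = #|[set: gT] : H|%g%:Z * e%:Z.
Proof.
rewrite /wF /val rmorph_nat w_p totram_card PoszM mulrAC mulzK //.
by rewrite eqz_nat -lt0n n0_gt0.
Qed.
Let dintF y : vge wF y 0 -> vge wF (sF s y - y) (1 + t%:Z).
Proof.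
rewrite !vgeF mulr0 => hy; rewrite {1}/val rmorphB /= -!/(val _) valsF.
have -> : n0%:Z * (1 + t%:Z) = (n0 * (1 + t))%N%:Z by rewrite PoszM PoszD.
rewrite -sum_t; apply: (fixed_val_ge galM1 Hw wgal xs_int xs_dense sH) => //.
by move=> r; apply: valH.
Qed.

Let uniF : exists pi : F, [/\ pi != 0, wF pi = 1, sF s pi - pi != 0 & wF (sF s pi - pi) = 1 + t%:Z].
Proof.
have [pi [pi0 piH wpi]] := fixed_val_exists galM1 Hw wgal xs_int Hr rc abelG H.
have [d0 wd] := onejump_uniformizer sH sum_t pi0 piH wpi.
have vpi := val_lift piH; exists (vsproj E pi).
have vd : val (sF s (vsproj E pi) - vsproj E pi) = s pi - pi.
  by rewrite {1}/val rmorphB /= -!/(val _) valsF vpi.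
have n00 : (n0%:Z != 0) by rewrite eqz_nat -lt0n n0_gt0.
split; rewrite -?val0 ?vpi ?vd //.
  by rewrite /wF vpi wpi divzz n00.
by rewrite /wF vd wd mulKz.
Qed.

Lemma onejump_coprime : ~~ (p %| t)%N -> (p%:Z - 1) * t%:Z < #|[set: gT] : H|%g%:Z * e%:Z.
Proof.
have [pi [pi0 wpi d0 wd]] := uniF.
move=> pt; rewrite -wFp.
exact: (jump_coprime Hwf rcF sD sM s1 ws t0 pi0 wpi d0 wd dintF sp p0F pt).
Qed.

Lemma onejump_divisible : (p %| t)%N -> (p%:Z - 1) * t%:Z = #|[set: gT] : H|%g%:Z * e%:Z.
Proof.
have [pi [pi0 wpi d0 wd]] := uniF.
move=> pt; rewrite -wFp.
exact: (jump_divisible Hwf rcF sD sM s1 ws t0 pi0 wpi d0 wd dintF sp p0F pt).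
Qed.

Lemma onejump_val_shift (x : M) (c : int) : x != 0 -> (forall r, r \in H -> r x = x) ->
  w x = n0%:Z * c -> ~~ (p %| `|c|)%N ->
  s x - x != 0 /\ w (s x - x) = n0%:Z * (c + t%:Z).
Proof.
move=> x0 xH wx pc.
have [pi [pi0 wpi d0 wd]] := uniF.
have vx := val_lift xH; set y := vsproj E x in vx.
have y0 : y != 0 by rewrite -val0 vx.
have wy : wF y = c by rewrite /wF vx wx mulKz // eqz_nat -lt0n n0_gt0.
have := val_shift Hwf rcF sD sM s1 ws t0 pi0 wpi d0 wd dintF y0.
rewrite wy => /(_ pc) [n00 wn].
have vd : val (sF s y - y) = s x - x.
  by rewrite {1}/val rmorphB /= -!/(val _) valsF vx.
by rewrite -vd val0 n00 (wFE n00) wn.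
Qed.

(* For [pi] the uniformizer of the fixed field and [pK] one of [K], the unit
   [(s pi - pi) / (pK ^ (t / p) pi)] satisfies an additive equation in the residue field. *)
Lemma onejump_residue (pK : K) : pK != 0 -> v pK = 1 -> (p %| t)%N ->
  #|[set: gT] : H|%g = p -> exists S : M, [/\ forall r, r \in H -> r S = S, w S = 0, S != 0
    & vge w (((p%:R / pK ^+ (t %/ p * p.-1))%:A * S) + S ^+ p) 1].
Proof.
move=> pK0 vpK pt ip.
have [pi [pi0 wpi d0 wd]] := uniF.
pose rho := vsproj E (pK ^+ (t %/ p))%:A.
have vr : val rho = (pK ^+ (t %/ p))%:A by apply: val_lift => r _; rewrite gal_alg.
have r0 : rho != 0 by rewrite -val0 vr alg_neq0 expf_neq0.
have wr : wF rho = t%:Z.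
  rewrite /wF vr walg ?expf_neq0 // e0_card totram_card (valX Hv) // vpK mul1r ip.
  rewrite [(p * _)%N]mulnC PoszM -mulrA mulKz; last by rewrite eqz_nat -lt0n n0_gt0.
  by rewrite -PoszM mulnC divnK.
have sr : sF s rho = rho by apply: valI; rewrite valsF vr gal_alg.
pose S := (sF s pi - pi) / (rho * pi).
have := jump_divisible_residue Hwf rcF sD sM s1 ws t0 pi0 wpi d0 wd dintF sp p0F pt r0 wr sr (erefl S).
rewrite vgeF mulr1 => hS.
have S0 : S != 0 by rewrite !mulf_neq0 ?invr_neq0 ?mulf_neq0.
exists (val S); split.
- by move=> r; apply: valH.
- by rewrite wFE // /S (val_div Hwf) ?mulf_neq0 // (dv_mul Hwf) // wd wr wpi [X in _ - X]addrC subrr mulr0.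
- by rewrite val0.
have Ev : val (p%:R / rho ^+ p.-1 * S + S ^+ p) = (p%:R / pK ^+ (t %/ p * p.-1))%:A * val S + val S ^+ p.
  rewrite {1}/val rmorphD rmorphM fmorph_div rmorph_nat !rmorphXn /= -!/(val _) vr.
  congr (_ * _ + _).
  by rewrite -[RHS]/(in_alg M _) fmorph_div rmorph_nat -[_%:A]/(in_alg M _) -rmorphXn /= exprM.
rewrite -Ev; apply: vgeW hS.
by have := n0_gt0; clear; lia.
Qed.

End Jump.

End Fixed.

End OneJumpLocal.

(* [1 + pi^r Y] is a [p]-th root of unity iff [Y] is a root of
   [((1 + pi^r Y)^p - 1) / pi^(r p) = Y^p + (p / pi^e) Y] modulo the maximal ideal, when
   [e = r (p - 1)]. *)
Lemma primitive_root_residue (K : fieldType) (v : K -> int) (p r e : nat) (pi c : K) :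
  dvaluation v ->
  (forall a : nat -> K,
      (forall N : int, exists n0 : nat, forall i j : nat,
          (n0 <= i)%N -> (n0 <= j)%N -> vge v (a i - a j) N) ->
      exists l : K, forall N : int, exists n0 : nat, forall i : nat,
          (n0 <= i)%N -> vge v (a i - l) N) ->
  prime p -> p%:R != 0 :> K -> v p%:R = e%:Z -> (0 < e)%N -> e = (r * p.-1)%N ->
  pi != 0 -> v pi = 1 -> vge v c 0 -> ~~ vge v c 1 ->
  vge v (p%:R / pi ^+ e * c + c ^+ p) 1 ->
  exists z : K, p.-primitive_root z.
Proof.
move=> Hv Hc pp p0 ve e0 Ee pi0 vpi hc uc heq.
have p1 := prime_gt1 pp.
have r0 : (0 < r)%N by move: e0; rewrite Ee; case: (r).
pose a := pi ^+ r.
have a0 : a != 0 by rewrite expf_neq0.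
have va : v a = r%:Z by rewrite (valX Hv) // vpi mul1r.
have Eap : a ^+ p = pi ^+ e * a by rewrite /a Ee exprM -exprSr prednK // prime_gt0.
pose q0 := p%:R / pi ^+ e.
have vq0 : vge v q0 0.
  by rewrite (vge_divE Hv) ?expf_neq0 // (valX Hv) // vpi mul1r add0r vgeE // ve.
have uq0 : q0 != 0 /\ v q0 = 0.
  rewrite /q0 mulf_neq0 ?invr_neq0 ?expf_neq0 // (val_div Hv) ?expf_neq0 //.
  by rewrite ve (valX Hv) // vpi mul1r subrr.
pose Q : {poly K} := \poly_(i < p.+1) (if i == 0%N then 0 else (a ^+ i / a ^+ p) *+ 'C(p, i)).
have QE y : Q.[y] = ((1 + a * y) ^+ p - 1) / a ^+ p.
  rewrite horner_poly exprDn big_ord_recl /= mul0r add0r.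
  rewrite [in RHS]big_ord_recl /= expr1n expr0 mulr1 bin0 mulr1n [1 + _]addrC addrK mulr_suml.
  apply: eq_bigr => i _; rewrite expr1n mul1r exprMn !mulrnAl.
  by rewrite [in RHS]mulrAC.
pose P0 : {poly K} := q0 *: 'X + 'X^p.
have QP i : Q`_i - P0`_i = if (1 < i < p)%N then (a ^+ i / a ^+ p) *+ 'C(p, i) else 0.
  rewrite coef_poly coefD coefZ coefX coefXn.
  have [->|i0] := eqVneq i 0%N.
    by rewrite /= mulr0 add0r (ltn_eqF (prime_gt0 pp)) addr0 oppr0.
  have [->|i1] := eqVneq i 1%N.
    rewrite ltnS prime_gt0 //= bin1 (ltn_eqF p1) mulr1 addr0 expr1 Eap /q0.
    rewrite -[X in X - _]mulr_natr.
    by apply/eqP; rewrite subr_eq0; apply/eqP; field; rewrite a0 expf_neq0.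
  have [->|ip] := eqVneq i p.
    by rewrite ltnSn binn mulr1n divff ?expf_neq0 // mulr0 add0r subrr ltnn andbF.
  rewrite mulr0 add0r subr0 ltnS leq_eqVlt (negbTE ip) /=.
  have -> : (1 < i)%N by lia.
  by [].
have hQP : pvge v (Q - P0) 1.
  move=> i; rewrite coefB QP; case: ifP => [/andP[i1 ip]|_]; last exact: vge0.
  have /dvdnP[b ->] := prime_dvd_bin pp (ltac:(by rewrite (ltnW i1)) : (0 < i < p)%N).
  rewrite mulrnA; have -> : a ^+ i / a ^+ p *+ b *+ p = (a ^+ i * p%:R / a ^+ p) *+ b.
    by rewrite -mulrnA mulnC mulrnA mulr_natr mulrnAl.
  apply: (vgeMn Hv); rewrite (vge_divE Hv) ?expf_neq0 //.
  rewrite vgeE ?mulf_neq0 ?expf_neq0 // (dv_mul Hv) ?expf_neq0 // !(valX Hv _ a0) va ve Ee.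
  rewrite -!PoszM -!PoszD lez_nat; move: i1 r0 p1 ip; clear; case: p => // q; nia.
have hP0 : pvge v P0 0.
  move=> i; rewrite coefD coefZ coefX coefXn; apply: (vgeD Hv).
    by apply: (vgeMr Hv) => //; apply: vge_nat.
  exact: vge_nat.
have hQ : pvge v Q 0.
  by rewrite -[Q](subrK P0); apply: pvgeD => //; apply: pvgeW hQP.
have ev1 (R : {poly K}) : pvge v R 1 -> vge v R.[c] 1.
  move=> hR; rewrite horner_coef; apply: (vge_sum Hv) => i _; apply: (vgeMr Hv) => //.
  exact: vgeX0.
have hQc : vge v Q.[c] 1.
  rewrite -[Q](subrK P0) hornerD; apply: (vgeD Hv); first exact: ev1.
  by rewrite !hornerE.
have hp1 : vge v p%:R 1 by rewrite vgeE // ve; lia.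
have hQ' : ~~ vge v Q^`().[c] 1.
  have [q00 vq] := uq0.
  have : ~~ vge v q0 1 by rewrite vgeE // vq.
  apply: contra => h.
  have -> : q0 = Q^`().[c] - (Q - P0)^`().[c] - (c ^+ p.-1) *+ p.
    have EP : P0^`().[c] = q0 + c ^+ p.-1 *+ p.
      by rewrite derivD derivZ derivX derivXn hornerD hornerMn hornerXn hornerZ hornerC mulr1.
    by rewrite derivB hornerD hornerN EP; ring.
  apply: (vgeB Hv); last by rewrite -mulr_natr; apply: (vgeMl Hv) => //; apply: vgeX0.
  apply: (vgeB Hv) => //; apply: ev1 => i; rewrite coef_deriv; exact: vgeMn.
have [b [rb hb]] := hensel_root Hv Hc hQ hc hQc hQ'.
have b0 : b != 0.
  apply: contraNneq uc => E0; move: hb; rewrite E0 sub0r vgeN //.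
pose z := 1 + a * b.
have zp : z ^+ p = 1.
  move/rootP: rb; rewrite QE => /eqP; rewrite mulf_eq0 invr_eq0 expf_eq0 (negbTE a0) andbF orbF.
  by rewrite subr_eq0 => /eqP.
have z1 : z != 1 by rewrite /z -subr_eq0 addrAC subrr add0r mulf_neq0.
have [m mz mp] := prim_order_exists (prime_gt0 pp) zp.
have m1 : m != 1%N by apply: contraNneq z1 => E; rewrite -(prim_expr_order mz) E expr1.
have := prime_nt_dvdP pp m1 mp => <-.
by exists z.
Qed.

(** * Layers of the ramification filtration *)

Section JumpStructure.
Variables (p : nat) (K : fieldType) (v : K -> int) (M : splittingFieldType K) (w : M -> int).
Variables (xs : M) (k : finFieldType) (red : M -> k) (e0 : int) (e : nat).
Hypothesis galM1 : galois 1%AS {:M}.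
Hypothesis Hv : dvaluation v.
Hypothesis Hw : dvaluation w.
Notation gT := (gal_of {:M}).
Implicit Types (s t : gT).
Hypothesis wgal : forall (s : gT) x, w (s x) = w x.
Hypothesis xs_int : vge w xs 0.
Hypothesis xs_dense : zdense w xs.
Hypothesis Hr : residue_map w red.
Hypothesis rc : residue_char w p.
Hypothesis abelG : (p.-abelem [set: gT])%g.
Hypothesis e00 : 0 < e0.
Hypothesis walg : forall c : K, c != 0 -> w c%:A = e0 * v c.
Hypothesis char0 : forall n : nat, (0 < n)%N -> n%:R != 0 :> K.
Hypothesis ve : v p%:R = e%:Z.

Let vgal (s : gT) x n : vge w (s x) n = vge w x n.
Proof. exact: vge_gal. Qed.
Let pp : prime p. Proof. exact: residue_char_prime rc. Qed.
Local Notation I := (inertia_group Hw wgal).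
Local Notation idx := (ramidx w xs).

Local Notation Phi := (phisum w xs [set: gT]).
Variables (f : nat) (sK : seq K).
Hypothesis Hc : forall a : nat -> K,
      (forall N : int, exists n0 : nat, forall i j : nat,
          (n0 <= i)%N -> (n0 <= j)%N -> vge v (a i - a j) N) ->
      exists l : K, forall N : int, exists n0 : nat, forall i : nat,
          (n0 <= i)%N -> vge v (a i - l) N.
Hypothesis e_gt0 : (0 < e)%N.
Hypothesis size_sK : size sK = (p ^ f)%N.
Hypothesis cover_sK : forall x, vge v x 0 -> exists2 y, y \in sK & vge v (x - y) 1.

Lemma vge_alg (c : K) n : vge w c%:A (e0 * n) = vge v c n.
Proof.
have [->|c0] := eqVneq c 0; first by rewrite scale0r !vge0.
by rewrite !vgeE ?alg_neq0 // walg // ler_pM2l.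
Qed.

Lemma vge_alg0 (c : K) : vge w c%:A 0 = vge v c 0.
Proof. by rewrite -(vge_alg c 0) mulr0. Qed.

Lemma vge_alg1 (c : K) : vge w c%:A 1 = vge v c 1.
Proof.
have [->|c0] := eqVneq c 0; first by rewrite scale0r !vge0.
rewrite !vgeE ?alg_neq0 // walg //; move: (v c) e00 => a; clear; nia.
Qed.

Section Totram.
Variable H : {group gT}.
Hypothesis totram : forall s, exists2 r, r \in H & inertial w (r * s)%g.
Local Notation n0 := #|H :&: I|.
Let n0_pos := n0_gt0 Hw wgal H.

(** The sum is the valuation of an element fixed by [H], hence a multiple of [n0]. Moving [s] within
    its coset to an inertial element, each [r] in [H :&: I] contributes at least [2] by wildness;
    this gives [0 < t]. *)
Lemma onejump_exists s : s \notin H -> exists2 t, (0 < t)%N &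
  (\sum_(r in H) idx (r * s)%g = n0 * (1 + t))%N.
Proof.
move=> sH; set S := (\sum_(r in H) _)%N.
have [y [hy yH hny]] := fixed_val_attained galM1 Hw wgal xs_int xs_dense sH.
have hyy := fixed_val_ge galM1 Hw wgal xs_int xs_dense sH hy yH.
rewrite -/S in hny hyy.
have d0 : s y - y != 0 by apply: contraNneq hny => ->; apply: vge0.
have wd : w (s y - y) = S%:Z.
  by move: hny hyy; rewrite !vgeE //; move: (w _) => a; clear; lia.
have dvdS : (n0 %| S)%N.
  have := fixed_val_dvd galM1 Hw wgal xs_int Hr rc abelG (N := H) d0.
  rewrite wd; apply=> r rH.
  by rewrite rmorphB /= (galC rc abelG) yH.
have S2 : (2 * n0 <= S)%N.
  have [r1 r1H hr1] := totram s.
  have -> : S = (\sum_(r in H) idx (r * (r1 * s))%g)%N by rewrite (coset_sum_mulg _ _ _ r1H).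
  rewrite mulnC -sum_nat_const big_mkcond [X in (_ <= X)%N]big_mkcond.
  apply: leq_sum => r _; rewrite in_setI; case: (r \in H) => //=.
  case: (boolP (r \in I)) => //= rI.
  apply: (inertial_wild galM1 Hw wgal xs_int xs_dense Hr rc abelG).
  apply/(mem_inertia w); rewrite -[_ \in _]/(_ \in I) groupM //.
  exact/mem_inertia.
case/dvdnP: dvdS S2 => q -> h.
exists q.-1; first by move: h n0_pos; rewrite leq_pmul2r // => h _; move: h; clear; lia.
rewrite mulnC; congr (_ * _)%N; move: h n0_pos; rewrite leq_pmul2r //; clear; lia.
Qed.

(** If [u s] and [u t'] have the same residue, then [s * t'^-1] moves [pi] by more than the jump
    permits outside [H]. The residues may be taken in [K], whence the exponent [f]. *)
Lemma onejump_index_le (t : nat) :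
  (forall s, s \notin H -> (\sum_(r in H) idx (r * s)%g = n0 * (1 + t))%N) ->
  (#|[set: gT] : H|%g <= p ^ f)%N.
Proof.
move=> Ht.
have [pi [pi0 piH wpi]] := fixed_val_exists galM1 Hw wgal xs_int Hr rc abelG H.
have wn0 : n0%:Z * (1 + t%:Z) = w (pi ^+ t.+1) by rewrite (valX Hw) // wpi -intS.
have hs s : vge w (s pi - pi) (n0%:Z * (1 + t%:Z)).
  have [sH|sH] := boolP (s \in H); first by rewrite piH // subrr vge0.
  have [d0 wd] := onejump_uniformizer galM1 xs_int xs_dense Hr rc abelG totram sH (Ht s sH) pi0 piH wpi.
  by rewrite vgeE // wd.
pose u s := (s pi - pi) / pi ^+ t.+1.
have hu s : vge w (u s) 0 by rewrite (vge_divE Hw) ?expf_neq0 // add0r -wn0.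
have uH s r : r \in H -> r (u s) = u s.
  by move=> rH; rewrite rmorphM fmorphV rmorphXn rmorphB /= (galC rc abelG) piH.
have /choice[c Hcc] : forall s, exists i : 'I_(size sK), vge w ((nth 0 sK i)%:A - u s) 1.
  move=> s; have [c hc hcu] := fixed_residue galM1 Hw wgal Hr rc abelG totram (hu s) (uH s).
  rewrite vge_alg0 in hc; have [y ysK hy] := cover_sK hc.
  have iy : (index y sK < size sK)%N by rewrite index_mem.
  exists (Ordinal iy); rewrite nth_index //.
  apply: (vge_trans Hw _ hcu); rewrite (vgeBC Hw).
  have -> : c%:A - y%:A = (c - y)%:A :> M by rewrite scalerBl.
  by rewrite vge_alg1.
rewrite -size_sK -[X in (_ <= X)%N]card_ord.
apply: (index_le_inj (f := c)); first exact: subsetT.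
move=> s t' _ _ E; apply: contraT => stH.
have [d0 wd] := onejump_uniformizer galM1 xs_int xs_dense Hr rc abelG totram stH (Ht _ stH) pi0 piH wpi.
have huu : vge w (u s - u t') 1.
  apply: (vge_trans Hw (y := (nth 0 sK (c s))%:A)); first by rewrite (vgeBC Hw).
  by rewrite E.
have Eu : s pi - t' pi = (u s - u t') * pi ^+ t.+1.
  by rewrite -mulrBl divfK ?expf_neq0 //; ring.
have : vge w (s pi - t' pi) (1 + n0%:Z * (1 + t%:Z)).
  by rewrite Eu; apply: (vgeM Hw) => //; rewrite wn0 vgeE ?expf_neq0.
have -> : s pi - t' pi = t' ((s * t'^-1)%g pi - pi).
  by rewrite rmorphB /= galMx galKV.
by rewrite vgal vgeE // wd; move: (n0%:Z * _) => a; clear; lia.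
Qed.

Lemma onejump_primitive_root s (t : nat) : s \notin H -> (0 < t)%N ->
  (\sum_(r in H) idx (r * s)%g = n0 * (1 + t))%N -> (p %| t)%N ->
  #|[set: gT] : H|%g = p -> exists z : K, p.-primitive_root z.
Proof.
move=> sH t0 Et pt ip.
have Epe := onejump_divisible galM1 Hv xs_int xs_dense Hr rc abelG e00 walg char0 ve totram sH t0 Et pt.
have [pK [pK0 vpK]] := dv_norm Hv.
have [S [SH wS S0 hS]] := onejump_residue galM1 Hv xs_int xs_dense Hr rc abelG e00 walg char0 ve totram sH t0 Et pK0 vpK pt ip.
have hSint : vge w S 0 by rewrite vgeE // wS.
have [c hc hcS] := fixed_residue galM1 Hw wgal Hr rc abelG totram hSint SH.
have Ee : e = (t %/ p * p.-1)%N.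
  move: Epe; rewrite ip; case/dvdnP: pt => q ->; rewrite mulnK ?prime_gt0 //.
  have := prime_gt0 pp; clear; case: p => // p' _ h.
  have : (p'.+1 * (q * p'))%N%:Z = p'.+1%:Z * e%:Z.
    have E1 : p'.+1%:Z - 1 = p'%:Z by lia.
    by rewrite -h E1 !PoszM; ring.
  by rewrite -PoszM => -[/eqP]; rewrite eqn_pmul2l // => /eqP.
rewrite -Ee in hS.
have vc0 : vge v c 0 by rewrite -vge_alg0.
have p0 : p%:R != 0 :> K by rewrite char0 // prime_gt0.
apply: (primitive_root_residue Hv Hc pp p0 ve e_gt0 Ee pK0 vpK vc0).
  rewrite -vge_alg1; apply/negP => h.
  have : vge w S 1 by rewrite -[S](subKr c%:A); apply: (vgeB Hw).
  by rewrite vgeE // wS.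
have q0 : vge v (p%:R / pK ^+ e) 0.
  by rewrite (vge_divE Hv) ?expf_neq0 // (valX Hv) // vpK mul1r add0r vgeE // ve.
rewrite -vge_alg1.
have -> : (p%:R / pK ^+ e * c + c ^+ p)%:A = (p%:R / pK ^+ e)%:A * c%:A + c%:A ^+ p :> M.
  by rewrite -[LHS]/(in_alg M _) rmorphD rmorphM rmorphXn.
set q := (p%:R / pK ^+ e) in hS q0 *.
have -> : q%:A * c%:A + c%:A ^+ p = (q%:A * S + S ^+ p) + q%:A * (c%:A - S) + (c%:A ^+ p - S ^+ p) by ring.
apply: (vgeD Hw); last by apply: (vgeW _ (pow_congr Hw rc (lexx 1) hc hSint hcS)).
apply: (vgeD Hw) => //; apply: (vgeMl Hw) => //.
by rewrite vge_alg0.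
Qed.

End Totram.

Lemma ramsub_groupP c : (c <= ramidx_bound w xs)%N -> group_set (ramsub w xs c).
Proof.
move=> hc; have := group_set_ramsub galM1 Hw wgal xs_int xs_dense c.
by rewrite (minn_idPl hc).
Qed.

(** With [C] a complement of [A], the subgroup [B C] meets [A] in [B], so the quotient by it retains
    exactly the layer [A / B]. *)
Lemma complement_over (A B : {group gT}) : B \subset A ->
  exists H : {group gT}, [/\ B \subset H, (A * H)%g = [set: gT] & #|[set: gT] : H|%g = #|A : B|%g].
Proof.
move=> BA.
have [C /complP[AC1 ACG]] : exists C : {group gT}, C \in [complements to A in [set: gT]]%g.
  have /splitsP[C hC] := abelem_splits abelG (subsetT A).
  by exists C; move: hC.
have cG : abelian [set: gT] by apply: abelem_abelian abelG.
have nB : C \subset 'N(B)%g.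
  exact: subset_trans (subsetT _) (sub_abelian_norm cG (subsetT _)).
exists (B <*> C)%G; split.
- exact: joing_subl.
- rewrite /= norm_joinEr // mulgA (mulGSid BA) ACG //.
- have cBC : #|(B <*> C)%G| = (#|B| * #|C|)%N.
    rewrite /= norm_joinEr // TI_cardMg //.
    by apply/trivgP; rewrite -AC1; apply: setSI.
  have cAC : #|[set: gT]| = (#|A| * #|C|)%N by rewrite -ACG TI_cardMg.
  apply/eqP; rewrite -(eqn_pmul2l (cardG_gt0 (B <*> C)%G)) Lagrange ?subsetT //.
  by rewrite cBC cAC mulnAC Lagrange.
Qed.

Section Layer.
Variable s0 : gT.
Hypothesis s01 : s0 != 1%g.
Local Notation c := (idx s0).
Hypothesis c0 : (0 < c)%N.
Let cB : (c < ramidx_bound w xs)%N. Proof. exact: ramidx_lt. Qed.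

Section Sub.
Variable H : {group gT}.
Hypothesis BH : ramsub w xs c.+1 \subset H.
Hypothesis AH : forall s, exists2 r, r \in H & (r * s)%g \in ramsub w xs c.
Hypothesis HT : exists s, s \notin H.

Let totram s : exists2 r, r \in H & inertial w (r * s)%g.
Proof.
have [r rH hr] := AH s; exists r => //.
apply/(ramsub1P galM1 Hw wgal xs_int xs_dense).
by move: hr; rewrite !inE; apply: leq_trans.
Qed.

(** A coset outside [H] meets the group of index [c] and avoids the next one, so its largest index
    is exactly [c]. *)
Let sum_phi s : s \notin H -> (\sum_(r in H) idx (r * s)%g = phisum w xs H c)%N.
Proof.
move=> sH; have [r rH hr] := AH s.
have le s' : s' \notin H -> (idx s' <= c)%N.
  by move=> h; rewrite leqNgt; apply: contra h => h; apply: (subsetP BH); rewrite inE.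
have E : idx (r * s)%g = c.
  apply/eqP; rewrite eqn_leq le ?groupMl //.
  by move: hr; rewrite inE.
rewrite -E -(coset_sum_mulg _ _ s rH).
apply: (coset_sum_max galM1 Hw wgal xs_int xs_dense) => r' r'H.
by rewrite E le // !groupMl.
Qed.

(** The value of [Phi c] identifies the jump [t] of the quotient with the upper value of [s0]; in
    particular [t] depends on [c] only, not on [H]. *)
Lemma layer_quotient : exists2 t, (0 < t)%N &
  [/\ forall s, exists2 r, r \in H & inertial w (r * s)%g,
      Phi c = (#|I| * (1 + t))%N
    & forall s, s \notin H -> (\sum_(r in H) idx (r * s)%g = #|H :&: I| * (1 + t))%N].
Proof.
have [s sH] := HT.
have [t t0 Et] := onejump_exists totram sH.
exists t => //; split => //.
  rewrite (phisum_cosets (N := H)) //; last exact: ltnW.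
    by rewrite -(sum_phi sH) Et (totram_card Hw wgal totram) mulnA.
  by move=> s' h; rewrite leqNgt; apply: contra h => h; apply: (subsetP BH); rewrite inE.
by move=> s' s'H; rewrite sum_phi // -(sum_phi sH).
Qed.

End Sub.

Lemma layer_structure : exists t m : nat,
  [/\ (0 < t)%N, Phi c = (#|I| * (1 + t))%N,
      #|ramsub w xs c| = (p ^ m * #|ramsub w xs c.+1|)%N, (1 <= m <= f)%N
    & (~~ (p %| t)%N -> (p%:Z - 1) * t%:Z < p%:Z * e%:Z) /\
      ((p %| t)%N -> [/\ m = 1%N, (p%:Z - 1) * t%:Z = p%:Z * e%:Z & exists z : K, p.-primitive_root z])].
Proof.
pose A := Group (ramsub_groupP (ltnW cB)); pose B := Group (ramsub_groupP cB).
have BA : B \subset A by apply/subsetP => s; rewrite !inE; apply: ltnW.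
have [H [BH AH iH]] := complement_over BA.
have AH' (H' : {group gT}) s : H \subset H' -> exists2 r, r \in H' & (r * s)%g \in ramsub w xs c.
  move=> HH'; have : (s^-1)%g \in (A * H)%g by rewrite AH inE.
  case/mulsgP => a r aA rH E; exists r; first exact: (subsetP HH').
  have -> : (r * s = a^-1)%g.
    by rewrite -[s]invgK E invMg mulKVg.
  by rewrite -[_ \in _]/(_ \in A) groupV.
have iAB : (1 < #|A : B|%g)%N.
  rewrite ltnNge; apply/negP => h.
  have E1 : #|A : B|%g = 1%N by move: h (indexg_gt0 A B); clear; lia.
  have : s0 \in A by rewrite inE.
  by rewrite -(index1g BA E1) inE ltnn.
have HT (H' : {group gT}) : (1 < #|[set: gT] : H'|%g)%N -> exists s, s \notin H'.
  move=> h; have : ~~ ([set: gT] \subset H') by rewrite -indexg_eq1 neq_ltn h orbT.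
  by case/subsetPn => s _ sH; exists s.
have iH1 : (1 < #|[set: gT] : H|%g)%N by rewrite iH.
have [t t0 [totH PhiH sumH]] := layer_quotient BH (fun s => AH' H s (subxx H)) (HT H iH1).
have [m Em] := index_pnat rc abelG H.
(* The index of [H] is the size of the layer, while the bounds on [t] need index [p]. Both quotients
   have the same [t]; when [p] divides [t], comparing the two equalities [(p - 1) t = index * e]
   gives [m = 1]. *)
have [H' maxH' HH'] : exists2 H' : {group gT}, maximal H' [set: gT] & H \subset H'.
  have [E|[H' ? ?]] := maximal_exists (subsetT H); last by exists H'.
  by move: iH1; rewrite /= E indexgg.
have iH' : #|[set: gT] : H'|%g = p by apply: p_maximal_index maxH'; apply: abelem_pgroup abelG.
have iH'1 : (1 < #|[set: gT] : H'|%g)%N by rewrite iH' prime_gt1.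
have [s' s'H'] := HT H' iH'1.
have [t' t'0 [totH' PhiH' sumH']] := layer_quotient (subset_trans BH HH') (fun s => AH' H' s HH') (HT H' iH'1).
have tt' : t' = t.
  move: PhiH'; rewrite PhiH => /eqP; rewrite eqn_pmul2l ?cardG_gt0 //.
  by rewrite eqn_add2l => /eqP.
rewrite {}tt' in t'0 PhiH' sumH'.
have [s sH] := HT H iH1.
have m1 : (0 < m)%N by move: iH1; rewrite Em; case: (m).
exists t, m; split => //.
- by rewrite -Em iH mulnC; apply/esym/(Lagrange BA).
- rewrite m1 -(leq_exp2l _ _ (prime_gt1 pp)) -Em.
  exact: (onejump_index_le totH sumH).
split=> pt.
  have := onejump_coprime galM1 Hv xs_int xs_dense Hr rc abelG e00 walg char0 ve totH' s'H' t0 (sumH' _ s'H') pt.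
  by rewrite iH'.
have E1 := onejump_divisible galM1 Hv xs_int xs_dense Hr rc abelG e00 walg char0 ve totH sH t0 (sumH _ sH) pt.
have E2 := onejump_divisible galM1 Hv xs_int xs_dense Hr rc abelG e00 walg char0 ve totH' s'H' t0 (sumH' _ s'H') pt.
split; last exact: (onejump_primitive_root totH' s'H' t0 (sumH' _ s'H') pt iH').
  have : #|[set: gT] : H|%g%:Z * e%:Z = p%:Z * e%:Z by rewrite -E1 E2 iH'.
  rewrite -!PoszM => -[/eqP]; rewrite eqn_pmul2r // Em -{2}(expn1 p).
  by rewrite eqn_exp2l ?prime_gt1 // => /eqP.
by rewrite E2 iH'.
Qed.

End Layer.

Lemma unramified_structure : #|[set: gT]| = #|I| \/ #|[set: gT]| = (p * #|I|)%N.
Proof.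
have le : (#|[set: gT] : I|%g <= p)%N.
  have := @inertia_index_le _ _ _ _ _ _ Hw wgal Hr rc abelG I; apply.
  by move=> s /mem_inertia.
have [m Em] := index_pnat rc abelG I.
rewrite -(Lagrange (subsetT I)) Em mulnC.
have : (m <= 1)%N by rewrite -(leq_exp2l _ _ (prime_gt1 pp)) -Em expn1.
by case: m {Em} => [|[|//]] _; [left; rewrite mul1n|right; rewrite expn1].
Qed.

End JumpStructure.

(** * Jumps of elementary abelian extensions *)

Record ramification_frame (p : nat) (K : fieldType) (v : K -> int) (M : splittingFieldType K)
    (w : M -> int) (xs : M) (k : finFieldType) (red : M -> k) (e0 : int) : Prop := {
  rf_w : dvaluation w;
  rf_gal : forall (s : gal_of {:M}) x, w (s x) = w x;
  rf_int : vge w xs 0;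
  rf_dense : zdense w xs;
  rf_red : residue_map w red;
  rf_char : residue_char w p;
  rf_e0 : 0 < e0;
  rf_alg : forall c : K, c != 0 -> w c%:A = e0 * v c }.

Lemma ramification_frame_exists (p : nat) (K : fieldType) (v : K -> int) (e f : nat)
    (M : splittingFieldType K) (w : M -> int) :
  prime p -> padic_field p v e f -> galois 1%AS {:M} -> ext_val v w ->
  exists xs k red e0, @ramification_frame p K v M w xs k red e0.
Proof.
move=> pp pf galM1 Hext; have [Hw [e0 [e00 walg]]] := Hext.
have Hv := pf_val pf.
have [sK [_ _ _ cov]] := pf_f pf.
have [sM covM] := residue_cover_ext Hv Hext cov.
have [k [red Hr]] := residue_field Hw covM.
have wg s x := ext_val_gal galM1 Hv (pf_complete pf) s x Hext.
have rc : residue_char w p.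
  split => //.
  have -> : p%:R = (p%:R : K)%:A :> M by rewrite -[_%:A]/(in_alg M _) rmorph_nat.
  have p0 : p%:R != 0 :> K by apply: (pf_char0 pf); apply: prime_gt0.
  rewrite vgeE ?alg_neq0 // walg // (pf_e pf).
  by have := pf_e_pos pf; move: e00; clear; nia.
have [xs xs0 xsd] := zdense_exists Hw Hr rc.
by exists xs, k, red, e0; split.
Qed.

Section UpperValues.
Variables (p : nat) (K : fieldType) (v : K -> int) (e f : nat) (M : splittingFieldType K).
Variable w : M -> int.
Hypothesis pp : prime p.
Hypothesis pf : padic_field p v e f.
Hypothesis galM1 : galois 1%AS {:M}.
Hypothesis abelG : (p.-abelem [set: gal_of {:M}])%g.
Hypothesis Hext : ext_val v w.
Notation gT := (gal_of {:M}).

(** For [s] other than the identity, [U s] is the largest [u] whose upper group contains [s]; that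
    it is an integer is the Hasse-Arf property. *)
Definition upper_value (U : gT -> int) :=
  forall s u, (s \in upper_ram w u) = (s == 1%g) || (u <= (U s)%:~R).

Definition jump_conditions (t : int) (m : nat) :=
  [/\ #|upper_ram w t%:~R| = (p ^ m * #|upper_ram w (t + 1)%:~R|)%N, (0 < m)%N &
   [\/ t = -1 /\ m = 1%N,
      [/\ 1 <= t, (m <= f)%N, coprime `|t| p & (p%:Z - 1) * t < p%:Z * e%:Z] |
      [/\ 1 <= t, m = 1%N, (p%:Z - 1) * t = p%:Z * e%:Z & exists z : K, p.-primitive_root z]]].

(** [U s] solves [Phi (idx s) = #|I| (1 + U s)], which has an integer solution by the study of
    layers. Strict monotonicity of [Phi] lets lower indices be compared through [U], so the layers
    are also those of the upper filtration. *)
Lemma upper_value_exists : exists2 U, upper_value U &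
  forall s, s != 1%g -> exists m, jump_conditions (U s) m.
Proof.
have [xs [k [red [e0 [Hw wgal xs_int xs_dense Hr rc e00 walg]]]]] :=
  ramification_frame_exists pp pf galM1 Hext.
have Hv := pf_val pf; have char0 := pf_char0 pf; have ve := pf_e pf; have e_gt0 := pf_e_pos pf.
have [sK [size_sK _ _ cov]] := pf_f pf; have Hc := pf_complete pf.
pose idx := ramidx w xs; pose Phi := phisum w xs [set: gT]; pose I := inertia_group Hw wgal.
have layer s : s != 1%g -> exists t : int, [/\ (Phi (idx s))%:Z = #|I|%:Z * (1 + t) &
    exists m, [/\ #|ramsub w xs (idx s)| = (p ^ m * #|ramsub w xs (idx s).+1|)%N, (0 < m)%N &
     [\/ t = -1 /\ m = 1%N,
      [/\ 1 <= t, (m <= f)%N, coprime `|t| p & (p%:Z - 1) * t < p%:Z * e%:Z] |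
      [/\ 1 <= t, m = 1%N, (p%:Z - 1) * t = p%:Z * e%:Z & exists z : K, p.-primitive_root z]]]].
  move=> s1; have [i0|ipos] := posnP (idx s).
    exists (-1); split; first by rewrite subrr mulr0 i0 /Phi /phisum big1 // => r _; rewrite minn0.
    have ER : ramsub w xs 1 = I by rewrite [RHS](inertia_ramsub galM1 Hw wgal xs_int xs_dense).
    have ET : ramsub w xs 0 = [set: gT] by apply/setP => r; rewrite !inE.
    exists 1%N; rewrite i0 ER ET expn1; split => //; last by constructor 1.
    have [E|//] := unramified_structure Hw wgal Hr rc abelG.
    have : s \in I by have /eqP -> : I == [set: gT] :> {set gT}; rewrite ?inE // eqEcard subsetT E leqnn.
    by rewrite -ER inE -/(idx s) i0.
  have [t [m [t0 EPhi EA /andP[m0 mf] [h1 h2]]]] :=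
    layer_structure galM1 Hv Hw wgal xs_int xs_dense Hr rc abelG e00 walg char0 ve Hc e_gt0 size_sK cov s1 ipos.
  exists t%:Z; split; first by rewrite /Phi EPhi PoszM PoszD.
  exists m; split => //.
  have [pt|pt] := boolP (p %| t)%N.
    by have [m1 E z] := h2 pt; constructor 3.
  constructor 2; split => //; last exact: h1.
  by rewrite coprime_sym prime_coprime.
have /choice[U HU] : forall s, exists t : int, s != 1%g -> [/\ (Phi (idx s))%:Z = #|I|%:Z * (1 + t) &
    exists m, [/\ #|ramsub w xs (idx s)| = (p ^ m * #|ramsub w xs (idx s).+1|)%N, (0 < m)%N &
     [\/ t = -1 /\ m = 1%N,
      [/\ 1 <= t, (m <= f)%N, coprime `|t| p & (p%:Z - 1) * t < p%:Z * e%:Z] |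
      [/\ 1 <= t, m = 1%N, (p%:Z - 1) * t = p%:Z * e%:Z & exists z : K, p.-primitive_root z]]]].
  by move=> s; have [->|/layer[t Ht]] := eqVneq s 1%g; [exists 0|exists t].
have I0 : 0 < #|I|%:Z :> int by rewrite ltz_nat cardG_gt0.
have upE : upper_value U.
  move=> s u; rewrite (mem_upper_ram galM1 Hw wgal xs_int xs_dense).
  have [//|s1 /=] := eqVneq s 1%g.
  have [EPhi _] := HU s s1.
  have := congr1 (fun z : int => z%:~R : rat) EPhi; rewrite /= intrM intrD -!pmulrn => E.
  rewrite -(inertia_lower w) -/(idx s) -/(Phi (idx s)) E mulrC ler_pM2l ?ltr0n ?cardG_gt0 //.
  by rewrite addrC lerD2l.
exists U => // s0 s01; have [EPhi [m [EA m0 hcases]]] := HU s0 s01.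
have phi_mono a b : (a <= b)%N -> (Phi a <= Phi b)%N.
  by move=> ab; apply: leq_sum => r _; rewrite leq_min geq_minl /= (leq_trans (geq_minr _ _)).
have phi_lt s : s != 1%g -> (idx s0 <= idx s)%N = (U s0 <= U s).
  move=> s1; have [EPhis _] := HU s s1.
  rewrite -[RHS](lerD2l 1) -(ler_pM2l I0) -EPhi -EPhis lez_nat.
  apply/idP/idP => [/phi_mono//|h]; rewrite leqNgt; apply/negP => lt.
  have E : Phi (idx s) = Phi (idx s0) by apply/eqP; rewrite eqn_leq h phi_mono // ltnW.
  have := @phisum_inj _ _ w xs galM1 xs_int [group of [set: gT]] (idx s) (idx s0) (ramidx_le w xs s) (ramidx_le w xs s0) E.
  by move=> E2; rewrite E2 ltnn in lt.
have phi_lt' s : s != 1%g -> (idx s0 < idx s)%N = (U s0 + 1 <= U s).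
  move=> s1; have [EPhis _] := HU s s1.
  rewrite ltnNge lezD1 ltNge; congr (~~ _).
  rewrite -[RHS](lerD2l 1) -(ler_pM2l I0) -EPhi -EPhis lez_nat.
  apply/idP/idP => [/phi_mono//|h]; rewrite leqNgt; apply/negP => lt.
  have E : Phi (idx s0) = Phi (idx s) by apply/eqP; rewrite eqn_leq h phi_mono // ltnW.
  have := @phisum_inj _ _ w xs galM1 xs_int [group of [set: gT]] (idx s0) (idx s) (ramidx_le w xs s0) (ramidx_le w xs s) E.
  by move=> E2; rewrite E2 ltnn in lt.
exists m; split => //.
have -> : upper_ram w (U s0)%:~R = ramsub w xs (idx s0).
  apply/setP => s; rewrite upE inE; have [->|s1] := eqVneq s 1%g; first by rewrite ramidx1 ramidx_le.
  by rewrite /= ler_int phi_lt.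
have -> // : upper_ram w (U s0 + 1)%:~R = ramsub w xs (idx s0).+1.
apply/setP => s; rewrite upE inE; have [->|s1] := eqVneq s 1%g; first by rewrite ramidx1 ramidx_lt.
by rewrite /= ler_int phi_lt'.
Qed.

End UpperValues.

Section JumpSets.
Variables (p : nat) (K : fieldType) (M : splittingFieldType K) (w : M -> int).
Notation gT := (gal_of {:M}).
Variable U : gT -> int.
Hypothesis HU : upper_value w U.

Lemma upper_jumpP (t : int) : upper_jump w t <-> exists2 s, s != 1%g & U s = t.
Proof.
split=> [/(_ (t + 1)%:~R)|[s s1 Us] u tu].
  rewrite ltr_int ltzD1 lexx => /(_ isT) /eqP h.
  apply: contrapT => H; apply: h; apply/setP => s; rewrite !HU.
  have [//|s1 /=] := eqVneq s 1%g.
  rewrite !ler_int lezD1 le_eqVlt; case: eqP => //= E.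
  by case: H; exists s.
apply/eqP => E; have : s \in upper_ram w t%:~R by rewrite HU Us lexx orbT.
by rewrite E HU (negbTE s1) /= Us leNgt tu.
Qed.

Variables (h : nat) (t m : 'I_h -> int).
Hypothesis p_gt0 : (0 < p)%N.
Hypothesis t_inc : forall i j : 'I_h, (i < j)%N -> t i < t j.
Hypothesis Hj : has_upper_jumps w p t m.

(** The product of the sizes telescopes, the group just above one jump being the group at the next;
    [D j] collects the elements whose upper value is one of the jumps from the [j]-th on. *)
Lemma card_gal_jumps : (#|[set: gT]|)%:R = (p%:R : rat) ^ (\sum_(i < h) m i).
Proof.
case: Hj => Hj1 Hj2.
have p0 : p%:R != 0 :> rat by rewrite pnatr_eq0 -lt0n.
have Uval s : s != 1%g -> exists i, U s = t i.
  move=> s1; have /Hj1[i Ei] : upper_jump w (U s) by apply/upper_jumpP; exists s.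
  by exists i.
have t_le (i j : 'I_h) : (t i <= t j) = (i <= j)%N.
  have [lt|gt|E] := ltngtP i j; first by rewrite ltW // t_inc.
    by apply/negbTE; rewrite -ltNge t_inc.
  by rewrite (ord_inj E) lexx.
pose D (j : nat) : {set gT} := [set s | (s == 1%g) || [exists i : 'I_h, (j <= i)%N && (U s == t i)]].
have DR (i : 'I_h) : upper_ram w (t i)%:~R = D i.
  apply/setP => s; rewrite HU inE; have [//|s1 /=] := eqVneq s 1%g.
  rewrite ler_int; have [j ->] := Uval s s1.
  apply/idP/existsP => [le|[l /andP[il /eqP E]]]; last by rewrite E t_le.
  by exists j; rewrite eqxx -t_le le.
have DR1 (i : 'I_h) : upper_ram w (t i + 1)%:~R = D i.+1.
  apply/setP => s; rewrite HU inE; have [//|s1 /=] := eqVneq s 1%g.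
  rewrite ler_int lezD1 ltNge; have [j ->] := Uval s s1.
  apply/idP/existsP => [le|[l /andP[il /eqP E]]]; last by rewrite E t_le -ltnNge.
  by exists j; rewrite eqxx andbT ltnNge -t_le.
have Dh : D h = [set 1%g].
  apply/setP => s; rewrite !inE; have [//|s1 /=] := eqVneq s 1%g.
  by apply/negbTE/existsPn => i; rewrite leqNgt ltn_ord.
have D0 : D 0%N = [set: gT].
  apply/setP => s; rewrite !inE; have [//|s1 /=] := eqVneq s 1%g.
  by have [i Ei] := Uval s s1; apply/existsP; exists i; rewrite Ei eqxx.
have key n : (n <= h)%N -> #|D (h - n)%N|%:R = (p%:R : rat) ^ (\sum_(i < h | (h - n <= i)%N) m i).
  elim: n => [|n IH] nh.
    rewrite subn0 Dh cards1 big_pred0 ?expr0z // => i.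
    by rewrite leqNgt ltn_ord.
  have lt : (h - n.+1 < h)%N by lia.
  have ES : (h - n.+1).+1 = (h - n)%N by lia.
  have := Hj2 (Ordinal lt); rewrite DR DR1 /= ES IH; last exact: ltnW.
  move=> ->; rewrite -expfzDr //; congr (_ ^ _).
  rewrite [RHS](bigD1 (Ordinal lt)) //=; congr (_ + _).
  apply: eq_bigl => i; rewrite -ES ltn_neqAle andbC eq_sym; congr (_ && _).
have := key h (leqnn h); rewrite subnn D0 => ->; congr (_ ^ _).
Qed.

End JumpSets.

(** * Splitting fields *)

Lemma irreducible_factor_exists (F : fieldType) (p : {poly F}) :
  (1 < size p)%N -> exists2 r, irreducible_poly r & r %| p.
Proof.
move=> sp; pose P n := `[< exists r : {poly F}, [/\ (1 < size r)%N, r %| p & size r = n] >].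
have [|n /asboolP[r [sr rp Er]] minr] := @ex_minnP P.
  by exists (size p); apply/asboolP; exists p.
have p0 : p != 0 by rewrite -size_poly_gt0 ltnW.
exists r => //; split=> // q sq qr.
have r0 : r != 0 by rewrite -size_poly_gt0 ltnW.
rewrite -dvdp_size_eqp // eqn_leq dvdp_leq //= Er minr //; apply/asboolP.
exists q; split => //; last exact: dvdp_trans rp.
by rewrite ltn_neqAle eq_sym sq size_poly_gt0; apply: contraNneq r0 => q0; rewrite -dvd0p -q0.
Qed.

(** Roots are adjoined one at a time, and [baseFieldType] views the tower over the ground field. *)
Lemma splitting_tower_exists (F : fieldType) (p : {poly F}) : p != 0 ->
  exists (L : fieldExtType F) (zs : seq L),
    map_poly (in_alg L) p %= \prod_(z <- zs) ('X - z%:P).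
Proof.
have [n] := ubnP (size p); elim: n F p => // n IH F p ltn p0.
have [sp|sp] := leqP (size p) 1.
  exists F^o, [::].
  by rewrite big_nil -size_poly_eq1 size_map_poly eqn_leq sp size_poly_gt0.
have [r irr rp] := irreducible_factor_exists sp.
have [K _ [x rx _]] := irredp_FAdjoin irr.
have /factor_theorem[q Eq] : root (map_poly (in_alg K) p) x.
  by apply: root_dvdp rx; rewrite dvdp_map.
have q0 : q != 0.
  by apply: contraNneq p0 => q0; rewrite -(map_poly_eq0 (in_alg K)) Eq q0 mul0r.
have [|L [zs Ezs]] := IH K q _ q0.
  by move: ltn; rewrite -(size_map_poly (in_alg K)) Eq size_Mmonic ?monicXsubC // size_XsubC addn2.
exists (baseFieldType L), ((x%:A : L) :: zs).
have -> : map_poly (in_alg (baseFieldType L)) p = map_poly (in_alg L) (map_poly (in_alg K) p).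
  rewrite -map_poly_comp; apply: eq_map_poly => a; exact: (baseField_scaleE a 1).
rewrite Eq big_cons mulrC rmorphM rmorphB /= map_polyX map_polyC /=.
exact: eqp_mull.
Qed.

Lemma splitting_field_exists (F : fieldType) (p : {poly F}) : p != 0 ->
  exists L : splittingFieldType F, splittingFieldFor 1 (map_poly (in_alg L) p) {:L}.
Proof.
move=> p0; have [L [ys Ey]] := splitting_tower_exists p0.
pose E := <<1 & ys>>%AS; pose S := subvs_of E; pose toL := linfun (vsval : S -> L).
pose zs : seq S := map (vsproj E) ys.
have Ezs : map toL zs = ys.
  by rewrite -map_comp map_id_in // => y yys; rewrite /= lfunE /= vsprojK ?seqv_sub_adjoin.
have Hsplit : splittingFieldFor 1 (map_poly (in_alg S) p) {:S}.
  exists zs.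
    rewrite -(eqp_map toL) -map_poly_comp rmorph_prod.
    have -> : map_poly (toL \o in_alg S) p = map_poly (in_alg L) p.
      by apply: eq_map_poly => a; exact: rmorph_alg.
    rewrite (eq_bigr (fun z => 'X - (toL z)%:P)) => [|z _].
      by rewrite -(big_map toL xpredT (fun y => 'X - y%:P)) Ezs.
    by rewrite rmorphB /= map_polyX map_polyC.
  apply/vspaceP => u; rewrite memvf.
  have : val u \in (toL @: <<1 & zs>>)%VS by rewrite aimg_adjoin_seq aimg1 Ezs (valP u).
  by case/memv_imgP => z zV; rewrite lfunE => /val_inj ->.
have ax : splitting_field_axiom S.
  by exists (map_poly (in_alg S) p) => //; apply: alg_polyOver.
pose m := FieldExt_isSplittingField.Build F S ax.
pose L' : splittingFieldType F := HB.pack S m.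
by exists L'.
Qed.

Lemma char0_splitting_galois (F : fieldType) (L : splittingFieldType F) :
  (forall n : nat, (0 < n)%N -> n%:R != 0 :> F) -> galois 1%AS {:L}.
Proof.
move=> char0; apply/and3P; split; first exact: sub1v.
  apply/separableP => x _; apply: pcharf0_separable => q; rewrite !inE.
  apply/andP => -[/prime_gt0 q0 /eqP E]; have := char0 _ q0.
  by rewrite -(fmorph_eq0 (in_alg L)) rmorph_nat E eqxx.
exact: normalFieldf.
Qed.

(** * Construction of extensions with prescribed jumps *)

Section CombinePieces.
Variables (gT : finGroupType) (p : nat) (R : rat -> {group gT}) (h : nat).
Variables (t : 'I_h -> int) (m : 'I_h -> nat) (N : 'I_h -> {group gT}).
Hypothesis p1 : (1 < p)%N.
Hypothesis Ranti : forall u u' : rat, u <= u' -> R u' \subset R u.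
Hypothesis tinc : forall i j : 'I_h, (i < j)%N -> t i < t j.
Hypothesis m_gt0 : forall i, (0 < m i)%N.
Hypothesis indexN : forall i, #|[set: gT] : N i|%g = (p ^ m i)%N.
Hypothesis Nfull : forall i s, exists2 r, r \in N i & (r * s)%g \in R (t i)%:~R.
Hypothesis Nsub : forall i (u : rat), (t i)%:~R < u -> R u \subset N i.
Hypothesis Ncap : forall s, (forall i, s \in N i) -> s = 1%g.

Let t_lt (i j : 'I_h) : (t i < t j) = (i < j)%N.
Proof.
have [lt|gt|E] := ltngtP i j; first exact: tinc.
  by apply/negbTE; rewrite -leNgt ltW // tinc.
by rewrite (ord_inj E) ltxx.
Qed.

Let D (u : rat) : {set gT} := [set s | [forall i, ((t i)%:~R < u) ==> (s \in N i)]].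

Let RD u : R u \subset D u.
Proof.
apply/subsetP => s sR; rewrite inE; apply/forallP => i; apply/implyP => iu.
exact: (subsetP (Nsub iu)).
Qed.

(** Downward induction on [i]. Given [s] in [D], choose [r] in [N i] with [r * s] in [R]. Then [r]
    lies in [N j] for all [j <= i], so it belongs to the group at the next jump by induction, or is
    the identity at the last one; hence [s] is in [R]. *)
Let DR_jump n (i : 'I_h) : (h - n <= i)%N -> D (t i)%:~R \subset R (t i)%:~R.
Proof.
elim: n i => [|n IH] i hi; first by have := ltn_ord i; lia.
apply/subsetP => s sD.
have [r rN rsR] := Nfull i s.
have sDi (j : 'I_h) : (j < i)%N -> s \in N j.
  move: sD; rewrite inE => /forallP /(_ j); rewrite ltr_int t_lt => /implyP; apply.
have rsD : (r * s)%g \in D (t i)%:~R by apply: (subsetP (RD _)).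
have rNj (j : 'I_h) : (j <= i)%N -> r \in N j.
  rewrite leq_eqVlt => /orP[/eqP/ord_inj->//|ji].
  rewrite -(groupMr _ (sDi _ ji)).
  by move: rsD; rewrite inE => /forallP /(_ j); rewrite ltr_int t_lt ji.
suff rR : r \in R (t i)%:~R by rewrite -(groupMl _ rR).
have [lt|ge] := ltnP i.+1 h.
  have : r \in R (t (Ordinal lt))%:~R.
    apply: (subsetP (IH (Ordinal lt) _)); first by rewrite /=; lia.
    rewrite inE; apply/forallP => j; apply/implyP; rewrite ltr_int t_lt /= => ji.
    exact: rNj.
  by apply: (subsetP (Ranti _)); rewrite ler_int ltW // tinc /=.
suff -> : r = 1%g by [].
apply: Ncap => j; apply: rNj; have := ltn_ord j; lia.
Qed.

Lemma pieces_filtration u : R u = [set s | [forall i, ((t i)%:~R < u) ==> (s \in N i)]] :> {set gT}.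
Proof.
apply/eqP; rewrite eqEsubset RD /=; apply/subsetP => s sD.
have [/existsP[i0 ui0]|/existsPn nu] := boolP [exists i, u <= (t i)%:~R].
  have [i ui mini] := @arg_minnP _ i0 (fun i => u <= (t i)%:~R) (fun i => nat_of_ord i) ui0.
  apply: (subsetP (Ranti ui)); apply: (subsetP (DR_jump (n := h) _)); first by rewrite subnn.
  move: sD; rewrite !inE => /forallP H; apply/forallP => j; apply/implyP; rewrite ltr_int t_lt => ji.
  have := H j; have [/mini|] := lerP u (t j)%:~R; first by rewrite leqNgt ji.
  by [].
suff -> : s = 1%g by [].
apply: Ncap => i; move: sD; rewrite inE => /forallP /(_ i).
by rewrite ltNge nu.
Qed.

Lemma pieces_jump (s : int) :
  (forall u, s%:~R < u -> R s%:~R != R u :> {set gT}) <-> exists i, t i = s.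
Proof.
split=> [H|[i <-] u iu].
  have := H (s + 1)%:~R; rewrite ltr_int ltzD1 lexx => /(_ isT) /eqP ne.
  apply: contrapT => nex; apply: ne; rewrite !pieces_filtration; apply/setP => r; rewrite !inE.
  apply: eq_forallb => i; rewrite !ltr_int ltzD1 le_eqVlt; case: eqP => //= E.
  by case: nex; exists i.
apply/eqP => E.
have : R (t i)%:~R \subset N i by rewrite E; apply: Nsub.
move=> sub; have : #|[set: gT] : N i|%g = 1%N.
  apply/eqP; rewrite indexg_eq1; apply/subsetP => r _.
  have [r' r'N] := Nfull i r; move/(subsetP sub).
  by rewrite groupMl.
rewrite indexN => /eqP; rewrite -(expn0 p) eqn_exp2l // => /eqP E0.
by have := m_gt0 i; rewrite E0.
Qed.

(** Passing the jump means intersecting with [N i], and [N i] together with [R] generates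
    everything, so the index of the intersection in [R] is that of [N i]. *)
Lemma pieces_card i : #|R (t i)%:~R| = (p ^ m i * #|R (t i + 1)%:~R|)%N.
Proof.
have ER1 : R (t i + 1)%:~R = (R (t i)%:~R :&: N i)%g :> {set gT}.
  rewrite !pieces_filtration; apply/setP => s; rewrite !inE.
  apply/forallP/andP => [H|[/forallP H sN] j]; last first.
    rewrite ltr_int ltzD1 le_eqVlt; apply/implyP => /orP[/eqP E|lt]; last first.
      by have /implyP := H j; rewrite ltr_int; apply.
    suff -> : j = i by [].
    case: (ltngtP j i) => [lt|gt|/ord_inj//].
      by move: (tinc lt); rewrite E ltxx.
    by move: (tinc gt); rewrite E ltxx.
  split; last by have := H i; rewrite ltr_int ltzD1 lexx.
  apply/forallP => j; apply/implyP => lt; have /implyP := H j; apply.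
  by move: lt; rewrite !ltr_int ltzD1; apply: ltW.
rewrite ER1 -indexN.
have NR : (N i * R (t i)%:~R)%g = [set: gT].
  apply/setP => s; rewrite inE; have [r rN rs] := Nfull i s.
  by apply/mulsgP; exists r^-1%g (r * s)%g; rewrite ?groupV ?mulKg.
have := mul_cardG (N i) (R (t i)%:~R); rewrite NR -(Lagrange (subsetT (N i))) -mulnA => /eqP.
by rewrite eqn_pmul2l ?cardG_gt0 // setIC => /eqP.
Qed.

End CombinePieces.

(** The fixed field of [N] has the single upper jump [t], of size [m], expressed through the upper
    filtration of the whole group: at [t] it maps onto the quotient by [N], and above [t] its image
    is trivial. *)
Definition ram_piece (p : nat) (K : fieldType) (M : splittingFieldType K) (w : M -> int)
    (N : {group gal_of {:M}}) (t : int) (m : nat) :=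
  [/\ #|[set: gal_of {:M}] : N|%g = (p ^ m)%N,
      forall s, exists2 r, r \in N & (r * s)%g \in upper_ram w t%:~R
    & forall u, t%:~R < u -> upper_ram w u \subset N].

Section Pieces.
Variables (p : nat) (K : fieldType) (v : K -> int) (M : splittingFieldType K) (w : M -> int).
Variables (xs : M) (k : finFieldType) (red : M -> k) (e0 : int) (e : nat).
Hypothesis galM1 : galois 1%AS {:M}.
Hypothesis Hv : dvaluation v.
Hypothesis Hw : dvaluation w.
Notation gT := (gal_of {:M}).
Implicit Types (s t : gT).
Hypothesis wgal : forall (s : gT) x, w (s x) = w x.
Hypothesis xs_int : vge w xs 0.
Hypothesis xs_dense : zdense w xs.
Hypothesis Hr : residue_map w red.
Hypothesis rc : residue_char w p.
Hypothesis abelG : (p.-abelem [set: gT])%g.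
Hypothesis e00 : 0 < e0.
Hypothesis walg : forall c : K, c != 0 -> w c%:A = e0 * v c.
Hypothesis char0 : forall n : nat, (0 < n)%N -> n%:R != 0 :> K.
Hypothesis ve : v p%:R = e%:Z.

Let pp : prime p. Proof. exact: residue_char_prime rc. Qed.
Local Notation I := (inertia_group Hw wgal).
Local Notation idx := (ramidx w xs).

Local Notation Phi := (phisum w xs [set: gT]).

Let phi_mono a b : (a <= b)%N -> (Phi a <= Phi b)%N.
Proof.
by move=> ab; apply: leq_sum => r _; rewrite leq_min geq_minl /= (leq_trans (geq_minr _ _)).
Qed.

Lemma upper_ram_group_set u : group_set (upper_ram w u).
Proof.
have mem := mem_upper_ram galM1 Hw wgal xs_int xs_dense.
apply/group_setP; split; first by rewrite mem eqxx.
move=> s t; rewrite !mem => /orP[/eqP->|hs]; first by rewrite mul1g.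
case/orP => [/eqP->|ht]; first by rewrite mulg1 hs orbT.
apply/orP; right.
have h : (Phi (minn (idx s) (idx t)) <= Phi (idx (s * t)%g))%N.
  by apply: phi_mono; apply: (ramidxM galM1 Hw wgal xs_int xs_dense).
apply: (le_trans _ (_ : (Phi (minn (idx s) (idx t)))%:R <= _)); last by rewrite ler_nat.
by rewrite /minn; case: ifP.
Qed.

Lemma upper_ram_anti u u' : u <= u' -> upper_ram w u' \subset upper_ram w u.
Proof.
move=> uu'; apply/subsetP => s; rewrite !(mem_upper_ram galM1 Hw wgal xs_int xs_dense).
case/orP => [->//|h]; apply/orP; right; apply: le_trans h.
by rewrite ler_wpM2r ?ler0n // lerD2r.
Qed.

Lemma unramified_piece (N : {group gT}) m :
  #|[set: gT] : N|%g = (p ^ m)%N -> I \subset N -> ram_piece p w N (-1) m.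
Proof.
move=> iN IN; split => //.
  move=> s; exists 1%g; rewrite // mul1g (mem_upper_ram galM1 Hw wgal xs_int xs_dense).
  by rewrite addNr mul0r ler0n orbT.
move=> u u1; apply/subsetP => s.
rewrite (mem_upper_ram galM1 Hw wgal xs_int xs_dense) => /orP[/eqP->//|h].
apply: (subsetP IN).
have HI : s \in ramsub w xs 1 -> s \in I by rewrite -(inertia_ramsub galM1 Hw wgal xs_int xs_dense).
apply: HI; rewrite inE lt0n; apply/negP => /eqP E.
move: h; rewrite E /phisum big1 => [|r _]; last by rewrite minn0.
rewrite leNgt pmulr_lgt0 ?ltr0n; first by rewrite -ltrBlDr sub0r u1.
by apply/card_gt0P; exists 1%g; rewrite (mem_lower_ram galM1 Hw wgal xs_int xs_dense) eqxx.
Qed.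

(** The value of [lam] in terms of [v] is [c / p^m] with [c] prime to [p], which forces ramification
    index at least [p^m]; as the degree is at most [p^m], the fixed field of [N] is totally ramified
    of that degree. There [lam] has value [c], so the displacement of [lam] reveals the jump. *)
Lemma totram_piece (N : {group gT}) (lam : M) (m t : nat) (c : int) :
  lam != 0 -> (forall s, s \in N -> s lam = lam) ->
  (0 < m)%N -> (#|[set: gT] : N|%g <= p ^ m)%N ->
  (p ^ m)%N%:Z * w lam = e0 * c -> coprime `|c| p ->
  (forall s, s \notin N -> (p ^ m)%N%:Z * (w (s lam - lam) - w lam) = e0 * t%:Z) ->
  ram_piece p w N t%:Z m.
Proof.
move=> lam0 lamN m0 iN Ec cp Et.
have n0_pos : (0 < #|N :&: I|)%N := cardG_gt0 (N :&: I)%G.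
set n0 := #|N :&: I| in n0_pos *.
have Ee := e0_card galM1 Hv Hw wgal xs_int Hr rc abelG e00 walg.
have /dvdzP[l El] : (n0%:Z %| w lam)%Z by apply: (fixed_val_dvd galM1 Hw wgal xs_int Hr rc abelG).
have [a Ea] : exists a, #|I| = (p ^ a * n0)%N.
  have [b Eb] := card_pnat abelG I.
  have : (#|I : N :&: I|%g %| p ^ b)%N by rewrite -Eb dvdn_indexg.
  case/(dvdn_pfactor _ _ pp) => a _ Ea; exists a.
  by rewrite -Ea mulnC; apply/esym/Lagrange/subsetIr.
have n0Z : (n0%:Z != 0) by rewrite eqz_nat -lt0n.
have E1 : (p ^ m)%N%:Z * l = (p ^ a)%N%:Z * c.
  apply: (mulfI n0Z); move: Ec; rewrite Ee Ea El PoszM => E.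
  by rewrite mulrCA [n0%:Z * l]mulrC E; ring.
have ma : (m <= a)%N.
  have : (p ^ m %| p ^ a * `|c|)%N.
    by have := congr1 absz E1; rewrite !abszM /= => <-; apply: dvdn_mulr.
  rewrite Gauss_dvdl; last by rewrite coprime_sym coprimeXr.
  by rewrite dvdn_Pexp2l ?prime_gt1.
have cNI : (#|(N * I)%g| = #|N| * p ^ a)%N.
  have /eqP := mul_cardG N I; rewrite Ea [(_ * n0)%N]mulnC [X in X == _]mulnCA -/n0.
  by rewrite [X in _ == X]mulnC eqn_pmul2l // => /eqP.
have le1 : (p ^ a <= #|[set: gT] : N|%g)%N.
  rewrite -(leq_pmul2l (cardG_gt0 N)) -cNI Lagrange ?subsetT //.
  exact/subset_leq_card/subsetT.
have am : a = m.
  apply/eqP; rewrite eqn_leq ma andbT -(leq_exp2l _ _ (prime_gt1 pp)).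
  exact: leq_trans iN.
rewrite {}am in Ea E1 cNI le1 {ma}.
have iN' : #|[set: gT] : N|%g = (p ^ m)%N by apply/eqP; rewrite eqn_leq iN le1.
have NI : (N * I)%g = [set: gT].
  by apply/eqP; rewrite eqEcard subsetT -(Lagrange (subsetT N)) iN' cNI /=.
have totram s : exists2 r, r \in N & inertial w (r * s)%g.
  have : s \in (N * I)%g by rewrite NI inE.
  case/mulsgP => r x rN /mem_inertia hx ->; exists r^-1%g; first by rewrite groupV.
  by rewrite mulKg.
have pm0 : (p ^ m)%N%:Z != 0 by rewrite eqz_nat -lt0n expn_gt0 prime_gt0.
have lc : l = c by apply: (mulfI pm0).
rewrite lc in El.
have npc : ~~ (p %| `|c|)%N by rewrite -prime_coprime // coprime_sym.
have sum_t s : s \notin N -> (\sum_(r in N) idx (r * s)%g = n0 * (1 + t))%N.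
  move=> sN; have [tau tau0 Etau] := onejump_exists galM1 Hw wgal xs_int xs_dense Hr rc abelG totram sN.
  have Elam : w lam = n0%:Z * c by rewrite El mulrC.
  have [d0 wd] := onejump_val_shift galM1 Hv xs_int xs_dense Hr rc abelG e00 walg char0 ve totram sN tau0 Etau lam0 lamN Elam npc.
  rewrite Etau; congr (_ * _)%N; congr (1 + _)%N.
  have := Et s sN; rewrite wd Elam Ee Ea.
  have -> : n0%:Z * (c + tau%:Z) - n0%:Z * c = n0%:Z * tau%:Z by ring.
  rewrite PoszM -mulrA => /(mulfI pm0)/(mulfI n0Z) [] //.
(* All nontrivial cosets have the same sum, hence by injectivity of [phisum] the same largest index
   [cc]; its Herbrand value is [t]. *)
have [s1 s1N] : exists s1, s1 \notin N.
  have : ~~ ([set: gT] \subset N).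
    by rewrite -indexg_eq1 iN' -(expn0 p) eqn_exp2l ?prime_gt1 // -lt0n.
  by case/subsetPn => s _ sN; exists s.
have cmax s : s \notin N -> exists2 r, r \in N & phisum w xs N (idx (r * s)%g) = (n0 * (1 + t))%N /\
    forall r', r' \in N -> (idx (r' * s)%g <= idx (r * s)%g)%N.
  move=> sN; have [r rN rmax] := coset_max_exists w xs N s.
  exists r => //; split.
    by rewrite -(coset_sum_max galM1 Hw wgal xs_int xs_dense rmax) (coset_sum_mulg _ _ _ rN) sum_t.
  by move=> r' r'N; have := rmax (r' * r^-1)%g; rewrite groupM ?groupV // !mulgA mulgKV; apply.
have [r1 r1N [E1r max1]] := cmax s1 s1N.
set cc := idx (r1 * s1)%g in E1r max1.
have ceq s r : s \notin N -> phisum w xs N (idx (r * s)%g) = (n0 * (1 + t))%N -> idx (r * s)%g = cc.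
  move=> sN E; apply: (phisum_inj galM1 xs_int (N := N)); try exact: ramidx_le.
  by rewrite E E1r.
have cle s : s \notin N -> (idx s <= cc)%N.
  move=> sN; have [r rN [E mx]] := cmax s sN.
  by have := mx 1%g (group1 N); rewrite mul1g (ceq _ _ sN E).
have PhiE : Phi cc = (#|I| * (1 + t))%N.
  rewrite (phisum_cosets (N := N)) //; last first.
  - by move=> s sN; rewrite E1r sum_t.
  - exact: ramidx_le.
  by rewrite E1r iN' Ea mulnA.
have memc u : ((u + 1) * #|lower_ram w 0|%:R <= (Phi cc)%:R) = (u <= t%:Z%:~R).
  rewrite PhiE -(inertia_lower w) natrM mulrC ler_pM2l ?ltr0n ?cardG_gt0 //.
  by rewrite natrD addrC lerD2l.
split => //.
  move=> s; have [sN|sN] := boolP (s \in N).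
    exists s^-1%g; rewrite ?groupV // mulVg (mem_upper_ram galM1 Hw wgal xs_int xs_dense).
    by rewrite eqxx.
  have [r rN [E _]] := cmax s sN; exists r => //.
  by rewrite (mem_upper_ram galM1 Hw wgal xs_int xs_dense) (ceq _ _ sN E) memc lexx orbT.
move=> u ut; apply/subsetP => s; rewrite (mem_upper_ram galM1 Hw wgal xs_int xs_dense).
case/orP => [/eqP->//|h]; apply: contraT => sN.
have : (u + 1) * #|lower_ram w 0|%:R <= (Phi cc)%:R.
  by apply: (le_trans h); rewrite ler_nat; apply: phi_mono; apply: cle.
by rewrite memc leNgt ut.
Qed.

End Pieces.

(** * Additive polynomials *)

Definition additive_eval (F : nzRingType) (p m : nat) (c : nat -> F) (x : F) :=
  \sum_(j < m.+1) c j * x ^+ (p ^ j).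

Lemma additive_root_bound (k : fieldType) p m (c : nat -> k) (rs : seq k) : (1 < p)%N ->
  c m != 0 -> uniq rs -> (forall a, a \in rs -> additive_eval p m c a = 0) ->
  (size rs <= p ^ m)%N.
Proof.
move=> p1 cm urs hrs.
pose P : {poly k} := \sum_(j < m.+1) c j *: 'X^(p ^ j).
have sP : size P = (p ^ m).+1.
  rewrite /P big_ord_recr /= addrC size_polyDl ?size_scale ?size_polyXn //.
  rewrite ltnS; apply: (leq_trans (size_sum _ _ _)); apply/bigmax_leqP => j _.
  apply: (leq_trans (size_scale_leq _ _)); rewrite size_polyXn.
  by rewrite ltn_exp2l.
have P0 : P != 0 by rewrite -size_poly_eq0 sP.
rewrite -ltnS -sP; apply: max_poly_roots => //.
apply/allP => a /hrs E; rewrite /root -E /additive_eval horner_sum; apply/eqP.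
by apply: eq_bigr => j _; rewrite hornerZ hornerXn.
Qed.

Section FiniteFieldAdditive.
Variables (k : finFieldType) (p f : nat).
Hypothesis pk : p \in [pchar k].
Hypothesis Ek : #|k| = (p ^ f)%N.
Let pp : prime p. Proof. exact: pcharf_prime pk. Qed.

Lemma additive_evalD m (c : nat -> k) x y :
  additive_eval p m c (x + y) = additive_eval p m c x + additive_eval p m c y.
Proof.
rewrite /additive_eval -big_split /=; apply: eq_bigr => j _; rewrite -mulrDr; congr (_ * _).
elim: (nat_of_ord j) => [|n IH]; first by rewrite expn0 !expr1.
by rewrite expnSr !exprM IH -!(pFrobenius_autE pk) rmorphD.
Qed.

(** The roots form a space over the prime field, enlarged by one dimension at each step: if
    [L b != 0], then [L^p - (L b)^(p-1) L] is additive and vanishes on the multiples of [b] added to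
    the roots of [L]. *)
Lemma additive_poly_exists m : (m <= f)%N -> exists (c : nat -> k) (A : {set k}),
  [/\ c m = 1, c 0%N != 0, #|A| = (p ^ m)%N & forall a, a \in A -> additive_eval p m c a = 0].
Proof.
elim: m => [|m IH] mf.
  exists (fun=> 1), [set 0]; split; rewrite ?oner_neq0 ?cards1 ?expn0 //.
  by move=> a; rewrite inE => /eqP ->; rewrite /additive_eval big_ord1 mul1r expn0 expr1.
have [c [A [cm c0 cA hA]]] := IH (ltnW mf).
pose L := additive_eval p m c.
have [b Lb] : exists b, L b != 0.
  apply: contrapT => H.
  have : (size (enum k) <= p ^ m)%N.
    apply: (additive_root_bound (c := c) (prime_gt1 pp)); rewrite ?cm ?oner_neq0 ?enum_uniq //.
    by move=> a _; apply/eqP; apply/negPn/negP => h; apply: H; exists a.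
  by rewrite -cardE Ek leqNgt ltn_exp2l ?prime_gt1 // mf.
set be := L b in Lb.
pose c' j := (if j is j'.+1 then c j' ^+ p else 0) - be ^+ p.-1 * (if (j <= m)%N then c j else 0).
have L'E x : additive_eval p m.+1 c' x = L x ^+ p - be ^+ p.-1 * L x.
  rewrite /additive_eval /c'; under eq_bigr => j _ do rewrite mulrBl.
  rewrite sumrB; congr (_ - _).
    rewrite big_ord_recl mul0r add0r -(pFrobenius_autE pk) rmorph_sum; apply: eq_bigr => j _ /=.
    by rewrite rmorphM rmorphXn /= !pFrobenius_autE /bump /= add1n expnS exprM.
  rewrite big_ord_recr /= ltnn mulr0 mul0r addr0 mulr_sumr; apply: eq_bigr => j _.
  by rewrite -ltnS ltn_ord mulrA.
pose g (u : k * 'I_p) := u.1 + b *+ u.2.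
have Lg u : u.1 \in A -> L (g u) = be *+ u.2.
  move=> uA; rewrite /g /L additive_evalD hA // add0r.
  elim: (nat_of_ord u.2) => [|n IHn].
    rewrite !mulr0n; apply: (addIr (additive_eval p m c 0)).
    by rewrite -additive_evalD !add0r.
  by rewrite !mulrS additive_evalD IHn.
exists c', (g @: setX A [set: 'I_p]); split.
- by rewrite /c' ltnn mulr0 subr0 cm expr1n.
- by rewrite /c' /= sub0r oppr_eq0 mulf_neq0 // expf_neq0.
- rewrite card_in_imset; first by rewrite cardsX cardsT card_ord cA expnSr.
  move=> u v; rewrite !inE !andbT => uA vA E.
  have E2 : u.2 = v.2.
    apply/ord_inj; have := congr1 L E; rewrite !Lg //.
    rewrite -(mulr_natr be u.2) -(mulr_natr be v.2) => /(mulfI Lb) E3.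
    have key (x y : nat) : (x <= y < p)%N -> x%:R = y%:R :> k -> x = y.
      move=> /andP[xy yp] Exy; apply/eqP; rewrite eqn_leq xy /= -subn_eq0.
      have : (p %| y - x)%N by rewrite (dvdn_pcharf pk) natrB // Exy subrr.
      by apply: contraLR => nm; rewrite gtnNdvd ?lt0n //; lia.
    have [le|/ltnW le] := leqP u.2 v.2; first by apply: key => //; rewrite le ltn_ord.
    by apply/esym/key => //; rewrite le ltn_ord.
  case: u v uA vA E E2 {Lg} => u1 u2 [v1 v2] /= _ _ E E2.
  by subst v2; have /= -> := addIr _ E.
- move=> a /imsetP[u]; rewrite !inE andbT => uA ->; rewrite L'E Lg //.
  have Ei : be ^+ p.-1 * be = be ^+ p by rewrite -exprSr prednK // prime_gt0.
  rewrite -(mulr_natr be) exprMn -[u.2%:R ^+ p](pFrobenius_autE pk) pFrobenius_aut_nat.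
  by rewrite mulrA Ei subrr.
Qed.

End FiniteFieldAdditive.

Lemma additive_eval_int (F : fieldType) (w : F -> int) p m (c : nat -> F) x : dvaluation w ->
  (forall j, vge w (c j) 0) -> vge w x 0 -> vge w (additive_eval p m c x) 0.
Proof.
by move=> Hw hc hx; apply: vge_sum => // j _; apply: vgeMl => //; apply: vgeX0.
Qed.

Lemma red_additive_eval (F : fieldType) (w : F -> int) (k : finFieldType) (red : F -> k)
    p m (c : nat -> F) x : dvaluation w -> residue_map w red ->
  (forall j, vge w (c j) 0) -> vge w x 0 ->
  red (additive_eval p m c x) = additive_eval p m (fun j => red (c j)) (red x).
Proof.
move=> Hw Hr hc hx; rewrite (red_sum Hw Hr) => [|j _]; last by apply: vgeMl => //; apply: vgeX0.
by apply: eq_bigr => j _; rewrite (redM Hr) ?vgeX0 // (redX Hw Hr).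
Qed.

Section AdditiveLift.
Variables (K : fieldType) (v : K -> int) (p e f : nat).
Hypothesis pp : prime p.
Hypothesis pf : padic_field p v e f.
Let Hv := pf_val pf.

Lemma padic_residue_char : residue_char v p.
Proof.
split => //; rewrite vgeE ?(pf_char0 pf) ?prime_gt0 // (pf_e pf).
by have := pf_e_pos pf.
Qed.

Lemma padic_residue_field : exists (k : finFieldType) (red : K -> k),
  residue_map v red /\ #|k| = (p ^ f)%N.
Proof.
have [s [ss alls dist cov]] := pf_f pf.
have [k [red Hr]] := residue_field Hv cov.
exists k, red; split => //.
have hs i : (i < size s)%N -> vge v (nth 0 s i) 0 by move=> h; apply: (all_nthP 0 alls).
rewrite -ss -[RHS]card_ord -(card_imset (f := fun i : 'I_(size s) => red (nth 0 s i))).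
  apply/esym/eq_card => a; rewrite !inE; apply/imsetP.
  have [x hx <-] := red_surj Hr a; have [y ys hxy] := cov x hx.
  have iy : (index y s < size s)%N by rewrite index_mem.
  exists (Ordinal iy); rewrite //= nth_index //; apply/eqP.
  by rewrite (red_eq Hv Hr) //; apply: (allP alls).
move=> i j /eqP; rewrite (red_eq Hv Hr) ?hs // => h.
apply/ord_inj; apply: contrapT => ne.
by have := dist i j (ltn_ord i) (ltn_ord j) ne; rewrite h.
Qed.

Lemma additive_lift_exists m : (m <= f)%N -> exists (c : nat -> K) (A : seq K),
  [/\ c m = 1, forall j, vge v (c j) 0, ~~ vge v (c 0%N) 1, size A = (p ^ m)%N &
   [/\ forall a, a \in A -> vge v a 0 /\ vge v (additive_eval p m c a) 1,
      forall i j, (i < size A)%N -> (j < size A)%N -> vge v (nth 0 A i - nth 0 A j) 1 -> i = j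
    & (0 < m)%N -> exists2 al, vge v al 0 &
       forall x, vge v x 0 -> ~~ vge v (additive_eval p m c x - al) 1]].
Proof.
move=> mf; have [k [red [Hr Ek]]] := padic_residue_field.
have pk := residue_pchar Hv Hr padic_residue_char.
have [c [A [cm c0 cA hA]]] := additive_poly_exists pk Ek mf.
have /choice[lift Hl] : forall a : k, exists x, vge v x 0 /\ red x = a.
  by move=> a; have [x] := red_surj Hr a; exists x.
pose c' j := if j == m then 1 else lift (c j).
have hc' j : vge v (c' j) 0 by rewrite /c'; case: ifP => _; [apply: vge_1|case: (Hl (c j))].
have rc' j : red (c' j) = c j.
  by rewrite /c'; case: eqP => [->|_]; [rewrite (red1 Hr) cm|case: (Hl (c j))].
have ev_int x : vge v x 0 -> vge v (additive_eval p m c' x) 0 by apply: additive_eval_int.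
have red_ev x : vge v x 0 -> red (additive_eval p m c' x) = additive_eval p m c (red x).
  by move=> hx; rewrite (red_additive_eval _ _ Hv Hr) //; apply: eq_bigr => j _; rewrite rc'.
have rl a : red (lift a) = a by case: (Hl a).
have il a : vge v (lift a) 0 by case: (Hl a).
exists c', (map lift (enum A)); split => //.
- by rewrite /c' eqxx.
- by rewrite -(red_eq0 Hr) // rc'.
- by rewrite size_map -cardE.
split.
- move=> _ /mapP[a aA ->]; rewrite mem_enum in aA; split => //.
  by rewrite -(red_eq0 Hr) ?ev_int // red_ev // rl hA.
- move=> i j; rewrite size_map => hi hj; rewrite -(red_eq Hv Hr).
    by rewrite !(nth_map 0) // !rl nth_uniq ?enum_uniq // => /eqP.
  1,2: by rewrite (nth_map 0).
- move=> m0.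
  have [a na] : exists a, forall x, additive_eval p m c x != a.
    apply: contrapT => H.
    have surj a : exists x, additive_eval p m c x = a.
      apply: contrapT => h; apply: H; exists a => x; apply/eqP => E; apply: h; by exists x.
    (* On a finite set surjective implies injective, which fails since [A] has more than one root; a
       value that is missed yields [al]. *)
    have inj : injective (additive_eval p m c).
      have : #|[set additive_eval p m c x | x : k]| = #|k|.
        by apply: eq_card => a; rewrite inE; have [x Ex] := surj a; apply/imsetP; exists x.
      by move/eqP/imset_injP => h x y; apply: h; rewrite inE.
    have : (#|A| <= 1)%N.
      apply/card_le1_eqP => x y xA yA; apply: inj; rewrite !hA //.
    by rewrite cA leqNgt -{1}(expn0 p) ltn_exp2l ?prime_gt1 // m0.
  exists (lift a) => // x hx; rewrite -(red_eq Hv Hr) ?ev_int // red_ev // rl.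
  exact: na.
Qed.

End AdditiveLift.

Section AdditiveRoots.
Variables (F : fieldType) (w : F -> int) (p m : nat) (c : nat -> F) (lam : F).
Hypothesis Hw : dvaluation w.
Hypothesis rc : residue_char w p.
Hypothesis c_int : forall j, vge w (c j) 0.
Hypothesis c_monic : c m = 1.
Hypothesis c_unit : ~~ vge w (c 0%N) 1.
Hypothesis lamH : forall j i, (j < m)%N -> (0 < i < p)%N -> vge w (p%:R * (lam ^+ (p ^ j)) ^+ i) 1.
Let pp : prime p. Proof. exact: residue_char_prime rc. Qed.

Let err del j := (lam + del) ^+ (p ^ j) - lam ^+ (p ^ j) - del ^+ (p ^ j).

(** The defect of additivity of the power [p ^ j]. In passing from [j] to [j + 1], mixed terms gain
    from the factor [p * x ^ i], by [lamH]. The growth condition on [b] fits three uses: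
    [b j = D p^j] with [D < 0], [b = 0], and [b] constant positive. *)
Let err_bound del (b : nat -> int) :
  (forall j i, (0 < i <= p)%N -> b j.+1 <= b j * i%:Z) ->
  (forall j, vge w (del ^+ (p ^ j)) (b j)) ->
  forall j, (j <= m)%N -> vge w (err del j) (b j + 1).
Proof.
move=> Hb Hd; elim=> [|j IH] jm.
  by rewrite /err expn0 !expr1 addrAC addrK subrr vge0.
have {IH} IH := IH (ltnW jm).
have Ep : (lam + del) ^+ (p ^ j) = lam ^+ (p ^ j) + (del ^+ (p ^ j) + err del j).
  by rewrite /err; ring.
rewrite /err expnSr !exprM Ep; have p1 : p = p.-1.+1 by rewrite prednK ?prime_gt0.
set x := lam ^+ _; set y := del ^+ _; set z := err del j.
have hz : vge w z (b j) by apply: (vgeW _ IH); lia.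
have hy : vge w y (b j) := Hd j.
have hyz : vge w (y + z) (b j) by apply: vgeD.
have -> : (x + (y + z)) ^+ p - x ^+ p - y ^+ p =
    ((x + (y + z)) ^+ p - x ^+ p - (y + z) ^+ p) + ((y + z) ^+ p - y ^+ p) by ring.
apply: vgeD => //.
  have split_ends (g : nat -> F) : \sum_(i < p.+1) g i = g 0%N + \sum_(i < p.-1) g i.+1 + g p.
    by rewrite p1 big_ord_recl big_ord_recr /= addrA.
  rewrite exprDn (split_ends (fun i => x ^+ (p - i) * (y + z) ^+ i *+ 'C(p, i))).
  rewrite subn0 subnn !expr0 bin0 binn !mulr1n mulr1 mul1r.
  rewrite addrAC addrK [x ^+ p + _]addrC addrK.
  apply: vge_sum => // i _; have ip : (i.+1 < p)%N by have := ltn_ord i; lia.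
  have /dvdnP[q Eq] : (p %| 'C(p, i.+1))%N by apply: prime_dvd_bin.
  rewrite Eq -mulr_natr natrM.
  have -> : x ^+ (p - i.+1) * (y + z) ^+ i.+1 * (q%:R * p%:R) =
     q%:R * ((p%:R * x ^+ (p - i.+1)) * (y + z) ^+ i.+1) by ring.
  apply: vgeMl => //; first exact: vge_nat.
  apply: (@vgeW _ _ _ (1 + b j * i.+1%:Z)).
    by have := Hb j i.+1; rewrite /= (ltnW ip) => /(_ isT); lia.
  apply: vgeM => //; last exact: vgeX.
  by apply: lamH => //; lia.
rewrite exprDn big_ord_recl /= subn0 expr0 mulr1 bin0 mulr1n addrAC subrr add0r.
apply: vge_sum => // i _; apply: vgeMn => //; rewrite /bump /= add1n.
have ip : (i.+1 <= p)%N by apply: ltn_ord.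
apply: (@vgeW _ _ _ (b j * (p - i.+1)%N%:Z + (b j + 1) * i.+1%:Z)).
  have := Hb j p; rewrite leqnn prime_gt0 // => /(_ isT).
  by rewrite -subzn // mulrBr mulrDl mul1r addrA subrK; clear; lia.
by apply: vgeM => //; apply: vgeX.
Qed.

(** Subtracting the two equations leaves the additive polynomial at [del] plus small errors. A pole
    of [del] would make the leading term dominate; a nonzero [del] in the maximal ideal would make
    the linear term, with unit coefficient, dominate. *)
Lemma additive_root_diff del :
  additive_eval p m c (lam + del) = additive_eval p m c lam ->
  [/\ vge w del 0, vge w (additive_eval p m c del) 1 & vge w del 1 -> del = 0].
Proof.
move=> HP.
have Esum : \sum_(j < m.+1) c j * (del ^+ (p ^ j) + err del j) = 0.
  move/eqP: HP; rewrite -subr_eq0 /additive_eval -sumrB => /eqP {2}<-.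
  by apply: eq_bigr => j _; rewrite -mulrBr; congr (_ * _); rewrite /err; ring.
have p_gt1 := prime_gt1 pp; have pj j : (0 < p ^ j)%N by rewrite expn_gt0 prime_gt0.
have h0 : vge w del 0.
  apply: contrapT => /negP; have [->|d0] := eqVneq del 0; first by rewrite vge0.
  rewrite vgeE // -ltNge => dneg; set D := w del in dneg.
  have hE := @err_bound del (fun j => D * (p ^ j)%N%:Z) _ (fun j => vgeX Hw _ _).
  have {}hE j : (j <= m)%N -> vge w (err del j) (D * (p ^ j)%N%:Z + 1).
    apply: hE; last by rewrite vgeE.
    by move=> j' i /andP[_ ip]; rewrite expnSr PoszM mulrA; apply: ler_wnM2l; rewrite ?lez_nat //; move: dneg; clear; nia.
  have x0 : del ^+ (p ^ m) != 0 by rewrite expf_neq0.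
  have [ne _] : (del ^+ (p ^ m) + \sum_(j < m) c j * (del ^+ (p ^ j) + err del j) + err del m) != 0
      /\ True.
    split => //; rewrite -addrA.
    apply: (proj1 (val_addl Hw x0 _)); rewrite valX // -/D.
    apply: vgeD => //; last exact: hE.
    apply: vge_sum => // j _; apply: vgeMl => //.
    apply: (@vgeW _ _ _ (D * (p ^ j)%N%:Z)).
      have : (p ^ j < p ^ m)%N by rewrite ltn_exp2l.
      by move: dneg; clear; nia.
    apply: vgeD => //; first by apply: vgeX => //; rewrite vgeE.
    by apply: (vgeW _ (hE _ (ltnW (ltn_ord j)))); clear; lia.
  by move/eqP: ne; apply; rewrite -[RHS]Esum big_ord_recr /= c_monic; ring.
split => //.
- have hE : forall j, (j <= m)%N -> vge w (err del j) 1.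
    by apply: (err_bound (b := fun=> 0)) => [//|j]; apply: vgeX0.
  have -> : additive_eval p m c del = - \sum_(j < m.+1) c j * err del j.
    apply/eqP; rewrite -addr_eq0 -[X in _ == X]Esum /additive_eval -big_split /=; apply/eqP.
    by apply: eq_bigr => j _; rewrite -mulrDr.
  rewrite vgeN //; apply: vge_sum => // j _; apply: vgeMl => //; apply: hE.
  by rewrite -ltnS.
- move=> h1; apply/eqP; apply/negPn/negP => d0; set D := w del.
  have D1 : 1 <= D by rewrite vgeE in h1.
  have hE : forall j, (j <= m)%N -> vge w (err del j) (D + 1).
    apply: (err_bound (b := fun=> D)) => [j i|j].
      by move: D1; clear; nia.
    apply: (@vgeW _ _ _ (D * (p ^ j)%N%:Z)); last by apply: vgeX => //; rewrite vgeE.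
    by move: D1 (pj j); clear; nia.
  have [c0 wc0] := val_unit (c_int 0%N) c_unit.
  have x0 : c 0%N * del != 0 by rewrite mulf_neq0.
  have ne : c 0%N * del + (c 0%N * err del 0 +
       \sum_(j < m) c j.+1 * (del ^+ (p ^ j.+1) + err del j.+1)) != 0.
    apply: (proj1 (val_addl Hw x0 _)); rewrite (dv_mul Hw) // wc0 add0r -/D.
    apply: vgeD => //; first by apply: vgeMl => //; apply: hE.
    apply: vge_sum => // j _; apply: vgeMl => //; apply: vgeD => //; last exact: hE.
    apply: (@vgeW _ _ _ (D * (p ^ j.+1)%N%:Z)); last by apply: vgeX => //; rewrite vgeE.
    have : (1 < p ^ j.+1)%N by rewrite -{1}(expn0 p) ltn_exp2l.
    by move: D1; clear; nia.
  move/eqP: ne; apply; rewrite -[RHS]Esum big_ord_recl /= expn0 expr1 /bump /=.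
  under [in RHS]eq_bigr => j _ do rewrite add1n.
  by rewrite [c 0%N * (del + _)]mulrDr addrA.
Qed.

End AdditiveRoots.

Section Fixer.
Variables (K : fieldType) (M : splittingFieldType K) (lam : M).
Notation gT := (gal_of {:M}).

Definition fixer : {set gT} := [set s : gT | s lam == lam].

Lemma fixer_group_set : group_set fixer.
Proof.
apply/group_setP; split=> [|s t]; first by rewrite inE gal_id.
by rewrite !inE galMx => /eqP -> /eqP ->.
Qed.

Canonical fixer_group := Group fixer_group_set.

Lemma mem_fixer (s : gT) : (s \in fixer_group) = (s lam == lam). Proof. by rewrite inE. Qed.

Lemma fixerM (s t : gT) : (s lam = t lam) -> (s * t^-1)%g \in fixer_group.
Proof. by move=> E; rewrite mem_fixer galMx E galVK. Qed.

End Fixer.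

Section AdditivePiece.
Variables (p : nat) (K : fieldType) (v : K -> int) (M : splittingFieldType K) (w : M -> int).
Variables (xs : M) (k : finFieldType) (red : M -> k) (e0 : int) (e : nat).
Hypothesis galM1 : galois 1%AS {:M}.
Hypothesis Hv : dvaluation v.
Hypothesis Hw : dvaluation w.
Notation gT := (gal_of {:M}).
Implicit Types (s t : gT).
Hypothesis wgal : forall (s : gT) x, w (s x) = w x.
Hypothesis xs_int : vge w xs 0.
Hypothesis xs_dense : zdense w xs.
Hypothesis Hr : residue_map w red.
Hypothesis rc : residue_char w p.
Hypothesis abelG : (p.-abelem [set: gT])%g.
Hypothesis e00 : 0 < e0.
Hypothesis walg : forall c : K, c != 0 -> w c%:A = e0 * v c.
Hypothesis char0 : forall n : nat, (0 < n)%N -> n%:R != 0 :> K.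
Hypothesis ve : v p%:R = e%:Z.

Let vgal (s : gT) x n : vge w (s x) n = vge w x n.
Proof. exact: vge_gal. Qed.
Let pp : prime p. Proof. exact: residue_char_prime rc. Qed.

Variables (m : nat) (c : nat -> K) (A : seq K) (al : K).
Hypothesis c_int : forall j, vge v (c j) 0.
Hypothesis c_monic : c m = 1.
Hypothesis c_unit : ~~ vge v (c 0%N) 1.
Hypothesis size_A : size A = (p ^ m)%N.
Hypothesis A_root : forall a, a \in A -> vge v a 0 /\ vge v (additive_eval p m c a) 1.
Hypothesis A_dist : forall i j, (i < size A)%N -> (j < size A)%N ->
  vge v (nth 0 A i - nth 0 A j) 1 -> i = j.

Let C j : M := (c j)%:A.
Let is_root (mu : M) := additive_eval p m C mu = al%:A.

Let C_int j : vge w (C j) 0. Proof. by rewrite /C (vge_alg0 e00 walg). Qed.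
Let C_monic : C m = 1. Proof. by rewrite /C c_monic scale1r. Qed.
Let C_unit : ~~ vge w (C 0%N) 1. Proof. by rewrite /C (vge_alg1 e00 walg). Qed.
Let eval_alg x : additive_eval p m C x%:A = (additive_eval p m c x)%:A.
Proof.
rewrite -[RHS]/(in_alg M _) rmorph_sum; apply: eq_bigr => j _ /=.
by rewrite -[RHS]/(in_alg M _) rmorphM rmorphXn.
Qed.

Let gal_root (s : gT) mu : is_root mu -> is_root (s mu).
Proof.
rewrite /is_root => E; rewrite -(gal_alg s al) -E /additive_eval rmorph_sum /=; apply: eq_bigr => j _ /=.
by rewrite rmorphM rmorphXn /= gal_alg.
Qed.

Lemma additive_root_pole mu : is_root mu -> ~~ vge w mu 0 ->
  al != 0 /\ (p ^ m)%N%:Z * w mu = e0 * v al.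
Proof.
move=> rmu nmu; have mu0 : mu != 0 by apply: contraNneq nmu => ->; rewrite vge0.
rewrite vgeE // -ltNge in nmu; set D := w mu in nmu.
have x0 : mu ^+ (p ^ m) != 0 by rewrite expf_neq0.
have h : vge w (\sum_(j < m) C j * mu ^+ (p ^ j)) (w (mu ^+ (p ^ m)) + 1).
  rewrite valX // -/D; apply: vge_sum => // j _; apply: vgeMl => //.
  rewrite vgeE ?expf_neq0 // valX // -/D.
  have : (p ^ j < p ^ m)%N by rewrite ltn_exp2l // prime_gt1.
  by move: nmu; clear; nia.
have [ne E] := val_addl Hw x0 h.
have Er : mu ^+ (p ^ m) + \sum_(j < m) C j * mu ^+ (p ^ j) = al%:A.
  by rewrite -rmu /additive_eval big_ord_recr /= C_monic mul1r addrC.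
rewrite Er in ne E; rewrite alg_neq0 in ne; split => //.
by rewrite -walg // E valX // mulrC.
Qed.

Hypothesis al_bound : al = 0 \/ (p%:Z - 1) * - v al < p%:Z * e%:Z.

Let wp : p%:R != 0 :> M /\ w p%:R = e0 * e%:Z.
Proof.
have -> : p%:R = (p%:R : K)%:A :> M by rewrite -[_%:A]/(in_alg M _) rmorph_nat.
by rewrite alg_neq0 walg ?char0 ?prime_gt0 // ve.
Qed.

(** Here the hypothesis on [al] enters. The worst case is [j = m - 1], [i = p - 1]: since
    [p^m w(mu) = e0 v(al)], the bound [(p - 1)(- v al) < p e] says exactly that [p] outweighs that
    pole. *)
Let root_bound mu : is_root mu ->
  forall j i, (j < m)%N -> (0 < i < p)%N -> vge w (p%:R * (mu ^+ (p ^ j)) ^+ i) 1.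
Proof.
move=> rmu j i jm /andP[i0 ip]; have [p0 wpE] := wp.
have [hmu|nmu] := boolP (vge w mu 0).
  by apply: vgeMr; rewrite ?vgeX0 //; exact: residue_char_val rc.
have mu0 : mu != 0 by apply: contraNneq nmu => ->; rewrite vge0.
have [al0 E] := additive_root_pole rmu nmu.
case: al_bound => [E0|hb]; first by rewrite E0 eqxx in al0.
rewrite vgeE // -ltNge in nmu.
rewrite vgeE ?mulf_neq0 ?expf_neq0 // (dv_mul Hw) ?expf_neq0 // wpE !valX ?expf_neq0 //.
have [d Em] : exists d, m = (j + d.+1)%N by exists (m - j.+1)%N; move: jm; clear; lia.
have pd : (0 < p ^ d)%N by rewrite expn_gt0 prime_gt0.
have pj : (0 < p ^ j)%N by rewrite expn_gt0 prime_gt0.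
move: E; rewrite Em expnD expnSr !PoszM.
have p1 : (1 < p)%N by apply: prime_gt1.
move: (w mu) nmu (v al) hb e00 p1 pd pj i0 ip.
move: (p ^ d)%N (p ^ j)%N => P Q D D0 a hb e00' p1 P0 Q0 i0 ip E.
have h1 : (0 : int) < e0 * (p%:Z * e%:Z + (p%:Z - 1) * a).
  by apply: mulr_gt0 => //; move: hb; clear; lia.
have h2 : Q%:Z * D * (p%:Z - 1) <= D * Q%:Z * i%:Z.
  have : Q%:Z * D <= 0 by move: Q0 D0; clear; nia.
  by move: i0 ip; rewrite [D * _]mulrC; move: (Q%:Z * D) => z; clear; nia.
have h3 : 0 < (P%:Z * p%:Z) * (e0 * e%:Z + Q%:Z * D * (p%:Z - 1)).
  have -> : (P%:Z * p%:Z) * (e0 * e%:Z + Q%:Z * D * (p%:Z - 1)) =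
     (P%:Z - 1) * (p%:Z * (e0 * e%:Z)) + e0 * (p%:Z * e%:Z + (p%:Z - 1) * a).
    transitivity (P%:Z * p%:Z * (e0 * e%:Z) + (p%:Z - 1) * (Q%:Z * (P%:Z * p%:Z) * D)); first by ring.
    by rewrite E; ring.
  by rewrite ltr_wpDl // !mulr_ge0 //; move: P0 e00'; clear; lia.
rewrite pmulr_rgt0 in h3; first by move: h2 h3; clear; lia.
by rewrite mulr_gt0 //; move: P0 p1; clear; lia.
Qed.

Let root_diff mu nu : is_root mu -> is_root nu ->
  [/\ vge w (nu - mu) 0, vge w (additive_eval p m C (nu - mu)) 1 & vge w (nu - mu) 1 -> nu = mu].
Proof.
move=> rm rn.
have [h1 h2 h3] : [/\ vge w (nu - mu) 0, vge w (additive_eval p m C (nu - mu)) 1 &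
    vge w (nu - mu) 1 -> nu - mu = 0].
  apply: (additive_root_diff Hw rc C_int C_monic C_unit (root_bound rm)).
  by rewrite addrC subrK rm rn.
by split => // /h3/eqP; rewrite subr_eq0 => /eqP.
Qed.

(** The residues of [A] already exhaust the at most [p ^ m] roots of the reduced polynomial, so the
    residue of [nu - mu] is one of them. *)
Let root_residue mu nu : is_root mu -> is_root nu ->
  exists i : 'I_(p ^ m), vge w (nu - mu - (nth 0 A i)%:A) 1.
Proof.
move=> rm rn; have [h1 h2 _] := root_diff rm rn; set del := nu - mu in h1 h2 *.
apply: contrapT => H.
have hA i : (i < size A)%N -> vge v (nth 0 A i) 0 by move=> hi; case: (A_root (mem_nth 0 hi)).
pose rs := red del :: [seq red a%:A | a <- A].
have : (size rs <= p ^ m)%N.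
  apply: (additive_root_bound (c := fun j => red (C j)) (prime_gt1 pp)).
  - by rewrite C_monic (red1 Hr) oner_neq0.
  - rewrite /= map_inj_in_uniq.
      apply/andP; split.
        apply/negP => /mapP[a aA /eqP].
        have [ha _] := A_root aA; have ha' : vge w a%:A 0 by rewrite (vge_alg0 e00 walg).
        rewrite (red_eq Hw Hr) // => h; apply: H.
        have ia : (index a A < p ^ m)%N by rewrite -size_A index_mem.
        by exists (Ordinal ia); rewrite /= nth_index.
      apply/(uniqP 0) => i j hi hj E; apply: A_dist => //.
      by rewrite E subrr vge0.
    move=> a b aA bA /eqP; have [ha _] := A_root aA; have [hb _] := A_root bA.
    rewrite (red_eq Hw Hr) ?(vge_alg0 e00 walg) // -scalerBl (vge_alg1 e00 walg) => h.
    rewrite -(nth_index 0 aA) -(nth_index 0 bA); congr nth; apply: A_dist; rewrite ?index_mem //.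
    by rewrite !nth_index.
  - move=> a; rewrite inE => /orP[/eqP ->|/mapP[b bA ->]].
      rewrite -(red_additive_eval _ _ Hw Hr) //; apply/eqP.
      by rewrite (red_eq0 Hr) // additive_eval_int.
    have [hb hPb] := A_root bA; have hb' : vge w b%:A 0 by rewrite (vge_alg0 e00 walg).
    rewrite -(red_additive_eval _ _ Hw Hr) //; apply/eqP.
    rewrite (red_eq0 Hr) ?additive_eval_int // eval_alg (vge_alg1 e00 walg) //.
by rewrite /= size_map size_A ltnn.
Qed.

(** Automorphisms act on a root as translations by elements of [K] modulo the maximal ideal; the two
    composites agree modulo that ideal, and congruent roots are equal. *)
Lemma gal_additive_root_comm s t mu : is_root mu -> s (t mu) = t (s mu).
Proof.
move=> rm; have [i hi] := root_residue rm (gal_root s rm).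
have [j hj] := root_residue rm (gal_root t rm).
have [_ _] := root_diff (gal_root t (gal_root s rm)) (gal_root s (gal_root t rm)); apply.
have hs : vge w (s (t mu - mu - (nth 0 A j)%:A)) 1 by rewrite vgal.
have ht : vge w (t (s mu - mu - (nth 0 A i)%:A)) 1 by rewrite vgal.
rewrite !rmorphB /= gal_alg in hs; rewrite !rmorphB /= gal_alg in ht.
have -> : s (t mu) - t (s mu) = (s (t mu) - s mu - (nth 0 A j)%:A) - (t (s mu) - t mu - (nth 0 A i)%:A)
  + ((s mu - mu - (nth 0 A i)%:A) - (t mu - mu - (nth 0 A j)%:A)) by ring.
by apply: vgeD => //; apply: vgeB.
Qed.

Lemma gal_additive_rootX s mu : is_root mu -> (s ^+ p)%g mu = mu.
Proof.
move=> rm; have [i hi] := root_residue rm (gal_root s rm); set a := nth 0 A i in hi.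
have ha : vge v a 0 by case: (A_root (mem_nth 0 _ : a \in A)); rewrite ?size_A.
have h n : vge w ((s ^+ n)%g mu - mu - (a *+ n)%:A) 1.
  elim: n => [|n IH]; first by rewrite expg0 gal_id mulr0n scale0r !subrr vge0.
  rewrite expgSr galMx.
  have h1 : vge w (s ((s ^+ n)%g mu - mu - (a *+ n)%:A)) 1 by rewrite vgal.
  rewrite !rmorphB /= gal_alg in h1.
  have -> : s ((s ^+ n)%g mu) - mu - (a *+ n.+1)%:A =
     (s ((s ^+ n)%g mu) - s mu - (a *+ n)%:A) + (s mu - mu - a%:A).
    by rewrite mulrS scalerDl; ring.
  exact: vgeD.
have [_ _] := root_diff rm (gal_root (s ^+ p)%g rm); apply.
rewrite -[X in vge w X](subrK (a *+ p)%:A); apply: vgeD => //.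
rewrite (vge_alg1 e00 walg) -mulr_natr; apply: vgeMl => //.
by rewrite vgeE ?char0 ?prime_gt0 // ve; have [_] := wp; have := residue_char_val rc;
  rewrite vgeE ?(proj1 wp) // => h1 E; move: h1; rewrite E; move: e00; clear; nia.
Qed.

Lemma gal_additive_root_fix s mu nu : is_root mu -> is_root nu -> s mu = mu -> s nu = nu.
Proof.
move=> rm rn smu; have [i hi] := root_residue rm rn.
have [_ _] := root_diff rn (gal_root s rn); apply.
have hs : vge w (s (nu - mu - (nth 0 A i)%:A)) 1 by rewrite vgal.
rewrite !rmorphB /= gal_alg smu in hs.
have -> : s nu - nu = (s nu - mu - (nth 0 A i)%:A) - (nu - mu - (nth 0 A i)%:A) by ring.
exact: vgeB.
Qed.

Variable lam : M.
Hypothesis lam_root : is_root lam.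

Lemma index_additive_fixer : (#|[set: gT] : fixer_group lam|%g <= p ^ m)%N.
Proof.
have /choice[g hg] : forall s : gT, exists i : 'I_(p ^ m), vge w (s lam - lam - (nth 0 A i)%:A) 1.
  by move=> s; apply: root_residue (gal_root s lam_root).
rewrite -[(p ^ m)%N]card_ord; apply: (index_le_inj (f := g)) => [|s t _ _ E]; first exact: subsetT.
apply: fixerM; have [_ _] := root_diff (gal_root t lam_root) (gal_root s lam_root); apply.
have -> : s lam - t lam = (s lam - lam - (nth 0 A (g s))%:A) - (t lam - lam - (nth 0 A (g t))%:A).
  by rewrite E; ring.
exact: vgeB.
Qed.

Lemma val_gal_additive_root s : s \notin fixer_group lam -> w (s lam - lam) = 0.
Proof.
rewrite mem_fixer => ne; have [h0 _ h1] := root_diff lam_root (gal_root s lam_root).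
have [] // := val_unit h0; apply/negP => /h1 E.
by rewrite E eqxx in ne.
Qed.

Lemma additive_totram_piece (t : nat) : (0 < m)%N -> al != 0 -> v al = - t%:Z -> (0 < t)%N ->
  coprime t p -> ram_piece p w (fixer_group lam) t%:Z m.
Proof.
move=> m0 al0 val t0 tp.
have nlam : ~~ vge w lam 0.
  apply/negP => hl; have := additive_eval_int p m Hw C_int hl.
  by rewrite lam_root (vge_alg0 e00 walg) vgeE // val oppr_ge0 lez_nat leqNgt t0.
have [_ E] := additive_root_pole lam_root nlam.
have l0 : lam != 0 by apply: contraNneq nlam => ->; rewrite vge0.
apply: (totram_piece galM1 Hv Hw wgal xs_int xs_dense Hr rc abelG e00 walg char0 ve l0 _ m0
  index_additive_fixer (c := - t%:Z)).
- by move=> s; rewrite mem_fixer => /eqP.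
- by rewrite E val.
- by rewrite abszN.
- by move=> s sN; rewrite val_gal_additive_root // sub0r mulrN E val mulrN opprK.
Qed.

(** An inertial [s] moves the integral root [lam] to a congruent one, hence fixes it; and [lam] is
    not in [K], where the equation is insoluble even modulo the maximal ideal. *)
Lemma additive_unramified_piece : m = 1%N -> vge v al 0 ->
  (forall x, vge v x 0 -> ~~ vge v (additive_eval p m c x - al) 1) ->
  ram_piece p w (fixer_group lam) (-1) 1.
Proof.
move=> m1 hal nP.
have hl : vge w lam 0.
  apply: contrapT => /negP nlam; have [al0 E] := additive_root_pole lam_root nlam.
  have l0 : lam != 0 by apply: contraNneq nlam => ->; rewrite vge0.
  rewrite vgeE // -ltNge in nlam; rewrite vgeE // in hal.
  have : (0 < p ^ m)%N by rewrite expn_gt0 prime_gt0.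
  by move: E nlam hal e00; clear; nia.
have iN := index_additive_fixer; have [a Ea] := index_pnat rc abelG (fixer_group lam).
apply: (@unramified_piece p _ _ _ _ galM1 Hw wgal xs_int xs_dense (fixer_group lam) 1%N).
  rewrite Ea m1 leq_exp2l ?prime_gt1 // in iN.
  rewrite Ea; case: a iN Ea => [_|[|//] _ _] //; rewrite expn0 => /eqP.
  rewrite indexg_eq1 => sub.
  have [x Ex] : exists x : K, lam = x%:A.
    by apply: (fixed_algP galM1) => s; apply/eqP; rewrite -mem_fixer (subsetP sub).
  have := nP x; rewrite -(vge_alg0 e00 walg) -Ex => /(_ hl).
  suff -> : additive_eval p m c x = al by rewrite subrr vge0.
  by apply: (alg_inj (M := M)); rewrite -eval_alg -Ex.
apply/subsetP => s /mem_inertia hs; rewrite mem_fixer; apply/eqP.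
by have [_ _] := root_diff lam_root (gal_root s lam_root); apply; apply: hs.
Qed.

End AdditivePiece.

(** * Kummer extensions *)

Lemma val_unity_root_sub1 (F : fieldType) (w : F -> int) (p : nat) (a : F) :
  dvaluation w -> residue_char w p -> p%:R != 0 :> F -> a ^+ p = 1 -> a != 1 ->
  (p%:Z - 1) * w (a - 1) = w p%:R.
Proof.
move=> Hw rc p0 ap a1; have pp : prime p := residue_char_prime rc.
have hp := residue_char_val rc; rewrite vgeE // in hp.
have p1 := prime_gt1 pp.
have ha : vge w a 0 by rewrite -(vgeX_iff _ Hw (prime_gt0 pp)) ap vge_1.
set y := a - 1; have hy : vge w y 0 by apply: vgeB => //; apply: vge_1.
have y0 : y != 0 by rewrite subr_eq0.
have [q Ep] : exists q, p = q.+2 by exists p.-2; lia.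
pose u := \sum_(i < q) ('C(p, i.+2) %/ p)%:R * y ^+ i.
have hu : vge w u 0 by apply: vge_sum => // i _; apply: vgeMl; rewrite ?vge_nat ?vgeX0.
(* The expansion of [(1 + y)^p = 1] divided by [y], with [p] factored out of all terms but the
   last. *)
have E : y ^+ q.+1 = - (p%:R * (1 + y * u)).
  apply/eqP; rewrite -addr_eq0; apply/eqP; apply: (mulfI y0); rewrite mulr0.
  have := ap; rewrite -[a](subrK 1) -/y addrC exprDn Ep.
  rewrite big_ord_recl big_ord_recr big_ord_recl /= /bump /= !add1n !expr1n expr0 bin0 bin1 binn.
  rewrite !mul1r !mulr1n expr1 => /eqP; rewrite -[X in _ == X]addr0 (inj_eq (addrI _)) => /eqP E.
  rewrite -[RHS]E mulrDr -exprS addrC; congr (_ + _).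
  rewrite -Ep mulrDr mulr1 mulrDr [y * p%:R]mulrC [p%:R * y]mulr_natl; congr (_ + _).
  rewrite /u !mulr_sumr; apply: eq_bigr => i _; rewrite !add1n expr1n mul1r.
  have /dvdnP[d Ed] : (p %| 'C(p, i.+2))%N by apply: prime_dvd_bin => //; move: (ltn_ord i) Ep; clear; lia.
  rewrite Ed mulnK ?prime_gt0 // -[RHS]mulr_natr natrM !exprS; ring.
have hyu : vge w (y * u) 1.
  have hyq : vge w (y ^+ q.+1) 1.
    rewrite E vgeN //; apply: vgeMr => //; first exact: residue_char_val rc.
    by apply: vgeD => //; [apply: vge_1|apply: vgeMl].
  apply: vgeMr => //; move: hyq; rewrite !vgeE ?expf_neq0 // valX //.
  by move: (w y) => x; clear; nia.
have h1 : w 1 + 1 = 1 by rewrite (dval1 Hw).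
have [n0 E0] := val_addl Hw (oner_neq0 F) (eq_ind_r (fun n => vge w (y * u) n) hyu h1).
have := congr1 w E; rewrite valX // valN // (dv_mul Hw) // E0 (dval1 Hw) addr0 => <-.
by rewrite mulrC Ep; congr (_ * _); clear; lia.
Qed.

Section KummerPiece.
Variables (p : nat) (K : fieldType) (v : K -> int) (M : splittingFieldType K) (w : M -> int).
Variables (xs : M) (k : finFieldType) (red : M -> k) (e0 : int) (e : nat).
Hypothesis galM1 : galois 1%AS {:M}.
Hypothesis Hv : dvaluation v.
Hypothesis Hw : dvaluation w.
Notation gT := (gal_of {:M}).
Implicit Types (s t : gT).
Hypothesis wgal : forall (s : gT) x, w (s x) = w x.
Hypothesis xs_int : vge w xs 0.
Hypothesis xs_dense : zdense w xs.
Hypothesis Hr : residue_map w red.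
Hypothesis rc : residue_char w p.
Hypothesis abelG : (p.-abelem [set: gT])%g.
Hypothesis e00 : 0 < e0.
Hypothesis walg : forall c : K, c != 0 -> w c%:A = e0 * v c.
Hypothesis char0 : forall n : nat, (0 < n)%N -> n%:R != 0 :> K.
Hypothesis ve : v p%:R = e%:Z.

Let pp : prime p. Proof. exact: residue_char_prime rc. Qed.

Variables (z pi : K).
Hypothesis z_prim : p.-primitive_root z.
Hypothesis pi0 : pi != 0.
Hypothesis vpi : v pi = 1.
Let is_root (mu : M) := mu ^+ p = pi%:A.

Let root_neq0 mu : is_root mu -> mu != 0.
Proof.
move=> E; have : pi%:A != 0 :> M by rewrite alg_neq0.
by rewrite -E expf_eq0 prime_gt0.
Qed.

Let root_ratio mu nu : is_root mu -> is_root nu -> exists i : 'I_p, nu = (z ^+ i)%:A * mu.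
Proof.
move=> rm rn; have mu0 := root_neq0 rm.
have zM : p.-primitive_root (in_alg M z) by rewrite fmorph_primitive_root.
have [i Ei] : {i : 'I_p | nu / mu = in_alg M z ^+ i}.
  by apply: (prim_rootP zM); rewrite expr_div_n rm rn divff // alg_neq0.
by exists i; rewrite -[_%:A]/(in_alg M _) rmorphXn -Ei divfK.
Qed.

Let gal_root s mu : is_root mu -> is_root (s mu).
Proof. by rewrite /is_root => E; rewrite -rmorphXn /= E gal_alg. Qed.

Lemma gal_kummer_root_comm s t mu : is_root mu -> s (t mu) = t (s mu).
Proof.
move=> rm; have [i Ei] := root_ratio rm (gal_root s rm).
have [j Ej] := root_ratio rm (gal_root t rm).
by rewrite Ei Ej !rmorphM /= !gal_alg Ei Ej mulrCA.
Qed.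

Lemma gal_kummer_rootX s mu : is_root mu -> (s ^+ p)%g mu = mu.
Proof.
move=> rm; have [i Ei] := root_ratio rm (gal_root s rm).
have h n : (s ^+ n)%g mu = (z ^+ i ^+ n)%:A * mu.
  elim: n => [|n IH]; first by rewrite expg0 gal_id expr0 scale1r mul1r.
  rewrite expgSr galMx IH rmorphM /= gal_alg Ei mulrA; congr (_ * _).
  by rewrite -!/(in_alg M _) -rmorphM -exprSr.
by rewrite h exprAC (prim_expr_order z_prim) expr1n scale1r mul1r.
Qed.

Lemma gal_kummer_root_fix s mu nu : is_root mu -> is_root nu -> s mu = mu -> s nu = nu.
Proof.
move=> rm rn E; have [i ->] := root_ratio rm rn.
by rewrite rmorphM /= gal_alg E.
Qed.

Variable lam : M.
Hypothesis lam_root : is_root lam.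

(** [lam] has value [1 / p] in terms of [v], and [s lam / lam - 1 = z^i - 1] has value
    [e / (p - 1) = t / p]. *)
Lemma kummer_piece (t : nat) : (p%:Z - 1) * t%:Z = p%:Z * e%:Z ->
  ram_piece p w (fixer_group lam) t%:Z 1.
Proof.
move=> Et; have l0 := root_neq0 lam_root.
have /choice[g hg] : forall s : gT, exists i : 'I_p, s lam = (z ^+ i)%:A * lam.
  by move=> s; apply: root_ratio (gal_root s lam_root).
apply: (@totram_piece p _ _ _ _ _ _ _ _ _ galM1 Hv Hw wgal xs_int xs_dense Hr rc abelG e00 walg
  char0 ve (fixer_group lam) lam 1 t 1 l0) => //.
- by move=> s; rewrite mem_fixer => /eqP.
- rewrite expn1 -[p in (_ <= p)%N]card_ord; apply: (index_le_inj (f := g)) => [|s s' _ _ E].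
    exact: subsetT.
  by apply: fixerM; rewrite !hg E.
- by rewrite expn1 mulrC -valX // lam_root walg // vpi.
- by rewrite (coprime1n p).
- move=> s; rewrite mem_fixer hg expn1 => ne.
  set a := z ^+ g s in ne *; have a1 : a != 1.
    by apply: contraNneq ne => ->; rewrite scale1r mul1r.
  have ap : a ^+ p = 1 by rewrite exprAC (prim_expr_order z_prim) expr1n.
  have -> : a%:A * lam - lam = (a - 1)%:A * lam by rewrite scalerBl scale1r mulrBl mul1r.
  have am : a - 1 != 0 by rewrite subr_eq0.
  rewrite (dv_mul Hw) ?alg_neq0 // addrK walg // mulrCA; congr (_ * _).
  have rcv : residue_char v p.
    split => //; have := residue_char_val rc.
    have -> : p%:R = (p%:R : K)%:A :> M by rewrite -[_%:A]/(in_alg M _) rmorph_nat.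
    by rewrite (vge_alg1 e00 walg).
  have := val_unity_root_sub1 Hv rcv (char0 (prime_gt0 pp)) ap a1; rewrite ve.
  have : (p%:Z - 1) != 0 by have := prime_gt1 pp; clear; lia.
  move: Et; set P := p%:Z => Et P1 Ea; apply: (mulfI P1).
  by rewrite Et -Ea; ring.
Qed.

End KummerPiece.

(** * Compositum of extensions with prescribed jumps *)

Lemma gal_fix_splitting (K : fieldType) (L : splittingFieldType K) (Q : {poly L}) (s : gal_of {:L}) :
  splittingFieldFor 1 Q {:L} -> (forall x, root Q x -> s x = x) -> s = 1%g.
Proof.
case=> rs EQ gen sfix; apply: gal_ext => x; rewrite gal_id.
have : (<<1%AS & rs>> <= fixedField [set s])%VS.
  apply/Fadjoin_seqP; split=> [|y yrs]; first exact: sub1v.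
  apply/fixedFieldP => [|t]; rewrite ?memvf // inE => /eqP ->; apply: sfix.
  by rewrite (eqp_root EQ) root_prod_XsubC.
rewrite gen => /subvP /(_ x (memvf _)) /fixedFieldP; apply; rewrite ?memvf //.
by rewrite inE.
Qed.

Lemma splitting_factor_root (K : fieldType) (L : splittingFieldType K) (Q R : {poly K}) :
  splittingFieldFor 1 (map_poly (in_alg L) Q) {:L} -> R %| Q -> (1 < size R)%N ->
  exists x, root (map_poly (in_alg L) R) x.
Proof.
case=> rs EQ _ RQ sR.
have : map_poly (in_alg L) R %| \prod_(z <- rs) ('X - z%:P).
  by rewrite -(eqp_dvdr _ EQ) dvdp_map.
case/dvdp_prod_XsubC => mk E.
have : size (map_poly (in_alg L) R) = (size (mask mk rs)).+1.
  by rewrite (eqp_size E) size_prod_XsubC.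
rewrite size_map_poly; case Em: (mask mk rs) => [|x l] /= sz; first by rewrite sz in sR.
by exists x; rewrite (eqp_root E) root_prod_XsubC Em mem_head.
Qed.

(* Relative to any Galois [M] containing a root, so that several such polynomials can be combined
   in one compositum; elementary abelianness of [M] itself is only known after combining them. *)
Definition jump_poly (p : nat) (K : fieldType) (v : K -> int) (t : int) (m : nat) (R : {poly K}) :=
  (1 < size R)%N /\
  forall (M : splittingFieldType K) (w : M -> int) (xs : M) (k : finFieldType) (red : M -> k) e0,
    galois 1%AS {:M} -> @ramification_frame p K v M w xs k red e0 ->
  forall lam, root (map_poly (in_alg M) R) lam ->
  [/\ forall s t : gal_of {:M}, s (t lam) = t (s lam),
      forall s : gal_of {:M}, (s ^+ p)%g lam = lam,
      forall (s : gal_of {:M}) mu, root (map_poly (in_alg M) R) mu -> s lam = lam -> s mu = mu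
    & (p.-abelem [set: gal_of {:M}])%g -> ram_piece p w (fixer_group lam) t m].

Section JumpPoly.
Variables (p : nat) (K : fieldType) (v : K -> int) (e f : nat).
Hypothesis pp : prime p.
Hypothesis pf : padic_field p v e f.
Let Hv := pf_val pf.

Let uniformizer : exists2 pi : K, pi != 0 & v pi = 1.
Proof. by have [pi [pi0 vpi]] := dv_norm Hv; exists pi. Qed.

Let additive_poly m (c : nat -> K) al := \sum_(j < m.+1) c j *: 'X^(p ^ j) - al%:P : {poly K}.

Let size_additive_poly m c al : c m = 1 -> (1 < size (additive_poly m c al))%N.
Proof.
move=> cm; have pm : (0 < p ^ m)%N by rewrite expn_gt0 prime_gt0.
have -> : size (additive_poly m c al) = (p ^ m).+1; last by rewrite ltnS.
rewrite /additive_poly big_ord_recr /= cm scale1r addrAC addrC size_polyDl size_polyXn //.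
rewrite ltnS; apply: (leq_trans (size_polyD _ _)); rewrite geq_max size_polyN.
rewrite (leq_trans (size_polyC_leq1 _)) // andbT.
apply: (leq_trans (size_sum _ _ _)); apply/bigmax_leqP => j _.
by apply: (leq_trans (size_scale_leq _ _)); rewrite size_polyXn ltn_exp2l ?prime_gt1.
Qed.

Let root_additive_poly (M : splittingFieldType K) m (c : nat -> K) al (x : M) :
  root (map_poly (in_alg M) (additive_poly m c al)) x ->
  additive_eval p m (fun j => (c j)%:A) x = al%:A.
Proof.
rewrite /root /additive_poly rmorphB rmorph_sum /= map_polyC !hornerE horner_sum subr_eq0.
move/eqP => E; apply: etrans E; apply: eq_bigr => j _.
by rewrite linearZ /= map_polyXn hornerZ hornerXn.
Qed.

Lemma jump_poly_coprime (t : int) (m : nat) : 1 <= t -> (p%:Z - 1) * t < p%:Z * e%:Z ->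
  coprime `|t| p -> (0 < m <= f)%N -> exists R, jump_poly p v t m R.
Proof.
move=> t1 tb tp /andP[m0 mf].
have [c [A [cm ci cu sA [rA dA _]]]] := additive_lift_exists pp pf mf.
have [pi pi0 vpi] := uniformizer; pose al := (pi ^+ `|t|)^-1.
(* The pole of order [t] of [al] becomes the jump, because conjugate roots differ by units. *)
have al0 : al != 0 by rewrite invr_neq0 // expf_neq0.
have Et : t = `|t|%N by move: t1; clear; lia.
have val : v al = - t by rewrite valV ?expf_neq0 // valX // vpi mul1r -Et.
have alb : al = 0 \/ (p%:Z - 1) * - v al < p%:Z * e%:Z by right; rewrite val opprK.
exists (additive_poly m c al); split; first exact: size_additive_poly.
move=> M w xs k red e0 galM1 [Hw wgal xs_int xs_dense Hr rc e00 walg] lam /root_additive_poly rl.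
have char0 := pf_char0 pf; have ve := pf_e pf.
split.
- move=> s u; exact: (gal_additive_root_comm Hw wgal Hr rc e00 walg char0 ve ci cm cu sA rA dA alb).
- move=> s; exact: (gal_additive_rootX Hv Hw wgal Hr rc e00 walg char0 ve ci cm cu sA rA dA alb).
- move=> s mu /root_additive_poly rm.
  exact: (gal_additive_root_fix Hw wgal Hr rc e00 walg char0 ve ci cm cu sA rA dA alb).
- move=> abelG; rewrite {1}Et.
  apply: (additive_totram_piece galM1 Hv Hw wgal xs_int xs_dense Hr rc abelG e00 walg char0 ve
    ci cm cu sA rA dA alb) => //; first by rewrite -Et.
  by move: t1; clear; lia.
Qed.

Lemma jump_poly_unramified : (0 < f)%N -> exists R, jump_poly p v (-1) 1 R.
Proof.
move=> f0; have [c [A [cm ci cu sA [rA dA]]]] := additive_lift_exists pp pf f0.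
case=> // al hal nal.
have alb : al = 0 \/ (p%:Z - 1) * - v al < p%:Z * e%:Z.
  have [->|al0] := eqVneq al 0; [by left|right].
  by rewrite vgeE // in hal; have := prime_gt1 pp; have := pf_e_pos pf; move: hal; clear; nia.
exists (additive_poly 1 c al); split; first exact: size_additive_poly.
move=> M w xs k red e0 galM1 [Hw wgal xs_int xs_dense Hr rc e00 walg] lam /root_additive_poly rl.
have char0 := pf_char0 pf; have ve := pf_e pf.
split.
- move=> s u; exact: (gal_additive_root_comm Hw wgal Hr rc e00 walg char0 ve ci cm cu sA rA dA alb).
- move=> s; exact: (gal_additive_rootX Hv Hw wgal Hr rc e00 walg char0 ve ci cm cu sA rA dA alb).
- move=> s mu /root_additive_poly rm.
  exact: (gal_additive_root_fix Hw wgal Hr rc e00 walg char0 ve ci cm cu sA rA dA alb).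
- move=> abelG.
  exact: (additive_unramified_piece galM1 Hw wgal xs_int xs_dense Hr rc abelG e00 walg char0 ve
    ci cm cu sA rA dA alb).
Qed.

Lemma jump_poly_kummer (z : K) (t : int) : p.-primitive_root z -> 0 <= t ->
  (p%:Z - 1) * t = p%:Z * e%:Z -> exists R, jump_poly p v t 1 R.
Proof.
move=> zp t0 Et; have [pi pi0 vpi] := uniformizer.
exists ('X^p - pi%:P); split; first by rewrite size_XnsubC ?prime_gt0 // ltnS prime_gt0.
have root_eq (M : splittingFieldType K) (x : M) :
    root (map_poly (in_alg M) ('X^p - pi%:P)) x -> x ^+ p = pi%:A.
  by rewrite /root rmorphB /= map_polyXn map_polyC !hornerE subr_eq0 => /eqP.
move=> M w xs k red e0 galM1 [Hw wgal xs_int xs_dense Hr rc e00 walg] lam /root_eq rl.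
have char0 := pf_char0 pf; have ve := pf_e pf.
split.
- move=> s u; exact: (gal_kummer_root_comm rc zp pi0).
- move=> s; exact: (gal_kummer_rootX rc zp pi0).
- by move=> s mu /root_eq rm; apply: (gal_kummer_root_fix rc zp pi0).
- move=> abelG; case: t t0 Et => // t _ Et.
  exact: (kummer_piece galM1 Hv Hw wgal xs_int xs_dense Hr rc abelG e00 walg char0 ve zp pi0 vpi).
Qed.

End JumpPoly.

Lemma padic_f_gt0 (p : nat) (K : fieldType) (v : K -> int) (e f : nat) :
  padic_field p v e f -> (0 < f)%N.
Proof.
move=> pf; have Hv := pf_val pf; have [s [ss _ _ cov]] := pf_f pf.
rewrite lt0n; apply/eqP => f0; rewrite f0 expn0 in ss.
case: s ss cov => // y [] // _ cov.
have [y1 h1 d1] := cov 1 (vge_1 Hv); have [y2 h2 d2] := cov 0 (vge0 v 0).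
move: h1 h2 d1 d2; rewrite !inE => /eqP -> /eqP -> d1 d2.
rewrite vgeBC // in d2; have := vge_trans Hv d1 d2.
by rewrite subr0 vgeE ?oner_neq0 // (dval1 Hv).
Qed.

Lemma jump_extension_exists (p : nat) (K : fieldType) (v : K -> int) (e f h : nat)
    (t : 'I_h -> int) (m : 'I_h -> nat) :
  prime p -> padic_field p v e f -> (forall i j : 'I_h, (i < j)%N -> t i < t j) ->
  (forall i, (0 < m i)%N) -> (forall i, exists R, jump_poly p v (t i) (m i) R) ->
  exists M : splittingFieldType K, [/\ galois 1%AS {:M}, (p.-abelem 'Gal({:M} / 1%AS))%g
    & exists w : M -> int, ext_val v w /\ has_upper_jumps w p t (fun i => (m i)%:Z)].
Proof.
move=> pp pf tinc m0 /choice[R HR]; pose Q := \prod_i R i.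
have R0 i : R i != 0 by rewrite -size_poly_gt0; case: (HR i) => /ltnW.
have [M splitM] : exists M : splittingFieldType K, splittingFieldFor 1 (map_poly (in_alg M) Q) {:M}.
  by apply: splitting_field_exists; apply/prodf_neq0 => i _.
have galM1 := char0_splitting_galois M (pf_char0 pf).
have [w Hext] := ext_val_exists galM1 (pf_val pf) (pf_complete pf).
have [xs [k [red [e0 frame]]]] := ramification_frame_exists pp pf galM1 Hext.
have /choice[lam rlam] i : exists x, root (map_poly (in_alg M) (R i)) x.
  apply: splitting_factor_root splitM _ _; last by case: (HR i).
  by rewrite /Q (bigD1 i) //= dvdp_mulIl.
have props i := (HR i).2 M w xs k red e0 galM1 frame (lam i) (rlam i).
(* Fixing one root of each [R i] fixes all its roots; so commutators and [p]-th powers, which fix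
   every [lam i], are trivial. *)
have fix1 (s : gal_of {:M}) : (forall i, s (lam i) = lam i) -> s = 1%g.
  move=> sl; apply: (gal_fix_splitting splitM) => x.
  rewrite /Q rmorph_prod /root horner_prod /= => /eqP/eqP/prodf_eq0[i _ rx].
  by have [_ _ + _] := props i; apply.
have abelG : (p.-abelem [set: gal_of {:M}])%g.
  apply/abelemP => //; split.
    apply/centsP => s _ u _; rewrite /commute; apply/eqP; rewrite eq_mulgV1; apply/eqP.
    apply: fix1 => i; have [comm _ _ _] := props i.
    by rewrite galMx (_ : (s * u)%g (lam i) = (u * s)%g (lam i)) ?galVK // !galMx comm.
  by move=> s _; apply: fix1 => i; have [_ sp _ _] := props i.
have [Hw wgal xs_int xs_dense _ _ _ _] := frame.
pose G u : {group gal_of {:M}} := Group (upper_ram_group_set galM1 Hw wgal xs_int xs_dense u).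
have piece i : ram_piece p w (fixer_group (lam i)) (t i) (m i).
  by have [_ _ _] := props i; apply.
have Ganti u u' : u <= u' -> G u' \subset G u := @upper_ram_anti _ _ _ _ galM1 Hw wgal xs_int xs_dense u u'.
have idx i : #|[set: gal_of {:M}] : fixer_group (lam i)|%g = (p ^ m i)%N by case: (piece i).
have full i s : exists2 r, r \in fixer_group (lam i) & (r * s)%g \in G (t i)%:~R.
  by have [_ + _] := piece i; apply.
have sub i u : (t i)%:~R < u -> G u \subset fixer_group (lam i).
  by have [_ _] := piece i; apply.
have cap s : (forall i, s \in fixer_group (lam i)) -> s = 1%g.
  by move=> hs; apply: fix1 => i; apply/eqP; rewrite -mem_fixer.
exists M; split => //; first by rewrite galT.
exists w; split => //; split=> [s|i].
  exact: (pieces_jump (prime_gt1 pp) Ganti tinc m0 idx full sub cap).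
by rewrite (pieces_card (prime_gt1 pp) Ganti tinc idx full sub cap) natrM natrX.
Qed.

Theorem theorem12 (p : nat) (K : fieldType) (v : K -> int) (e f : nat)
    (h : nat) (t m : 'I_h -> int) :
  prime p -> padic_field p v e f ->
  (forall i j : 'I_h, (i < j)%N -> t i < t j) ->
  ((exists (M : splittingFieldType K),
      [/\ galois 1%AS {:M}, (p.-abelem 'Gal({:M} / 1%AS))%g
        & exists w : M -> int, ext_val v w /\ has_upper_jumps w p t m])
   <->
   ((forall i : 'I_h,
       [\/ [/\ 1 <= t i, (p%:Z - 1) * t i < p%:Z * e%:Z & coprime `|t i|%N p],
           (i : nat) = 0%N /\ t i = -1
         | [/\ (i : nat) = h.-1, (exists z : K, p.-primitive_root z)
             & (p%:Z - 1) * t i = p%:Z * e%:Z]]) /\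
    (forall i : 'I_h,
       [/\ 1 <= m i <= f%:Z,
           ((i : nat) = 0%N -> t i = -1 -> m i = 1)
         & ((i : nat) = h.-1 -> (p%:Z - 1) * t i = p%:Z * e%:Z -> m i = 1)])))
  /\
  (forall (M : splittingFieldType K) (w : M -> int),
      galois 1%AS {:M} -> (p.-abelem 'Gal({:M} / 1%AS))%g ->
      ext_val v w -> has_upper_jumps w p t m ->
      (\dim {:M})%:R = (p%:R : rat) ^ (\sum_(i < h) m i)).
Proof.
move=> pp pf tinc; have p1 := prime_gt1 pp; have e_gt0 := pf_e_pos pf.
have f_gt0 := padic_f_gt0 pf.
split; last first.
  move=> M w galM1; rewrite galT => abelG Hext Hj.
  have [U HU _] := upper_value_exists pp pf galM1 abelG Hext.
  rewrite -(card_gal_jumps HU (prime_gt0 pp) tinc Hj) -galT.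
  by rewrite -(galois_dim galM1) dimv1 divn1.
split=> [[M [galM1 abelG [w [Hext Hj]]]]|[Ht Hm]]; last first.
  have Em i : (`|m i|%N)%:Z = m i by have [+ _ _] := Hm i; move: (m i) => a; clear; lia.
  have m_gt0 i : (0 < `|m i|)%N.
    by rewrite -ltz_nat Em; have [+ _ _] := Hm i; move: (m i) => a; clear; lia.
  have polys i : exists R, jump_poly p v (t i) `|m i| R.
    have [mf m_unram m_kummer] := Hm i; case: (Ht i) => [[t1 tb tp]|[i0 ti]|[ih [z zp] ti]].
    - apply: (jump_poly_coprime pp pf) => //.
      by move: mf; move: (m i) => a; clear; lia.
    - by rewrite ti m_unram //; apply: (jump_poly_unramified pp pf).
    - rewrite m_kummer //; apply: (jump_poly_kummer pp pf zp) => //.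
      by move: ti p1 e_gt0; move: (t i) => a; clear; nia.
  have [M [galM1 abelG [w [Hext [Hj Hs]]]]] := jump_extension_exists pp pf tinc m_gt0 polys.
  exists M; split => //; exists w; split => //; split => // i.
  by rewrite Hs Em.
rewrite galT in abelG.
have [U HU Hjump] := upper_value_exists pp pf galM1 abelG Hext.
have [Hj1 Hj2] := Hj.
(* The given [m i] is only an integer; both it and the natural number [m'] are exponents of [p] for
   the same index, hence equal. *)
have cond i : exists2 m' : nat, m i = m'%:Z & jump_conditions p e f w (t i) m'.
  have /(upper_jumpP HU)[s s1 Us] : upper_jump w (t i) by apply/Hj1; exists i.
  have [m' jc] := Hjump _ s1; rewrite Us in jc; exists m' => //.
  have [card_t _ _] := jc; have := Hj2 i; rewrite card_t natrM natrX => E.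
  have c0 : #|upper_ram w (t i + 1)%:~R|%:R != 0 :> rat.
    rewrite pnatr_eq0 -lt0n; apply/card_gt0P; exists 1%g; by rewrite HU eqxx.
  have /(mulIf c0) E' := E.
  have pq : 0 < p%:R :> rat by rewrite ltr0n prime_gt0.
  have pq1 : p%:R != 1 :> rat by rewrite pnatr_eq1 neq_ltn p1 orbT.
  by apply/esym; apply: (ieexprIz pq pq1).
(* The exceptional values are the extremes of the permitted range, so strict monotonicity places
   them at the first and last indices. *)
have t_ge i : -1 <= t i.
  by have [m' _ [_ _ [[-> _]|[h1 _ _ _]|[h1 _ _ _]]]] := cond i => //; move: h1; clear; lia.
have t_le i : (p%:Z - 1) * t i <= p%:Z * e%:Z.
  have [m' _ [_ _ [[-> _]|[_ _ _ /ltW//]|[_ _ -> _]]]] := cond i => //.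
  by move: p1; clear; nia.
split=> i; have [m' Em [_ m'0 jc]] := cond i.
  case: jc => [[ti _]|[t1 _ tp tb]|[t1 _ ti z]].
  - apply: Or32; split => //; have h0 : (0 < h)%N by apply: leq_ltn_trans (ltn_ord i).
    case: (posnP i) => // i0; have := tinc (Ordinal h0) i i0.
    by rewrite ti ltNge t_ge.
  - by apply: Or31.
  - apply: Or33; split => //; have h1 : (h.-1 < h)%N by rewrite ltn_predL; apply: leq_ltn_trans (ltn_ord i).
    have [lt|gt|//] := ltngtP (i : nat) h.-1; last by have := ltn_ord i; move: gt h1; clear; lia.
    have := tinc i (Ordinal h1) lt; have := t_le (Ordinal h1); rewrite -ti.
    by rewrite ler_pM2l ?subr_gt0 ?ltz_nat // leNgt => /negP.
split.
- rewrite Em !lez_nat m'0 /=.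
  by case: jc => [[_ ->]|[_ -> _ _]|[_ -> _ _]].
- move=> _ ti; case: jc => [[_ m1]|[t1 _ _ _]|[t1 _ _ _]]; first by rewrite Em m1.
    by rewrite ti in t1.
  by rewrite ti in t1.
- move=> _ ti; case: jc => [[_ m1]|[_ _ _]|[_ m1 _ _]]; rewrite ?Em ?m1 //.
  by rewrite ti ltxx.
Qed.
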